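(* Let $\varepsilon>0$, $f\in\mathbb R[x]_{2d}$ and $g_i\in\mathbb R[x]_{2d_i}$ for $i=0,\dots,m$, with $g_0=1$ and $g_1=c(R-\|x\|_{\ell_2}^2)$ for some $c>0$ and $R>0$. Suppose $\|g_i\|_{\ell_1}\le1$ for $i=1,\dots,m$. Let $S(g)=\{x\in\mathbb R^n: g_i(x)\ge0,\ i=1,\dots,m\}$ and $f^\star=\inf_{x\in S(g)}f(x)$. Assume that this problem has an optimal solution $x^\star$ with $\|x^\star\|_{\ell_1}\le r$, where $r\in(0,1)$, and that the second-order sufficient optimality conditions hold at every optimal solution. Then there exists $K\in\mathbb N$ such that $\lambda_k=f^\star$ for all $k\ge K$, where $\lambda_k$ is the value of the order-$k$ sum-of-squares relaxation. Moreover, for such $k$: if there exist $\underline\lambda\in\mathbb R$ and a positive measure $\mu$ supported on $S(g)$ with $\underline\lambda\le\lambda_k$ and $\int(f-\underline\lambda)\,d\mu\,/\,\lambda_{\min}(D_k(g\mu))\le1$, and $\lambda_k^{(\varepsilon)}$ denotes the value returned by the algorithm CON (described in the context) run with $\varepsilon$, $\underline\lambda$ and a point $a\in S(g)$, then $$0\le\lambda_k^{(\varepsilon)}-f^\star\le\varepsilon\left(2+\frac r{1-r}\right).$$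
   Context: Second-order sufficient optimality conditions at $x^\star\in S(g)$. Let $\mathcal L(x,\eta)=f(x)-\sum_{i=1}^m\eta_ig_i(x)$, $J(x^\star)=\{i\in\{1,\dots,m\}: g_i(x^\star)=0\}$ and $\Lambda=\{\nabla g_i(x^\star)\}_{i\in J(x^\star)}$. The conditions are: (1) KKT: there is $\eta^\star\in\mathbb R^m_+$ with $\nabla_x\mathcal L(x^\star,\eta^\star)=0$ and $\eta_i^\star g_i(x^\star)=0$ for all $i$; (2) strict complementarity: $\eta_i^\star+g_i(x^\star)>0$ for all $i$; (3) the family $\Lambda$ is linearly independent; (4) $u^\top\nabla_x^2\mathcal L(x^\star,\eta^\star)u>0$ for all $u\in\operatorname{span}(\Lambda)^\perp\setminus\{0\}$. Notation. $\mathbb N^n_t=\{\alpha\in\mathbb N^n:|\alpha|\le t\}$; $\mathbb R[x]_t$: real polynomials in $x=(x_1,\dots,x_n)$ of degree at most $t$; $f=\sum f_\alpha x^\alpha$, $g_i=\sum g_{i,\alpha}x^\alpha$; $d=\lceil\deg(f)/2\rceil$, $d_i=\lceil\deg(g_i)/2\rceil$; relaxation orders satisfy $k\ge\max\{d,d_0,\dots,d_m\}$; $\|p\|_{\ell_1}$ is the sum of absolute values of the coefficients of $p$; $v_t=(x^\alpha)_{\alpha\in\mathbb N^n_t}$; $\mathbb S^N$: real symmetric $N\times N$ matrices. For $y=(y_\alpha)_{\alpha\in\mathbb N^n_{2k}}$: $M_{k-d_i}(g_iy)=(\sum_\gamma g_{i,\gamma}y_{\alpha+\beta+\gamma})_{\alpha,\beta\in\mathbb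 N^n_{k-d_i}}$ and $D_k(gy)=\operatorname{diag}((M_{k-d_i}(g_iy))_{i=0,\dots,m})$. For a measure $\mu$ with finite moments, $D_k(g\mu)=D_k(gy)$ with $y_\alpha=\int x^\alpha d\mu$. $\lambda_{\min}(\cdot)$ of a matrix is its smallest eigenvalue (implicitly positive in the quotient above). SOS relaxation: $\lambda_k=\sup\{\lambda:\ \lambda\in\mathbb R,\ G=\operatorname{diag}(G_0,\dots,G_m)\succeq0,\ f-\lambda=\sum_{i=0}^mg_iv_{k-d_i}^\top G_iv_{k-d_i}\}$. Hamiltonian updates HU. Input: $\varepsilon>0$, $A'_1,\dots,A'_{M'}\in\mathbb S^N$, $b'_1,\dots,b'_{M'}\in\mathbb R$ (encoding: find $X\succeq0$ with $\operatorname{tr}X=1$, $\operatorname{tr}(A'_jX)\le b'_j$ for all $j$). Set $W^{(1)}=I_N$ and $T'=\lceil 16\log(N)/\varepsilon^2\rceil$. For $t=1,\dots,T'$: set $P^{(t)}=W^{(t)}/\operatorname{tr}(W^{(t)})$; if some $j^{(t)}$ satisfies $\operatorname{tr}(A'_{j^{(t)}}P^{(t)})>b'_{j^{(t)}}+\varepsilon$, choose one and set $M^{(t)}=\frac12(I_N-A'_{j^{(t)}})$; otherwise stop with output $\eta=1$. Set $W^{(t+1)}=\exp\big(\frac{\varepsilon}{4}\sum_{s=1}^tM^{(s)}\big)$. If the loop completes, output $\eta=0$. Binary search BS. Input: $C,A_1,\dots,A_M\in\mathbb S^N$, $b\in\mathbb R^M$, reals $\lambda_{\min}<\lambda_{\max}$,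 $\varepsilon>0$. Set $\underline\lambda_0=\lambda_{\min}$, $\overline\lambda_0=\lambda_{\max}$, $T=\lceil\log_2((\lambda_{\max}-\lambda_{\min})/\varepsilon)\rceil$ (no iterations if $T\le 0$). For $t=0,\dots,T-1$: let $\lambda_t=(\underline\lambda_t+\overline\lambda_t)/2$; run HU with accuracy $\varepsilon$ on the constraints $\operatorname{tr}(A_iX)\le b_i$, $\operatorname{tr}(-A_iX)\le -b_i$ ($i=1,\dots,M$), $\operatorname{tr}(CX)\le\lambda_t$; if $\eta=0$ set $(\underline\lambda_{t+1},\overline\lambda_{t+1})=(\lambda_t,\overline\lambda_t)$, if $\eta=1$ set $(\underline\lambda_{t+1},\overline\lambda_{t+1})=(\underline\lambda_t,\lambda_t)$. Output: the final lower value $\underline\lambda_T$. Algorithm CON. For $i=0,\dots,m$ and $\eta\in\mathbb N^n$, let $B_i^{(\eta)}$ be the matrix indexed by $\mathbb N^n_{k-d_i}$ with $(\alpha,\beta)$-entry $1$ if $\alpha+\beta=\eta$ and $0$ otherwise. For $\gamma\in\mathbb N^n_{2k}$ put $B_g^{(\gamma)}=\operatorname{diag}\big(\big(\sum_{\zeta\in\mathbb N^n_{2d_i},\,\gamma-\zeta\in\mathbb N^n}g_{i,\zeta}B_i^{(\gamma-\zeta)}\big)_{i=0,\dots,m}\big)$. Enumerate $\mathbb N^n_{2k}=\{\gamma_0=0,\gamma_1,\dots,\gamma_M\}$, $M=\binom{n+2k}{n}-1$. Put $C=\operatorname{diag}(B_g^{(0)},0)$, $A_i=\operatorname{diag}(B_g^{(\gamma_i)},0)$,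 $b_i=f_{\gamma_i}$ ($i=1,\dots,M$), of size $N=1+\sum_{i=0}^m\binom{n+k-d_i}{n}$; $\lambda_{\min}=f_0-f(a)$, $\lambda_{\max}=f_0-\underline\lambda$ (with $\lambda_{\min}<\lambda_{\max}$ as required by BS). Run BS and return $\lambda_k^{(\varepsilon)}=f_0-\underline\lambda_T$. *)

(* Defs.v *)
From HB Require Import structures.
From mathcomp Require Import all_boot all_order all_algebra.
From mathcomp Require Import all_classical all_reals all_analysis.
(* The notations of mpoly clash with those of MathComp-Analysis. *)
From mathcomp Require mpoly.
Export -(notations) mpoly.

Set Implicit Arguments.
Unset Strict Implicit.
Unset Printing Implicit Defensive.

Import Order.TTheory GRing.Theory Num.Theory.
Import numFieldNormedType.Exports.

Local Open Scope classical_set_scope.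
Local Open Scope ring_scope.

Notation borelRn R n := (g_sigma_algebraType (@open 'rV[R]_n)).

Section Polynomials.
Variables (R : realType) (n : nat).
Implicit Types (p : mpoly n R) (x : 'rV[R]_n).

Definition peval p x : R := meval (x 0) p.

(* The degree of the zero polynomial is taken to be 0. *)
Definition pdeg p : nat := (mmeasure mdeg p).-1.

Definition half_deg p : nat := uphalf (pdeg p).

Definition l1norm p : R := \sum_(a <- msupp p) `|mcoeff a p|.

Definition gradient p x : 'rV[R]_n := \row_j peval (mderiv j p) x.

Definition hessian p x : 'M[R]_n :=
  \matrix_(i, j) peval (mderiv i (mderiv j p)) x.

End Polynomials.

Section Matrices.
Variable R : realType.

Definition psd N (A : 'M[R]_N) : Prop :=
  A^T = A /\ forall u : 'rV[R]_N, 0 <= (u *m A *m u^T) 0 0.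

Definition lambda_min N (A : 'M[R]_N) : R := inf [set a | eigenvalue A a].

Definition expmx N (A : 'M[R]_N) : 'M[R]_N :=
  \matrix_(i, j) limn (series (fun k : nat => (A ^+ k) i j / k`!%:R)).

End Matrices.

(* The polynomials g_0, ..., g_m are a family indexed by 'I_m.+1; those that  *)
(* constrain the feasible set are the g (lift ord0 i) with i : 'I_m.          *)
Section Problem.
Variables (R : realType) (n m : nat).
Variables (f : mpoly n R) (g : 'I_m.+1 -> mpoly n R).
Implicit Types (x : 'rV[R]_n) (eta : 'I_m -> R).

Definition feasible : set 'rV[R]_n :=
  [set x | forall i : 'I_m, 0 <= peval (g (lift ord0 i)) x].

Definition opt_value : R := inf (peval f @` feasible).

Definition optimal_solution x : Prop :=
  feasible x /\ forall y, feasible y -> peval f x <= peval f y.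

Definition lagrangian eta : mpoly n R :=
  f - \sum_(i < m) eta i *: g (lift ord0 i).

Definition active_gradients x : seq 'rV[R]_n :=
  [seq gradient (g (lift ord0 i)) x
     | i <- enum 'I_m & peval (g (lift ord0 i)) x == 0].

Definition KKT x eta : Prop :=
  [/\ forall i, 0 <= eta i,
      gradient (lagrangian eta) x = 0 &
      forall i, eta i * peval (g (lift ord0 i)) x = 0].

Definition strict_complementarity x eta : Prop :=
  forall i, 0 < eta i + peval (g (lift ord0 i)) x.

Definition hessian_positive x eta : Prop :=
  forall u : 'rV[R]_n,
    (forall w, w \in <<active_gradients x>>%VS -> (w *m u^T) 0 0 = 0) ->
    u != 0 -> 0 < (u *m hessian (lagrangian eta) x *m u^T) 0 0.

Definition second_order_sufficient x : Prop :=
  exists eta, [/\ KKT x eta, strict_complementarity x eta,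
                  free (active_gradients x) & hessian_positive x eta].

End Problem.

Section Relaxation.
Variables (R : realType) (n m : nat).
Variables (f : mpoly n R) (g : 'I_m.+1 -> mpoly n R) (k : nat).

Definition relaxation_order : Prop :=
  (maxn (half_deg f) (\max_(i < m.+1) half_deg (g i)) <= k)%N.

(* Matrices indexed by the multi-indices of degree at most t are matrices of  *)
(* size #|{: bmultinom n t.+1}|, through a fixed enumeration; mon a is the    *)
(* multi-index at position a.                                                 *)
Definition nmon (t : nat) : nat := #|{: bmultinom n t.+1}|.

Definition mon t (a : 'I_(nmon t)) : multinom n := bmnm (enum_val a).

Definition monvec t : 'cV[mpoly n R]_(nmon t) := \col_a mpolyX R (mon a).

Definition gram t (G : 'M[R]_(nmon t)) : mpoly n R :=
  ((monvec t)^T *m map_mx (@mpolyC n R) G *m monvec t) 0 0.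

Definition blk (i : 'I_m.+1) : nat := nmon (k - half_deg (g i)).

Definition sos_feasible (l : R) : Prop :=
  exists G : forall i : 'I_m.+1, 'M[R]_(blk i),
    psd (\mxdiag_(i < m.+1) G i) /\
    f - mpolyC n l = \sum_(i < m.+1) g i * gram (G i).

Definition sos_value : \bar R := ereal_sup (EFin @` sos_feasible).

Definition localizing t (p : mpoly n R) (y : multinom n -> R) :
    'M[R]_(nmon t) :=
  \matrix_(a, b) \sum_(c <- msupp p)
    mcoeff c p * y (mnm_add (mnm_add (mon a) (mon b)) c).

Definition moment_matrix (y : multinom n -> R) : 'M[R]_(\sum_i blk i) :=
  \mxdiag_(i < m.+1) localizing (k - half_deg (g i)) (g i) y.

Section Moments.
Variable mu : {measure set (borelRn R n) -> \bar R}.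

Definition finite_moments : Prop :=
  forall a : multinom n,
    mu.-integrable setT (fun x => (peval (mpolyX R a) x)%:E).

Definition moment (a : multinom n) : R :=
  (\int[mu]_x peval (mpolyX R a) x)%R.

End Moments.

End Relaxation.

(* The ceiling of x as an iteration count: 0 when it is negative. *)
Definition steps (R : realType) (x : R) : nat :=
  if Num.ceil x is Posz t then t else 0%N.

(* The constraints are a family over an arbitrary finite type J. Since the    *)
(* violated constraint is chosen freely, the algorithm is given as a relation *)
(* holding of every output that some sequence of choices produces.            *)
Section HamiltonianUpdates.
Variables (R : realType) (N : nat) (J : finType).
Variables (eps : R) (A : J -> 'M[R]_N) (b : J -> R).

Definition hu_density (W : 'M[R]_N) : 'M[R]_N := (\tr W)^-1 *: W.

Definition hu_violated (W : 'M[R]_N) (j : J) : Prop :=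
  b j + eps < \tr (A j *m hu_density W).

(* hu_run t S W o: with t iterations left, current weight W, and S the sum of *)
(* the matrices M chosen so far, the output can be o (true for eta = 1).      *)
Inductive hu_run : nat -> 'M[R]_N -> 'M[R]_N -> bool -> Prop :=
| hu_complete S W : hu_run 0 S W false
| hu_stop t S W :
    (forall j, ~ hu_violated W j) -> hu_run t.+1 S W true
| hu_update t S W j o :
    hu_violated W j ->
    let S' := S + 2^-1 *: (1%:M - A j) in
    hu_run t S' (expmx ((eps / 4) *: S')) o ->
    hu_run t.+1 S W o.

Definition hu_output (o : bool) : Prop :=
  hu_run (steps (16 * ln N%:R / eps ^+ 2)) 0 1%:M o.

Lemma hu_output_exists : exists o, hu_output o.
Proof.
rewrite /hu_output; move: (steps _) 0 1%:M => t.
elim: t => [|t IH] S W; first by exists false; constructor.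
case: (pselect (exists j, hu_violated W j)) => [ [j vj] | nv].
  have [out ho] := IH (S + 2^-1 *: (1%:M - A j))
                    (expmx ((eps / 4) *: (S + 2^-1 *: (1%:M - A j)))).
  by exists out; apply: hu_update vj ho.
by exists true; apply: hu_stop => j vj; apply: nv; exists j.
Qed.

End HamiltonianUpdates.

Section BinarySearch.
Variables (R : realType) (N : nat) (J : finType).
Variables (eps : R) (C : 'M[R]_N) (A : J -> 'M[R]_N) (b : J -> R).

Definition bs_lhs (c : option (J + J)) : 'M[R]_N :=
  match c with
  | Some (inl i) => A i
  | Some (inr i) => - A i
  | None => C
  end.

Definition bs_rhs (l : R) (c : option (J + J)) : R :=
  match c with
  | Some (inl i) => b i
  | Some (inr i) => - b i
  | None => l
  end.

(* bs_run t lo hi v: with t iterations left and current bounds lo and hi, the *)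
(* returned value can be v.                                                   *)
Inductive bs_run : nat -> R -> R -> R -> Prop :=
| bs_done lo hi : bs_run 0 lo hi lo
| bs_raise t lo hi v :
    hu_output eps bs_lhs (bs_rhs ((lo + hi) / 2)) false ->
    bs_run t ((lo + hi) / 2) hi v -> bs_run t.+1 lo hi v
| bs_lower t lo hi v :
    hu_output eps bs_lhs (bs_rhs ((lo + hi) / 2)) true ->
    bs_run t lo ((lo + hi) / 2) v -> bs_run t.+1 lo hi v.

Definition bs_output (lmin lmax v : R) : Prop :=
  bs_run (steps (ln ((lmax - lmin) / eps) / ln 2)) lmin lmax v.

Lemma bs_output_exists lmin lmax : exists v, bs_output lmin lmax v.
Proof.
rewrite /bs_output; move: (steps _) => t.
elim: t lmin lmax => [|t IH] lo hi; first by exists lo; constructor.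
case: (hu_output_exists eps bs_lhs (bs_rhs ((lo + hi) / 2))) => -[] ho.
  by have [v hv] := IH lo ((lo + hi) / 2); exists v; apply: bs_lower.
by have [v hv] := IH ((lo + hi) / 2) hi; exists v; apply: bs_raise.
Qed.

End BinarySearch.

Section CON.
Variables (R : realType) (n m : nat).
Variables (f : mpoly n R) (g : 'I_m.+1 -> mpoly n R) (k : nat).

Definition hankel t (e : multinom n) : 'M[R]_(nmon n t) :=
  \matrix_(a, b) (mnm_add (mon a) (mon b) == e)%:R.

Definition Bg (c : multinom n) : 'M[R]_(\sum_i blk g k i) :=
  \mxdiag_(i < m.+1)
    \sum_(z : bmultinom n (2 * half_deg (g i)).+1 | lem z c)
      mcoeff z (g i) *: hankel (k - half_deg (g i)) (mnm_sub c z).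

Definition con_mx (c : multinom n) : 'M[R]_(\sum_i blk g k i + 1) :=
  block_mx (Bg c) 0 0 0.

(* the multi-indices gamma_1, ..., gamma_M *)
Definition con_index : finType :=
  {c : bmultinom n (2 * k).+1 | bmnm c != mnm0}.

Definition con_lmin (a : 'rV[R]_n) : R := mcoeff mnm0 f - peval f a.

Definition con_lmax (llow : R) : R := mcoeff mnm0 f - llow.

Definition con_output (eps llow : R) (a : 'rV[R]_n) (v : R) : Prop :=
  exists2 l : R,
    bs_output eps (con_mx mnm0)
      (fun c : con_index => con_mx (val c))
      (fun c : con_index => mcoeff (val c) f)
      (con_lmin a) (con_lmax llow) l
    & v = mcoeff mnm0 f - l.

End CON.

(* Main.v *)
Require Import Defs.
From HB Require Import structures.
From mathcomp Require Import all_boot all_order all_algebra.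
From mathcomp Require Import all_classical all_reals all_analysis.
From mathcomp Require Import ring lra.
Set Implicit Arguments.
Unset Strict Implicit.
Unset Printing Implicit Defensive.
Import Order.TTheory GRing.Theory Num.Theory.
Import numFieldNormedType.Exports.
Local Open Scope classical_set_scope.
Local Open Scope ring_scope.

(* Let f* be the optimal value.  A quadratic module containing the ball
   constraint contains every polynomial positive on S(g) (Putinar).  The second
   order conditions make the optimal solutions isolated, and near each of them
   f - f* is, up to third order terms, a positive definite quadratic form plus
   products of active constraints with squares.  Gluing these local identities
   by interpolation at the finitely many optimal solutions, and absorbing the
   errors with Putinar's theorem on the rest of S(g), puts f - f* in the
   quadratic module; hence lambda_k = f* for large k, and the supremum is
   attained by some G.

   Integrating the certificate against mu bounds lambda_min(D_k(g mu)) tr G by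
   the integral of f - llow, so tr G <= 1, and G completed by one slack
   diagonal entry has trace one and satisfies the constraints exactly.

   Hamiltonian updates never answer 0 on an instance with a feasible X: while
   log (tr (exp H)) >= tr (H X), the trace inequality
   tr (exp (S + h M)) <= tr (exp S) + (e^h - 1) tr (M exp S), for 0 <= M <= 1,
   makes each update raise log (tr (exp H)) by less than
   (eps / 4) tr (M X) - (eps / 4)^2, so 16 log N / eps^2 updates cannot occur.
   An answer 1 provides P whose moments are eps-close to those of f;
   testing the polynomial sum_i g_i v^T P_i v >= 0 at x* costs at most eps times
   the sum of |x*^alpha| over alpha != 0, which is at most r / (1 - r). *)

(** * Spectral theorem and trace inequalities *)

(** The certificate must be exact, but F = f - f* vanishes at the optimal solutions, where Putinar's
    theorem gives nothing. The gluing therefore aims at one format: an element of the quadratic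
    module, plus squares a_i^2 times polynomials positive at the zeros of F, plus products a_i a_j
    k_ij with k_ij zero there. This explains the cubes in the interpolation: pi^3 is the square pi^2
    times a factor pi that still vanishes at the zeros.

    The trace inequality takes the place of Golden-Thompson. As S and M are positive semidefinite,
    tr exp(S + tM) can be treated termwise: its truncated series are polynomials in t whose second
    derivative is at most the first for t >= 0.

    Constants: with h = eps/4, a violation makes tr(M X) exceed tr(M P) by more than 2h, and the
    second order costs at most h^2, so each update gains more than h^2 = eps^2/16. In the final
    bound one eps is the width of the last search interval, the other the tolerance on tr(C X) in an
    answer 1. *)

Section SpectralTheorem.
Variable R : realType.
Implicit Type N : nat.

Definition dotr N (u v : 'rV[R]_N) : R := (u *m v^T) 0 0.

Lemma dotrE N (u v : 'rV[R]_N) : dotr u v = \sum_i u 0 i * v 0 i.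
Proof. by rewrite /dotr mxE; apply: eq_bigr => i _; rewrite mxE. Qed.

Lemma dotrC N (u v : 'rV[R]_N) : dotr u v = dotr v u.
Proof. by rewrite !dotrE; apply: eq_bigr => i _; rewrite mulrC. Qed.

Lemma dotrDl N (u v w : 'rV[R]_N) : dotr (u + v) w = dotr u w + dotr v w.
Proof. by rewrite /dotr mulmxDl mxE. Qed.

Lemma dotrZl N a (u w : 'rV[R]_N) : dotr (a *: u) w = a * dotr u w.
Proof. by rewrite /dotr -scalemxAl mxE. Qed.

Lemma dotrDr N (u v w : 'rV[R]_N) : dotr w (u + v) = dotr w u + dotr w v.
Proof. by rewrite ![dotr w _]dotrC dotrDl. Qed.

Lemma dotrZr N a (u w : 'rV[R]_N) : dotr w (a *: u) = a * dotr w u.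
Proof. by rewrite ![dotr w _]dotrC dotrZl. Qed.

Lemma dotr_ge0 N (u : 'rV[R]_N) : 0 <= dotr u u.
Proof. by rewrite dotrE sumr_ge0// => i _; rewrite -expr2 sqr_ge0. Qed.

Lemma dotr_eq0 N (u : 'rV[R]_N) : dotr u u = 0 -> u = 0.
Proof.
rewrite dotrE => /psumr_eq0P u0; apply/rowP => i; rewrite mxE.
by apply/eqP; rewrite -sqrf_eq0 expr2 u0// => j _; rewrite -expr2 sqr_ge0.
Qed.

Lemma dotr_mulmx N (A : 'M[R]_N) (u v : 'rV[R]_N) :
  dotr (u *m A) v = dotr u (v *m A^T).
Proof. by rewrite /dotr trmx_mul trmxK mulmxA. Qed.

(** First-order optimality: for small [t] of sign opposite to [a] the linear term wins. The test
    point [- a / (1 + |b|)] avoids a limit. *)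
Lemma lin_quad_ge0 (a b : R) : (forall t, 0 <= t * a + t ^+ 2 * b) -> a = 0.
Proof.
move=> h; have [//|a0] := eqVneq a 0; exfalso.
have a2 : 0 < a ^+ 2 by rewrite exprn_even_gt0.
have [c c0 cE] : exists2 c : R, 0 < c & c = (1 + `|b|)^-1.
  by exists (1 + `|b|)^-1 => //; rewrite invr_gt0 ltr_pwDl.
have := h (- (a * c)).
have -> : - (a * c) * a + (- (a * c)) ^+ 2 * b = - (a ^+ 2) * c * (1 - c * b).
  by ring.
apply/negP; rewrite -ltNge !mulNr oppr_lt0; apply: mulr_gt0; first exact: mulr_gt0.
rewrite subr_gt0.
have [b0|b0] := leP b 0; first by rewrite (le_lt_trans (mulr_ge0_le0 (ltW c0) b0)).
rewrite cE mulrC ltr_pdivrMr ?ltr_pwDl// mul1r gtr0_norm//; lra.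
Qed.

Lemma continuous_coord N (i : 'I_N) : continuous (fun u : 'rV[R]_N => u 0 i).
Proof. exact: coord_continuous. Qed.

Lemma continuous_mul_real (T : topologicalType) (f g : T -> R) :
  continuous f -> continuous g -> continuous (fun x => f x * g x).
Proof. by move=> cf cg x; apply: (@cvgM _ _ _ _ f g); [exact: cf|exact: cg]. Qed.

Lemma continuous_add_real (T : topologicalType) (f g : T -> R) :
  continuous f -> continuous g -> continuous (fun x => f x + g x).
Proof. by move=> cf cg x; apply: (@cvgD _ _ _ _ _ f g); [exact: cf|exact: cg]. Qed.

Lemma continuous_norm_real (T : topologicalType) (f : T -> R) :
  continuous f -> continuous (fun x => `|f x|).
Proof.
by move=> cf x; apply: (@continuous_comp _ _ _ f (@Num.norm R R));
  [exact: cf|exact: norm_continuous].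
Qed.

Lemma continuous_const_real (T : topologicalType) (c : R) :
  continuous (fun _ : T => c).
Proof. by move=> x; exact: cvg_cst. Qed.

Lemma continuous_sum_real (T : topologicalType) (I : Type) (r : seq I) (P : pred I)
    (F : I -> T -> R) :
  (forall i, P i -> continuous (F i)) ->
  continuous (fun x => \sum_(i <- r | P i) F i x).
Proof. by move=> cF; apply: continuous_big => //; exact: add_continuous. Qed.

Lemma continuous_dotr N (B C : 'M[R]_N) :
  continuous (fun u : 'rV[R]_N => dotr (u *m B) (u *m C)).
Proof.
have cl (D : 'M[R]_N) i : continuous (fun u : 'rV[R]_N => (u *m D) 0 i).
  under eq_fun do rewrite mxE.
  by apply: continuous_sum_real => j _; apply: continuous_mul_real;
    [exact: continuous_coord|exact: continuous_const_real].
under eq_fun do rewrite dotrE.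
by apply: continuous_sum_real => i _; apply: continuous_mul_real; apply: cl.
Qed.

Lemma closed_preim_ge (T : topologicalType) (f : T -> R) (a : R) :
  continuous f -> closed [set x | a <= f x].
Proof. by move=> cf; apply: (closed_comp _ (@closed_ge _ a)) => x _; exact: cf. Qed.

Lemma closed_preim_le (T : topologicalType) (f : T -> R) (a : R) :
  continuous f -> closed [set x | f x <= a].
Proof. by move=> cf; apply: (closed_comp _ (@closed_le _ a)) => x _; exact: cf. Qed.

Lemma closed_preim_eq (T : topologicalType) (f : T -> R) (a : R) :
  continuous f -> closed [set x | f x = a].
Proof. by move=> cf; apply: (closed_comp _ (@closed_eq _ a)) => x _; exact: cf. Qed.

Lemma compact_box N (b : R) :
  compact [set v : 'rV[R]_N | forall i, - b <= v 0 i <= b].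
Proof.
have := @rV_compact R N (fun=> [set` `[- b, b]]) (fun=> @segment_compact R (- b) b).
by congr compact; apply/seteqP; split => v /= h i; have := h i; rewrite /= in_itv.
Qed.

Lemma compact_in_box N (b : R) (A : set 'rV[R]_N) :
  closed A -> (forall v, A v -> forall i, - b <= v 0 i <= b) -> compact A.
Proof. by move=> cA Ab; exact: (subclosed_compact cA (@compact_box N b)). Qed.

Lemma dotr_coord N (u : 'rV[R]_N) i : u 0 i ^+ 2 <= dotr u u.
Proof.
rewrite dotrE (bigD1 i)//= expr2 lerDl sumr_ge0// => j _.
by rewrite -expr2 sqr_ge0.
Qed.

Lemma compact_sphere_ortho N k (V : 'M[R]_(k, N)) :
  compact [set u : 'rV[R]_N | dotr u u = 1 /\ u *m V^T = 0].
Proof.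
apply: (@compact_in_box _ 1); last first.
  move=> v [v1 _] i; have := dotr_coord v i; rewrite v1 => h.
  by rewrite -ler_norml -(ler_pXn2r (n := 2)) ?nnegrE// expr1n real_normK// num_real.
rewrite [X in closed X](_ : _ = [set u : 'rV[R]_N | dotr u u = 1] `&`
   \bigcap_(i in [set: 'I_k]) [set u : 'rV[R]_N | (u *m V^T) 0 i = 0]); last first.
  apply/seteqP; split=> u /= [u1 u0]; split => //.
    by move=> i _; rewrite /= u0 mxE.
  by apply/rowP => i; rewrite [LHS](u0 i I) mxE.
apply: closedI.
  apply: closed_preim_eq; have := @continuous_dotr N 1%:M 1%:M.
  by under eq_fun do rewrite mulmx1.
apply: closed_bigI => i _; apply: closed_preim_eq.
under eq_fun do rewrite mxE.
by apply: continuous_sum_real => j _; apply: continuous_mul_real;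
    [exact: continuous_coord|exact: continuous_const_real].
Qed.

Lemma compact_min (T : topologicalType) (f : T -> R) (A : set T) :
  A !=set0 -> compact A -> continuous f ->
  exists2 c, A c & forall t, A t -> f c <= f t.
Proof.
move=> A0 cA cf; have [|c cA' h] := @compact_EVT_min T R f A A0 cA.
  by apply: continuous_subspaceT.
by exists c; [rewrite -inE|move=> t At; apply: h; rewrite inE].
Qed.

(** A minimizer of the Rayleigh quotient on the unit sphere of the complement of the rows of [V] is
    a further eigenvector, because that complement is stable under a symmetric [A]. *)
Lemma ortho_eigenvectors N (A : 'M[R]_N) k : A^T = A -> (k <= N)%N ->
  exists (V : 'M[R]_(k, N)) (d : 'rV[R]_k),
    V *m V^T = 1%:M /\ V *m A = diag_mx d *m V.
Proof.
move=> AT; elim: k => [_|k IH kN].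
  by exists 0, 0; split; apply/matrixP => -[].
have [V [d [VV VA]]] := IH (ltnW kN).
pose K := [set u : 'rV[R]_N | dotr u u = 1 /\ u *m V^T = 0].
have K0 : K !=set0.
  have /rowV0Pn[u uK u0] : kermx V^T != 0.
    rewrite -mxrank_eq0 mxrank_ker subn_eq0 -ltnNge.
    by rewrite mxrank_tr (leq_ltn_trans (rank_leq_row _)).
  have uV : u *m V^T = 0 by apply/sub_kermxP.
  have du : 0 < dotr u u.
    by rewrite lt_neqAle dotr_ge0 andbT; apply: contraNneq u0 => /esym/dotr_eq0 ->.
  exists ((Num.sqrt (dotr u u))^-1 *: u); split; last by rewrite -scalemxAl uV scaler0.
  rewrite dotrZl dotrZr mulrA -expr2 exprVn sqr_sqrtr ?dotr_ge0//.
  by rewrite mulVf// gt_eqF.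
have cf : continuous (fun u : 'rV[R]_N => dotr (u *m A) u).
  by have := @continuous_dotr N A 1%:M; under eq_fun do rewrite mulmx1.
have [v [v1 vV] vmin] := compact_min K0 (@compact_sphere_ortho _ _ V) cf.
set l := dotr (v *m A) v in vmin.
have hom w : w *m V^T = 0 -> l * dotr w w <= dotr (w *m A) w.
  move=> wV; have [->|w0] := eqVneq w 0.
    by rewrite mul0mx /dotr !mul0mx mxE mulr0.
  have dw : 0 < dotr w w.
    by rewrite lt_neqAle dotr_ge0 andbT; apply: contraNneq w0 => /esym/dotr_eq0 ->.
  have := vmin ((Num.sqrt (dotr w w))^-1 *: w) _.
  rewrite -scalemxAl !dotrZl !dotrZr !mulrA -!expr2 !exprVn !sqr_sqrtr ?dotr_ge0//.
  rewrite [_ * dotr (w *m A) w]mulrC ler_pdivlMr//; apply.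
  rewrite /K /= -scalemxAl wV scaler0; split => //.
  rewrite dotrZl dotrZr mulrA -expr2 exprVn sqr_sqrtr ?dotr_ge0//.
  by rewrite mulVf// gt_eqF.
(* The residual [x] again lies in the complement, and the derivative of the quotient at [v] along
   [x] is twice [dotr x x]; minimality makes it 0. *)
have [x xE] : exists x, x = v *m A - l *: v by exists (v *m A - l *: v).
have xV : x *m V^T = 0.
  rewrite xE mulmxBl -scalemxAl vV scaler0 subr0.
  rewrite -[A]AT -mulmxA -trmx_mul VA trmx_mul tr_diag_mx mulmxA vV.
  by rewrite mul0mx.
have x0 : x = 0.
  apply: dotr_eq0; apply: (@lin_quad_ge0 _ ((dotr (x *m A) x - l * dotr x x) / 2)).
  move=> t; have := hom (v + t *: x).
  rewrite !mulmxDl -!scalemxAl vV xV scaler0 addr0 => /(_ erefl).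
  rewrite !(dotrDl, dotrDr, dotrZl, dotrZr) -/l v1.
  have -> : dotr (x *m A) v = dotr (v *m A) x by rewrite dotr_mulmx AT dotrC.
  have -> : dotr x x = dotr (v *m A) x - l * dotr v x.
    by rewrite {1}xE dotrDl -scaleNr dotrZl mulNr.
  rewrite [dotr x v]dotrC; lra.
have vA : v *m A = l *: v by apply/eqP; rewrite -subr_eq0 -xE x0.
rewrite -addn1; exists (col_mx V v), (row_mx d l%:M).
split.
  rewrite tr_col_mx mul_col_row VV vV.
  have -> : V *m v^T = 0 by rewrite -[LHS]trmxK trmx_mul trmxK vV trmx0.
  have -> : v *m v^T = 1%:M.
    by apply/matrixP => i j; rewrite !ord1 [LHS]v1 mxE.
  by rewrite -scalar_mx_block.
rewrite mul_col_mx VA vA diag_mx_row mul_block_col !mul0mx addr0 add0r.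
congr col_mx; apply/matrixP => i j; rewrite !ord1 !mxE big_ord1 !mxE !eqxx.
by rewrite !mulr1n.
Qed.

Theorem symmetric_diagonalizable N (A : 'M[R]_N) : A^T = A ->
  exists (U : 'M[R]_N) (d : 'rV[R]_N),
    [/\ U *m U^T = 1%:M, U^T *m U = 1%:M & A = U^T *m diag_mx d *m U].
Proof.
move=> AT; have [U [d [UU UA]]] := ortho_eigenvectors AT (leqnn N).
have UU' := mulmx1C UU; exists U, d; split => //.
by rewrite -mulmxA -UA mulmxA UU' mul1mx.
Qed.

End SpectralTheorem.

(** * Functions of a symmetric matrix and traces of products *)

Section MatrixExponential.
Variable R : realType.
Implicit Types (N : nat).

Definition conj_diag N (U : 'M[R]_N) (d : 'rV[R]_N) : 'M[R]_N :=
  U^T *m diag_mx d *m U.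

Lemma conj_diag_sym N (U : 'M[R]_N) d : (conj_diag U d)^T = conj_diag U d.
Proof. by rewrite /conj_diag !trmx_mul trmxK tr_diag_mx mulmxA. Qed.

Lemma conj_diagE N (U : 'M[R]_N) d i j :
  conj_diag U d i j = \sum_l U l i * U l j * d 0 l.
Proof.
rewrite mxE; apply: eq_bigr => l _; rewrite mul_mx_diag !mxE; ring.
Qed.

Lemma conj_diag_exp N (U : 'M[R]_N) d k : U *m U^T = 1%:M -> U^T *m U = 1%:M ->
  conj_diag U d ^+ k = conj_diag U (\row_l d 0 l ^+ k).
Proof.
move=> UU UU'; elim: k => [|k IH].
  rewrite expr0 /conj_diag (_ : diag_mx _ = 1%:M) ?mulmx1 ?UU'//.
  by rewrite -diag_const_mx; congr diag_mx; apply/rowP => l; rewrite !mxE.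
rewrite exprS IH /conj_diag -mulmxE.
rewrite -[_ *m U *m _]mulmxA [U *m _]mulmxA [U *m _]mulmxA UU mul1mx.
rewrite !mulmxA -[_ *m diag_mx _ *m diag_mx _]mulmxA mulmx_diag.
by congr (_ *m diag_mx _ *m _); apply/rowP => l; rewrite !mxE exprS.
Qed.

Lemma tr_conj_diag N (U : 'M[R]_N) d (B : 'M[R]_N) :
  \tr (B *m conj_diag U d) = \sum_l (U *m B *m U^T) l l * d 0 l.
Proof.
rewrite /conj_diag !mulmxA mxtrace_mulC !mulmxA.
by apply: eq_bigr => l _; rewrite mul_mx_diag mxE.
Qed.

Lemma mx_conj_diag_row N (U : 'M[R]_N) d (u : 'rV[R]_N) :
  (u *m conj_diag U d *m u^T) 0 0 = \sum_l (u *m U^T) 0 l ^+ 2 * d 0 l.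
Proof.
rewrite /conj_diag !mulmxA -[_ *m U *m u^T]mulmxA.
rewrite mxE; apply: eq_bigr => l _; rewrite mul_mx_diag.
have -> : (U *m u^T) l 0 = (u *m U^T) 0 l 
  by rewrite !mxE; apply: eq_bigr => i _; rewrite !mxE mulrC.
by rewrite mxE expr2 mulrAC.
Qed.

Lemma conj_diag_psd N (U : 'M[R]_N) (d : 'rV[R]_N) :
  (forall l, 0 <= d 0 l) -> psd (conj_diag U d).
Proof.
move=> d0; split; first exact: conj_diag_sym.
by move=> u; rewrite mx_conj_diag_row sumr_ge0// => l _; rewrite mulr_ge0// sqr_ge0.
Qed.

Lemma psd_conj_ge0 N (A U : 'M[R]_N) l : psd A -> 0 <= (U *m A *m U^T) l l.
Proof.
move=> -[_ /(_ (row l U))]; rewrite -row_mul mxE [in X in _ -> X]mxE.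
by under eq_bigr do rewrite !mxE; under [in X in _ -> X]eq_bigr do rewrite !mxE.
Qed.

Lemma psd_diagP N (A : 'M[R]_N) : psd A ->
  exists (U : 'M[R]_N) (d : 'rV[R]_N),
    [/\ U *m U^T = 1%:M, U^T *m U = 1%:M, A = conj_diag U d & forall l, 0 <= d 0 l].
Proof.
move=> pA; have [U [d [UU UU' AE]]] := symmetric_diagonalizable pA.1.
exists U, d; split => // l.
have := psd_conj_ge0 U l pA; rewrite AE !mulmxA UU mul1mx -mulmxA UU mulmx1.
by rewrite mxE eqxx mulr1n.
Qed.

Lemma psd_tr_mul_ge0 N (A B : 'M[R]_N) : psd A -> psd B -> 0 <= \tr (A *m B).
Proof.
move=> pA /psd_diagP[U [d [UU UU' -> d0]]]; rewrite tr_conj_diag sumr_ge0// => l _.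
by rewrite mulr_ge0// psd_conj_ge0.
Qed.

Lemma psdD N (A B : 'M[R]_N) : psd A -> psd B -> psd (A + B).
Proof.
move=> [AT A0] [BT B0]; split; first by rewrite linearD/= AT BT.
by move=> u; rewrite mulmxDr mulmxDl mxE addr_ge0.
Qed.

Lemma psdZ N (a : R) (A : 'M[R]_N) : 0 <= a -> psd A -> psd (a *: A).
Proof.
move=> a0 [AT A0]; split; first by rewrite linearZ/= AT.
by move=> u; rewrite -scalemxAr -scalemxAl mxE mulr_ge0.
Qed.

Lemma psd0 N : psd (0 : 'M[R]_N).
Proof. by split=> [|u]; rewrite ?trmx0// mulmx0 mul0mx mxE. Qed.

(** The eigenvalues of [M] lie in [0, 1]. This turns the tr (M^2 X^k) of a second derivative into
    the tr (M X^k) of the first. *)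
Lemma psd_sub_sqr N (M : 'M[R]_N) : psd M -> psd (1%:M - M) -> psd (M - M *m M).
Proof.
move=> pM pM1; have [U [d [UU UU' ME d0]]] := psd_diagP pM.
have d1 l : d 0 l <= 1.
  have := psd_conj_ge0 U l pM1; rewrite mulmxBr mulmxBl mulmx1 UU ME !mulmxA UU.
  by rewrite mul1mx -mulmxA UU mulmx1 !mxE !eqxx !mulr1n subr_ge0.
have -> : M - M *m M = conj_diag U (\row_l (d 0 l - d 0 l ^+ 2)).
  rewrite mulmxE -expr2 ME conj_diag_exp//; apply/matrixP => i j.
  rewrite mxE [in X in _ + X]mxE !conj_diagE -sumrB; apply: eq_bigr => l _.
  by rewrite !mxE; ring.
apply: conj_diag_psd => l; rewrite mxE subr_ge0 expr2 ler_piMr//.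
Qed.

Definition exp_partial N (A : 'M[R]_N) (n : nat) : 'M[R]_N :=
  \sum_(k < n) (k`!%:R)^-1 *: A ^+ k.

Lemma expmx_conj_diag N (U : 'M[R]_N) d : U *m U^T = 1%:M -> U^T *m U = 1%:M ->
  expmx (conj_diag U d) = conj_diag U (\row_l expR (d 0 l)).
Proof.
move=> UU UU'; apply/matrixP => i j; rewrite mxE conj_diagE.
apply/cvg_lim => //.
rewrite (_ : series _ = fun n => \sum_l U l i * U l j * series (exp_coeff (d 0 l)) n).
  apply: cvg_big; [exact: add_continuous| move=> l _].
  apply: cvgM; [exact: cvg_cst|rewrite mxE; exact: is_cvg_series_exp_coeff].
apply/funext => n; rewrite /series/=.
under eq_bigr do rewrite conj_diag_exp// conj_diagE mulr_suml.
rewrite exchange_big/=; apply: eq_bigr => l _; rewrite mulr_sumr.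
by apply: eq_bigr => k _; rewrite mxE /exp_coeff /= mulrA.
Qed.

(** [expmx] is an entrywise limit; through this lemma, inequalities between traces of truncated
    series pass to the exponential. *)
Lemma cvg_tr_exp_partial N (A M : 'M[R]_N) : A^T = A ->
  \tr (M *m exp_partial A n) @[n --> \oo] --> \tr (M *m expmx A).
Proof.
move=> AT; have [U [d [UU UU' ->]]] := symmetric_diagonalizable AT.
rewrite -/(conj_diag U d) expmx_conj_diag// tr_conj_diag.
rewrite (_ : (fun n => _) = fun n => \sum_l (U *m M *m U^T) l l *
   series (exp_coeff (d 0 l)) n).
  apply: cvg_big; [exact: add_continuous| move=> l _].
  apply: cvgM; [exact: cvg_cst|rewrite mxE; exact: is_cvg_series_exp_coeff].
apply/funext => n; rewrite /exp_partial mulmx_sumr raddf_sum/=.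
under eq_bigr do rewrite -scalemxAr linearZ/= conj_diag_exp// tr_conj_diag mulr_sumr.
rewrite exchange_big/=; apply: eq_bigr => l _; rewrite /series/= big_mkord mulr_sumr.
by apply: eq_bigr => k _; rewrite mxE /exp_coeff /=; ring.
Qed.

(* In an eigenbasis of [S] with eigenvalues [x_a], the difference of the two
   sides is [1/2 \sum_(a, b) M_ab ^ 2 (x_a^j - x_b^j) (x_a^l - x_b^l)]. *)
Lemma tr_mul_exp_le N (S M : 'M[R]_N) j l : psd S -> M^T = M ->
  \tr (M *m S ^+ j *m M *m S ^+ l) <= \tr (M *m M *m S ^+ (j + l)).
Proof.
move=> /psd_diagP[U [x [UU UU' -> x0]]] MT.
have [B BE] : exists B, B = U *m M *m U^T by exists (U *m M *m U^T).
have BT a b : B a b = B b a.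
  have /matrixP/(_ a b) : B^T = B by rewrite BE !trmx_mul trmxK MT mulmxA.
  by rewrite mxE.
have E1 : \tr (M *m conj_diag U x ^+ j *m M *m conj_diag U x ^+ l) =
    \sum_a \sum_b B a b ^+ 2 * (x 0 b ^+ j * x 0 a ^+ l).
  rewrite !conj_diag_exp// tr_conj_diag; apply: eq_bigr => a _.
  have -> : U *m (M *m conj_diag U (\row_l0 x 0 l0 ^+ j) *m M) *m U^T =
            B *m diag_mx (\row_l0 x 0 l0 ^+ j) *m B.
    by rewrite BE /conj_diag !mulmxA.
  rewrite mxE mulr_suml mul_mx_diag; apply: eq_bigr => b _; rewrite !mxE [B b a]BT.
  ring.
have E2 : \tr (M *m M *m conj_diag U x ^+ (j + l)) =
    \sum_a \sum_b B a b ^+ 2 * (x 0 a ^+ (j + l)).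
  rewrite conj_diag_exp// tr_conj_diag; apply: eq_bigr => a _.
  have -> : U *m (M *m M) *m U^T = B *m B.
    by rewrite BE -!mulmxA [U^T *m (U *m _)]mulmxA UU' mul1mx.
  rewrite mxE mulr_suml; apply: eq_bigr => b _; rewrite !mxE [B b a]BT; ring.
have E3 : \sum_a \sum_b B a b ^+ 2 * (x 0 a ^+ (j + l)) =
          \sum_a \sum_b B a b ^+ 2 * (x 0 b ^+ (j + l)).
  by rewrite exchange_big/=; apply: eq_bigr => a _; apply: eq_bigr => b _; rewrite BT.
have E4 : \sum_a \sum_b B a b ^+ 2 * (x 0 b ^+ j * x 0 a ^+ l) =
          \sum_a \sum_b B a b ^+ 2 * (x 0 a ^+ j * x 0 b ^+ l).
  by rewrite exchange_big/=; apply: eq_bigr => a _; apply: eq_bigr => b _; rewrite BT.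
rewrite E1 E2 -subr_ge0 -(pmulr_rge0 (x := 2))// mulr2n mulrDl !mul1r.
rewrite {1}E3 {1}E4 addrACA -!opprD -!big_split/= -sumrB sumr_ge0// => a _.
rewrite -!big_split/= -sumrB sumr_ge0// => b _.
rewrite -!mulrDr -mulrBr mulr_ge0 ?sqr_ge0//.
have -> : x 0 b ^+ (j + l) + x 0 a ^+ (j + l) -
   (x 0 a ^+ j * x 0 b ^+ l + x 0 b ^+ j * x 0 a ^+ l) =
   (x 0 a ^+ j - x 0 b ^+ j) * (x 0 a ^+ l - x 0 b ^+ l) by rewrite !exprD; ring.
have [ab|ba] := leP (x 0 a) (x 0 b).
  by rewrite mulr_le0// subr_le0 lerXn2r// nnegrE.
by rewrite mulr_ge0// subr_ge0 lerXn2r ?nnegrE// ltW.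
Qed.

End MatrixExponential.

(** * Growth of tr exp (S + tM) in t *)

Section TraceExponentialGrowth.
Variable R : realType.

Lemma le_of_derive_le0 (f df : R -> R) (h : R) : 0 <= h ->
  (forall x, is_derive x (1 : R) f (df x)) ->
  (forall x, 0 <= x -> x <= h -> df x <= 0) -> f h <= f 0.
Proof.
move=> h0 fdf df0; apply: (@ler0_derive1_nincr R f 0 h) => //.
- move=> x; rewrite in_itv/= => /andP[x0 xh].
  by rewrite derive1E derive_val df0// ltW.
- apply: continuous_subspaceT => x; apply: differentiable_continuous.
  exact/derivable1_diffP.
Qed.

(* [p' e^{-t}] and then [p - p'(0) e^t] are nonincreasing on [0, h]. *)
Lemma poly_growth (p : {poly R}) (h : R) : 0 <= h ->
  (forall t, 0 <= t -> t <= h -> p^`()^`().[t] <= p^`().[t]) ->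
  p.[h] <= p.[0] + (expR h - 1) * p^`().[0].
Proof.
move=> h0 pp.
have dexp x : is_derive x (1 : R) (fun t : R => expR (- t)) (- expR (- x)).
  have dd := is_derive1_comp (is_derive_expR (- x)) (is_deriveN (is_derive_id x (1 : R))).
  by apply: (is_derive_eq dd); rewrite /GRing.scale/= mulrN1.
have dp' t : 0 <= t -> t <= h -> p^`().[t] <= expR t * p^`().[0].
  move=> t0 th.
  have : (fun x => p^`().[x] * expR (- x)) t <= (fun x => p^`().[x] * expR (- x)) 0.
    apply: (@le_of_derive_le0 (fun x => p^`().[x] * expR (- x)) (fun x => (p^`()^`().[x] -
      p^`().[x]) * expR (- x))) => //.
      move=> x; have dd := is_deriveM (is_derive_poly p^`() x) (dexp x).
      apply: (is_derive_eq dd); rewrite /GRing.scale/=; ring.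
    move=> x x0 xt; rewrite mulr_le0_ge0 ?expR_ge0// subr_le0 pp//.
    exact: le_trans xt th.
  rewrite /= oppr0 expR0 mulr1 expRN ler_pdivrMr ?expR_gt0//.
  by rewrite mulrC.
have : (fun x => p.[x] - p^`().[0] * expR x) h <= (fun x => p.[x] - p^`().[0] * expR x) 0.
  apply: (@le_of_derive_le0 (fun x => p.[x] - p^`().[0] * expR x) (fun x => p^`().[x] -
    p^`().[0] * expR x)) => //.
  by move=> x x0 xh; rewrite subr_le0 mulrC dp'.
rewrite /= expR0 mulr1; set a := p^`().[0]; set b := expR h; lra.
Qed.

Section MatrixPolynomial.
Variables (N : nat) (S M : 'M[R]_N).

Local Notation Mc := (map_mx polyC M).
(** S + tM with a formal [t]: traces of its powers are polynomials, so derivatives in [t] are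
    algebraic although [S] and [M] need not commute. *)
Definition pencil : 'M[{poly R}]_N := map_mx polyC S + 'X *: Mc.

Lemma map_deriv_mul (A B : 'M[{poly R}]_N) :
  map_mx (@deriv R) (A *m B) = map_mx (@deriv R) A *m B + A *m map_mx (@deriv R) B.
Proof.
apply/matrixP => i j; rewrite !mxE raddf_sum -big_split/=.
by apply: eq_bigr => k _; rewrite !mxE derivM.
Qed.

Lemma map_deriv_pencil : map_mx (@deriv R) pencil = Mc.
Proof. by apply/matrixP => i j;
  rewrite !mxE derivD derivM !derivC derivX add0r mul1r mulr0 addr0. Qed.

Lemma map_deriv_exp k : map_mx (@deriv R) (pencil ^+ k.+1) =
  \sum_(j < k.+1) pencil ^+ j *m Mc *m pencil ^+ (k - j).
Proof.
elim: k => [|k IH].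
  by rewrite expr1 big_ord1 map_deriv_pencil !expr0 mul1mx mulmx1.
rewrite exprS -mulmxE map_deriv_mul IH map_deriv_pencil [RHS]big_ord_recl/=.
rewrite expr0 mul1mx subn0; congr (_ + _).
rewrite mulmx_sumr; apply: eq_bigr => j _; rewrite /bump/= add1n exprS -mulmxE subSS.
by rewrite !mulmxA.
Qed.

Lemma deriv_tr (A : 'M[{poly R}]_N) : (\tr A)^`() = \tr (map_mx (@deriv R) A).
Proof. by rewrite /mxtrace raddf_sum; apply: eq_bigr => i _; rewrite mxE. Qed.

(** By cyclicity of the trace, the [k.+1] terms of the noncommutative Leibniz rule coincide. *)
Lemma deriv_tr_exp k : (\tr (pencil ^+ k.+1))^`() = \tr (Mc *m pencil ^+ k) *+ k.+1.
Proof.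
rewrite deriv_tr map_deriv_exp raddf_sum/=.
rewrite (eq_bigr (fun=> \tr (Mc *m pencil ^+ k))) ?sumr_const ?card_ord//.
move=> j _; rewrite mxtrace_mulC mulmxA mxtrace_mulC mulmxE -exprD.
by rewrite subnK // -ltnS.
Qed.

Lemma map_deriv_const : map_mx (@deriv R) Mc = 0.
Proof. by apply/matrixP => i j; rewrite !mxE derivC. Qed.

Lemma deriv_tr_mul_exp k : (\tr (Mc *m pencil ^+ k.+1))^`() =
  \sum_(j < k.+1) \tr (Mc *m pencil ^+ j *m Mc *m pencil ^+ (k - j)).
Proof.
rewrite deriv_tr map_deriv_mul map_deriv_const mul0mx add0r map_deriv_exp.
by rewrite mulmx_sumr raddf_sum; apply: eq_bigr => j _; rewrite !mulmxA.
Qed.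

Lemma map_horner_mul (t : R) (A B : 'M[{poly R}]_N) :
  map_mx (horner_eval t) (A *m B) = map_mx (horner_eval t) A *m map_mx (horner_eval t) B.
Proof. by rewrite map_mxM. Qed.

Lemma map_horner_const (t : R) (A : 'M[R]_N) : map_mx (horner_eval t) (map_mx polyC A) = A.
Proof. by apply/matrixP => i j; rewrite !mxE horner_evalE hornerC. Qed.

Lemma map_horner_exp (t : R) k :
  map_mx (horner_eval t) (pencil ^+ k) = (S + t *: M) ^+ k.
Proof.
elim: k => [|k IH]; first by rewrite !expr0 map_mx1.
rewrite !exprS -!mulmxE map_horner_mul IH; congr (_ *m _).
by apply/matrixP => i j; rewrite !mxE horner_evalE !hornerE.
Qed.

Lemma horner_tr (t : R) (A : 'M[{poly R}]_N) : (\tr A).[t] = \tr (map_mx (horner_eval t) A).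
Proof. by rewrite /mxtrace horner_sum; apply: eq_bigr => i _; rewrite mxE. Qed.

Definition trexp (n : nat) : {poly R} :=
  \sum_(k < n) (k`!%:R)^-1 *: \tr (pencil ^+ k).

Lemma invf_factS k : ((k.+1)`!%:R)^-1 *+ k.+1 = (k`!%:R)^-1 :> R.
Proof.
by rewrite factS natrM invfM -[LHS]mulr_natl mulrA mulfV ?mul1r ?pnatr_eq0.
Qed.

Lemma deriv_trexp n : (trexp n.+1)^`() = \sum_(k < n) (k`!%:R)^-1 *: \tr (Mc *m pencil ^+ k).
Proof.
rewrite raddf_sum big_ord_recl/= derivZ expr0 deriv_tr.
rewrite (_ : map_mx _ _ = 0); last first.
  by apply/matrixP => i j; rewrite !mxE; case: (i == j); rewrite ?derivC ?deriv0// -polyC1 derivC.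
rewrite mxtrace0 scaler0 add0r; apply: eq_bigr => k _.
by rewrite /bump/= add1n derivZ deriv_tr_exp -scalerMnr scalerMnl invf_factS.
Qed.

Hypotheses (pS : psd S) (pM : psd M) (pM1 : psd (1%:M - M)).

(** With X = S + tM, each of the k + 1 terms tr (M X^j M X^(k-j)) of the second derivative is at
    most tr (M^2 X^k), hence at most tr (M X^k); their number turns the coefficient 1/(k+1)! into
    the 1/k! of the first derivative. *)
Lemma trexp_second n (t : R) : 0 <= t ->
  (trexp n.+1)^`()^`().[t] <= (trexp n.+1)^`().[t].
Proof.
move=> t0; have pX : psd (S + t *: M) by apply: psdD => //; exact: psdZ.
have pXk k : psd ((S + t *: M) ^+ k).
  have [U [d [UU UU' -> d0]]] := psd_diagP pX.
  by rewrite conj_diag_exp//; apply: conj_diag_psd => l; rewrite mxE exprn_ge0.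
rewrite deriv_trexp; case: n => [|n]; first by rewrite !big_ord0 deriv0.
(* Differentiation shifts the index by one: the term [k = 0] on the left vanishes, and the last term
   on the right, nonnegative, has no counterpart. *)
rewrite raddf_sum big_ord_recl/= [X in _ <= X.[t]]big_ord_recr/=.
rewrite derivZ expr0 mulmx1 deriv_tr map_deriv_const mxtrace0 scaler0 add0r.
rewrite hornerD -[leLHS]addr0 lerD//; last first.
  rewrite hornerZ mulr_ge0// horner_tr map_horner_mul map_horner_exp map_horner_const.
  exact: psd_tr_mul_ge0.
rewrite !horner_sum; apply: ler_sum => k _; rewrite /bump/= add1n derivZ !hornerZ.
have := invf_factS k; set c := (k.+1)`!%:R^-1 => <-.
rewrite mulrnAl -mulrnAr; apply: ler_wpM2l; first by rewrite invr_ge0.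
rewrite deriv_tr_mul_exp horner_sum.
have -> : (\tr (Mc *m pencil ^+ k)).[t] *+ k.+1 =
    \sum_(j < k.+1) (\tr (M *m (S + t *: M) ^+ k)).
  by rewrite sumr_const card_ord horner_tr map_horner_mul map_horner_exp map_horner_const.
apply: ler_sum => j _.
rewrite horner_tr !map_horner_mul !map_horner_exp !map_horner_const.
apply: le_trans (tr_mul_exp_le _ _ pX pM.1) _.
rewrite subnKC; last by rewrite -ltnS.
rewrite -subr_ge0 -raddfB -mulmxBl psd_tr_mul_ge0//.
exact: psd_sub_sqr.
Qed.

Theorem tr_expmx_growth (h : R) : 0 <= h ->
  \tr (expmx (S + h *: M)) <= \tr (expmx S) + (expR h - 1) * \tr (M *m expmx S).
Proof.
move=> h0.
(* The truncation orders differ by one because the derivative of [trexp n.+1] has [n] terms; both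
   sides tend to exponentials. *)
have step n : \tr (1%:M *m exp_partial (S + h *: M) n.+1) <=
    \tr (1%:M *m exp_partial S n.+1) + (expR h - 1) * \tr (M *m exp_partial S n).
  have := @poly_growth (trexp n.+1) h h0 (fun t t0 _ => trexp_second n t0).
  have E t : (trexp n.+1).[t] = \tr (1%:M *m exp_partial (S + t *: M) n.+1).
    rewrite mul1mx horner_sum raddf_sum; apply: eq_bigr => k _.
    by rewrite hornerZ horner_tr map_horner_exp -mxtraceZ.
  have E' : (trexp n.+1)^`().[0] = \tr (M *m exp_partial S n).
    rewrite deriv_trexp mulmx_sumr horner_sum raddf_sum; apply: eq_bigr => k _.
    rewrite hornerZ horner_tr map_horner_mul map_horner_exp map_horner_const.
    by rewrite scale0r addr0 -scalemxAr -mxtraceZ.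
  by rewrite E' !E scale0r addr0.
have ST : S^T = S := pS.1.
have SMT : (S + h *: M)^T = S + h *: M by rewrite linearD linearZ/= pM.1 ST.
have c1 := cvg_tr_exp_partial (M := 1%:M) SMT.
have c2 := cvg_tr_exp_partial (M := 1%:M) ST.
have c3 := cvg_tr_exp_partial (M := M) ST.
rewrite -[in leLHS](mul1mx (expmx _)) -[X in _ <= \tr X + _]mul1mx.
rewrite -cvg_shiftS in c1; rewrite -cvg_shiftS in c2.
apply: ler_cvg_to c1 _ _; last by near=> n; exact: step.
apply: cvgD; first exact: c2.
by apply: cvgM; [exact: cvg_cst|exact: c3].
Unshelve. all: by end_near. Qed.

End MatrixPolynomial.

End TraceExponentialGrowth.

Lemma steps_ge (R : realType) (c : R) : c <= (steps c)%:R.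
Proof.
have := Num.Theory.ceil_ge c; rewrite /steps.
case: (Num.ceil c) => [k|k] ck; first by rewrite pmulrn.
by apply: le_trans ck _; rewrite NegzE mulrNz oppr_le0 ler0z.
Qed.

(** * Hamiltonian updates and binary search *)

Section HamiltonianUpdatesCorrect.
Variables (R : realType) (N : nat).
Hypothesis N_gt1 : (1 < N)%N.

Let N_gt0 : (0 < N)%N := ltnW N_gt1.

Lemma expmx0 : expmx (0 : 'M[R]_N) = 1%:M.
Proof.
have E (d : 'rV[R]_N) : conj_diag 1%:M d = diag_mx d.
  by rewrite /conj_diag trmx1 mul1mx mulmx1.
have := @expmx_conj_diag R N 1%:M 0; rewrite trmx1 mul1mx !E => /(_ erefl erefl).
rewrite raddf0 => ->; apply/matrixP => i j; rewrite !mxE.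
by rewrite expR0.
Qed.

Lemma expmx_psd (A : 'M[R]_N) : A^T = A -> psd (expmx A).
Proof.
move=> /symmetric_diagonalizable[U [d [UU UU' ->]]].
rewrite -/(conj_diag U d) expmx_conj_diag//; apply: conj_diag_psd => l.
by rewrite mxE expR_ge0.
Qed.

Lemma tr_conj_diag_orth (U : 'M[R]_N) d : U *m U^T = 1%:M ->
  \tr (conj_diag U d) = \sum_l d 0 l.
Proof.
move=> UU; rewrite -[conj_diag _ _]mul1mx tr_conj_diag mulmx1 UU.
by apply: eq_bigr => l _; rewrite mxE eqxx mulr1n mul1r.
Qed.

Lemma tr_expmx_gt0 (A : 'M[R]_N) : A^T = A -> 0 < \tr (expmx A).
Proof.
move=> /symmetric_diagonalizable[U [d [UU UU' ->]]].
rewrite -/(conj_diag U d) expmx_conj_diag// tr_conj_diag_orth//.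
rewrite (bigD1 (Ordinal N_gt0))//= mxE ltr_wpDr ?expR_gt0//.
by rewrite sumr_ge0// => l _; rewrite mxE expR_ge0.
Qed.

(** In an eigenbasis of [A] the diagonal of [X] is a probability vector, and each eigenvalue of [A]
    is at most the logarithm of the sum of their exponentials. *)
Lemma gibbs_le (A X : 'M[R]_N) : A^T = A -> psd X -> \tr X = 1 ->
  \tr (A *m X) <= ln (\tr (expmx A)).
Proof.
move=> AT pX X1; have := tr_expmx_gt0 AT.
have [U [d [UU UU' ->]]] := symmetric_diagonalizable AT.
rewrite -/(conj_diag U d) expmx_conj_diag// tr_conj_diag_orth//.
set Z := \sum_l _ => Z0; rewrite mxtrace_mulC tr_conj_diag.
have <- : \sum_l (U *m X *m U^T) l l * ln Z = ln Z.
  by rewrite -mulr_suml -[X in X * _]/(\tr _) mxtrace_mulC mulmxA UU' mul1mx X1 mul1r.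
apply: ler_sum => l _; apply: ler_wpM2l; first exact: psd_conj_ge0.
rewrite -ler_expR lnK ?posrE// /Z (bigD1 l)//= mxE lerDl sumr_ge0// => i _.
by rewrite mxE expR_ge0.
Qed.

Variables (J : finType) (eps : R) (A : J -> 'M[R]_N) (b : J -> R) (X : 'M[R]_N).
Hypotheses (eps_gt0 : 0 < eps).
Hypotheses (A_le1 : forall j, psd (1%:M - A j)) (A_geN1 : forall j, psd (1%:M + A j)).
Hypotheses (X_psd : psd X) (X_tr : \tr X = 1).
Hypothesis X_feas : forall j, \tr (A j *m X) <= b j.

Let h := eps / 4.
Let gain j : 'M[R]_N := 2^-1 *: (1%:M - A j).

(** [X] satisfies the constraint that the density fails by more than [eps], so the trace of [gain j]
    against [X] exceeds that against the density by more than [eps / 2 = 2 * h]. The log-trace grows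
    by at most [h] times the latter plus [h ^+ 2]. *)
Lemma hu_update_bound (S : 'M[R]_N) j : psd S -> hu_violated eps A b (expmx (h *: S)) j ->
  ln (\tr (expmx (h *: (S + gain j)))) <
  ln (\tr (expmx (h *: S))) + h * \tr (gain j *m X) - h ^+ 2.
Proof.
move=> pS; rewrite /hu_violated /hu_density; set W := expmx _ => viol.
have h0 : 0 < h by rewrite divr_gt0.
have pM : psd (gain j) by apply: psdZ => //; rewrite invr_ge0.
have pM1 : psd (1%:M - gain j).
  have -> : 1%:M - gain j = 2^-1 *: (1%:M + A j).
    rewrite /gain scalerBr scalerDr opprB addrCA addrC; congr (_ + _).
    rewrite -[X in X - _]scale1r -scalerBl; congr (_ *: _); lra.
  by apply: psdZ => //; rewrite invr_ge0.
have ST : (h *: S)^T = h *: S by rewrite linearZ/= pS.1.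
have pW : psd W := expmx_psd ST.
have W0 : 0 < \tr W := tr_expmx_gt0 ST.
have := tr_expmx_growth (psdZ (ltW h0) pS) pM pM1 (ltW h0).
rewrite -scalerDr -/W.
set p := \tr (gain j *m ((\tr W)^-1 *: W)).
have pE : p = (\tr W)^-1 * \tr (gain j *m W) by rewrite /p -scalemxAr linearZ.
have trgain B : \tr (gain j *m B) = 2^-1 * (\tr B - \tr (A j *m B)).
  by rewrite /gain -scalemxAl linearZ/= mulmxBl raddfB/= mul1mx.
have p0 : 0 <= p.
  by rewrite pE; apply: mulr_ge0; [rewrite invr_ge0 ltW|exact: psd_tr_mul_ge0].
have pD : p = 2^-1 * (1 - \tr (A j *m ((\tr W)^-1 *: W))).
  by rewrite /p trgain linearZ/= mulVf ?gt_eqF.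
have xp : p + 2 * h < \tr (gain j *m X).
  have := X_feas j; rewrite trgain X_tr pD /h; lra.
have x1 : \tr (gain j *m X) <= 1.
  have := psd_tr_mul_ge0 pM1 X_psd; rewrite mulmxBl raddfB/= mul1mx X_tr; lra.
(* [xp] and [x1] give [h < 1 / 2], as [p] is nonnegative; the bound is then [1 - h <= expR (- h)]
   inverted. *)
have eh : expR h - 1 <= h / (1 - h).
  have h1 : 0 < 1 - h by lra.
  have := expR_ge1Dx (- h); rewrite expRN => e1.
  rewrite ler_pdivlMr// mulrBl mul1r lerBlDr.
  have : (1 - h) * expR h <= 1 by rewrite -ler_pdivlMr ?expR_gt0// mul1r.
  by lra.
(* After clearing the denominator this is [p <= 1 - h], again from [xp] and [x1]. *)
have ehp : (expR h - 1) * p <= h * p + h ^+ 2.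
  apply: (le_trans (ler_wpM2r p0 eh)).
  have h1 : 0 < 1 - h by lra.
  rewrite mulrAC ler_pdivrMr//; nra.
set W' := expmx (h *: (S + gain j)) => trW'.
have W'0 : 0 < \tr W'.
  by apply: tr_expmx_gt0; rewrite linearZ linearD/= pS.1 pM.1.
have le1 : ln (\tr W') <= ln (\tr W) + (expR h - 1) * p.
  rewrite -ler_expR expRD !lnK ?posrE//.
  apply: le_trans trW' _.
  apply: (@le_trans _ _ (\tr W * (1 + (expR h - 1) * p))).
    by rewrite mulrDr mulr1 lerD2l pE mulrCA [_ * (_^-1 * _)]mulrA mulfV ?gt_eqF// mul1r.
  by apply: ler_wpM2l; [exact: ltW|exact: expR_ge1Dx].
apply: le_lt_trans le1 _; nra.
Qed.

(** [a] is a lower bound on how far ln tr W lags behind ln N + h tr (S X). Each update adds more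
    than [h ^+ 2] to it, and [gibbs_le] at the end of the loop caps it at ln N; an early stop is
    excluded by the output [false]. *)
Lemma hu_run_bound t S W o (a : R) : hu_run eps A b t S W o -> o = false ->
  W = expmx (h *: S) -> psd S ->
  ln (\tr W) <= ln N%:R + h * \tr (S *m X) - a ->
  a + t%:R * h ^+ 2 <= ln N%:R /\ ((0 < t)%N -> a + t%:R * h ^+ 2 < ln N%:R).
Proof.
move=> run; elim: run a => {t S W o}.
- move=> S W a _ WE pS le; split=> //; rewrite mul0r addr0.
  have : \tr ((h *: S) *m X) <= ln (\tr W).
    by rewrite WE; apply: gibbs_le => //; rewrite linearZ/= pS.1.
  rewrite -scalemxAl linearZ/=; lra.
- by [].
- move=> t S W j o viol S' _ IH a oE WE pS le.
  rewrite WE in viol le; have := hu_update_bound pS viol => lt'.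
  have pS' : psd S'.
    by apply: psdD => //; apply: psdZ => //; rewrite invr_ge0.
  set x := \tr (gain j *m X) in lt'.
  have S'X : \tr (S' *m X) = \tr (S *m X) + x by rewrite mulmxDl raddfD.
  (* The induction continues with the exact lag after the update, which exceeds [a + h ^+ 2]. *)
  have [] := IH (ln N%:R + h * \tr (S' *m X) - ln (\tr (expmx (h *: S')))) oE erefl pS' _.
    lra.
  move=> le2 _; rewrite S'X in le2; rewrite -[S + _]/S' in lt'.
  rewrite -addn1 natrD mulrDl mul1r.
  suff lt3 : a + (t%:R * h ^+ 2 + h ^+ 2) < ln N%:R 
    by split=> //; exact: ltW.
  lra.
Qed.

Theorem hu_output_feasible : ~ hu_output eps A b false.
Proof.
rewrite /hu_output; set t := steps _ => run.
have lnN : 0 < ln (N%:R : R) by rewrite ln_gt0// ltr1n.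
have h2 : h ^+ 2 = eps ^+ 2 / 16 by rewrite /h expr_div_n; congr (_ / _); ring.
have tle : 16 * ln N%:R / eps ^+ 2 <= t%:R := steps_ge _.
(* [1 < N] makes ln N positive: an empty loop would answer 0 untested, and strictness comes from at
   least one update. *)
have t0 : (0 < t)%N.
  by rewrite -(ltr0n R); apply: lt_le_trans tle; rewrite divr_gt0 ?mulr_gt0 ?exprn_gt0.
have [] := @hu_run_bound _ _ _ _ 0 run erefl _ (@psd0 R N) _.
- by rewrite scaler0 expmx0.
- by rewrite mul0mx mxtrace0 mulr0 addr0 subr0 mxtrace1.
move=> _ /(_ t0); rewrite add0r; apply/negP; rewrite -leNgt h2 mulrA ler_pdivlMr//.
by rewrite mulrC -ler_pdivrMr ?exprn_gt0.
Qed.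

End HamiltonianUpdatesCorrect.

(** * Binary search with inexact feasibility answers *)

Section BinarySearchCorrect.
Variables (R : realType) (N : nat).
Hypothesis N_gt1 : (1 < N)%N.

Lemma hu_output_approx (J : finType) (eps : R) (A : J -> 'M[R]_N) (b : J -> R) :
  (forall j, (A j)^T = A j) -> hu_output eps A b true ->
  exists P : 'M[R]_N, [/\ psd P, \tr P = 1 & forall j, \tr (A j *m P) <= b j + eps].
Proof.
move=> AT.
(* A run may start from any [W]; that it is the exponential of a symmetric matrix, which makes the
   density positive, must be carried along. *)
suff inv t S W o : hu_run eps A b t S W o -> o = true ->
    W = expmx ((eps / 4) *: S) -> S^T = S ->
    exists P : 'M[R]_N, [/\ psd P, \tr P = 1 & forall j, \tr (A j *m P) <= b j + eps].
  by move=> /inv; apply => //; [rewrite scaler0 expmx0|exact: trmx0].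
elim=> {t S W o} //.
- move=> t S W nv _ WE ST; exists (hu_density W).
  have hST : ((eps / 4) *: S)^T = (eps / 4) *: S by rewrite linearZ/= ST.
  have W0 : 0 < \tr W by rewrite WE; exact: tr_expmx_gt0.
  split.
  + apply: psdZ; first by rewrite invr_ge0 ltW.
    by rewrite WE; exact: expmx_psd.
  + by rewrite linearZ/= mulVf// gt_eqF.
  + by move=> j; have /negP := nv j; rewrite -leNgt.
- move=> t S W j o viol S' _ IH oE WE ST; apply: IH => //.
  by rewrite linearD linearZ linearB/= trmx1 AT ST.
Qed.

Variables (J : finType) (eps : R) (C : 'M[R]_N) (A : J -> 'M[R]_N) (b : J -> R).
Hypotheses (eps_gt0 : 0 < eps).
Hypotheses (C_le1 : psd (1%:M - C)) (C_geN1 : psd (1%:M + C)) (CT : C^T = C).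
Hypotheses (A_le1 : forall j, psd (1%:M - A j)) (A_geN1 : forall j, psd (1%:M + A j)).
Hypothesis AT : forall j, (A j)^T = A j.
Variables (X : 'M[R]_N) (delta : R).
Hypotheses (X_psd : psd X) (X_tr : \tr X = 1) (X_feas : forall j, \tr (A j *m X) = b j).
Hypothesis C_min : forall P : 'M[R]_N, psd P -> \tr P = 1 ->
  (forall j, `|b j - \tr (A j *m P)| <= eps) -> \tr (C *m X) <= \tr (C *m P) + delta.

Let V := \tr (C *m X).

(** [lo <= V] is exact: [X] is feasible for any threshold above [V], so an answer 0 proves the
    threshold to be at most [V]. An answer 1 only yields a [P] feasible up to [eps]; this loses
    [eps] in the bound on [C] and [delta], through [C_min], for the equations. *)
Lemma bs_run_bounds t lo hi v : bs_run eps C A b t lo hi v ->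
  lo <= V -> V <= hi + eps + delta ->
  v <= V /\ V <= v + (hi - lo) / 2 ^+ t + eps + delta.
Proof.
move=> run; elim: run => {t lo hi v}.
- by move=> lo hi lV Vh; split => //; rewrite expr0 divr1; lra.
- move=> t lo hi v out _ IH lV Vh.
  have mV : (lo + hi) / 2 <= V.
    rewrite leNgt; apply/negP => Vm.
    apply: (@hu_output_feasible R N N_gt1 _ eps (bs_lhs C A)
      (bs_rhs b ((lo + hi) / 2)) X) => //.
    + by case=> [[j|j]|]//=; rewrite opprK.
    + by case=> [[j|j]|]//=.
    + case=> [[j|j]|]/=; first by rewrite X_feas.
        by rewrite mulNmx raddfN/= X_feas.
      exact: ltW.
  have [vV Vv] := IH mV Vh; split => //.
  suff <- : (hi - (lo + hi) / 2) / 2 ^+ t = (hi - lo) / 2 ^+ t.+1 by [].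
  by rewrite exprS invfM mulrA; congr (_ * _); lra.
- move=> t lo hi v out _ IH lV Vh.
  have Vm : V <= (lo + hi) / 2 + eps + delta.
    have BT c : (bs_lhs C A c)^T = bs_lhs C A c.
      by case: c => [[j|j]|]//=; rewrite linearN/= AT.
    have [P [pP P1 PA]] := hu_output_approx BT out.
    apply: (@le_trans _ _ (\tr (C *m P) + delta)); last first.
      by rewrite lerD2r; exact: (PA None).
    apply: C_min => // j; rewrite ler_norml; apply/andP; split.
      by have := PA (Some (inl j)); rewrite /= ; lra.
    by have := PA (Some (inr j)); rewrite /= mulNmx raddfN/=; lra.
  have [vV Vv] := IH lV Vm; split => //.
  suff <- : ((lo + hi) / 2 - lo) / 2 ^+ t = (hi - lo) / 2 ^+ t.+1 by [].
  by rewrite exprS invfM mulrA; congr (_ * _); lra.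
Qed.

Theorem bs_output_bounds lmin lmax v : bs_output eps C A b lmin lmax v ->
  lmin < lmax -> lmin <= V -> V <= lmax -> 0 <= delta ->
  v <= V <= v + 2 * eps + delta.
Proof.
move=> out ll lV Vl d0.
have [] := bs_run_bounds out lV; first by move: eps_gt0; lra.
move=> vV Vv; rewrite vV /=; apply: le_trans Vv _.
(* The number of steps is at least the binary logarithm of [(lmax - lmin) / eps], so the last
   interval is no longer than [eps]: the second [eps] of the bound. *)
set w := (lmax - lmin) / _; suff : w <= eps by move: w => w; lra.
rewrite {}/w.
have xe : 0 < (lmax - lmin) / eps by rewrite divr_gt0// subr_gt0.
rewrite ler_pdivrMr ?exprn_gt0// -ler_pdivrMl// [_^-1 * _]mulrC.
have ln2 : 0 < ln (2 : R) by rewrite ln_gt0// ltr1n.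
rewrite -ler_ln ?posrE ?exprn_gt0// lnXn// -[leRHS]mulr_natl -ler_pdivrMr//.
exact: steps_ge.
Qed.

End BinarySearchCorrect.

(** * Putinar's theorem *)

Section Evaluation.
Variables (R : realType) (n : nat).
Local Notation P := (mpoly n R).
Implicit Types (p q : P) (x : 'rV[R]_n).

Definition var (i : 'I_n) : P := mpolyX R (mnm1 i).

Lemma pevalD p q x : peval (p + q) x = peval p x + peval q x.
Proof. exact: mevalD. Qed.
Lemma pevalN p x : peval (- p) x = - peval p x.
Proof. exact: mevalN. Qed.
Lemma pevalB p q x : peval (p - q) x = peval p x - peval q x.
Proof. exact: mevalB. Qed.
Lemma pevalM p q x : peval (p * q) x = peval p x * peval q x.
Proof. exact: mevalM. Qed.
Lemma pevalC c x : peval (mpolyC n c) x = c.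
Proof. exact: mevalC. Qed.
Lemma peval1 x : peval (1 : P) x = 1.
Proof. exact: meval1. Qed.
Lemma peval0 x : peval (0 : P) x = 0.
Proof. exact: meval0. Qed.
Lemma pevalZ c p x : peval (c *: p) x = c * peval p x.
Proof. exact: mevalZ. Qed.
Lemma pevalXn p x k : peval (p ^+ k) x = peval p x ^+ k.
Proof. exact: rmorphXn. Qed.
Lemma peval_var i x : peval (var i) x = x 0 i.
Proof. exact: mevalXU. Qed.
Lemma peval_sum (I : Type) (r : seq I) (Q : pred I) (F : I -> P) x :
  peval (\sum_(i <- r | Q i) F i) x = \sum_(i <- r | Q i) peval (F i) x.
Proof. exact: raddf_sum. Qed.
Lemma peval_prod (I : Type) (r : seq I) (Q : pred I) (F : I -> P) x :
  peval (\prod_(i <- r | Q i) F i) x = \prod_(i <- r | Q i) peval (F i) x.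
Proof. exact: rmorph_prod. Qed.

Definition pevalE := (pevalD, pevalN, pevalM, pevalC, peval1, peval0, pevalZ,
  pevalXn, peval_var, peval_sum, peval_prod).

Lemma continuous_peval p : continuous (fun x => peval p x).
Proof.
rewrite (_ : (fun x => _) = fun x : 'rV[R]_n =>
   \sum_(a <- msupp p) mcoeff a p * \prod_i x 0 i ^+ a i); last first.
  by apply/funext => x; rewrite /peval mevalE.
apply: continuous_sum_real => a _; apply: continuous_mul_real.
  exact: continuous_const_real.
apply: continuous_big; first exact: mul_continuous.
move=> i _; elim: (a i) => [|k IH].
  by under eq_fun do rewrite expr0; exact: continuous_const_real.
under eq_fun do rewrite exprS; apply: continuous_mul_real => //.
exact: continuous_coord.
Qed.

End Evaluation.

Section QuadraticModule.
Variables (R : realType) (n m : nat) (g : 'I_m.+1 -> mpoly n R).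
Hypothesis g0E : g ord0 = 1.
Local Notation P := (mpoly n R).
Implicit Types (p q h : P) (x : 'rV[R]_n).

Definition qmod p : Prop :=
  exists s : 'I_m.+1 -> seq P, p = \sum_(i < m.+1) g i * \sum_(h <- s i) h ^+ 2.

Lemma qmodD p q : qmod p -> qmod q -> qmod (p + q).
Proof.
move=> [s ->] [t ->]; exists (fun i => s i ++ t i).
by rewrite -big_split/=; apply: eq_bigr => i _; rewrite big_cat mulrDr.
Qed.

Lemma qmod_sqM h p : qmod p -> qmod (h ^+ 2 * p).
Proof.
move=> [s ->]; exists (fun i => [seq h * k | k <- s i]).
rewrite mulr_sumr; apply: eq_bigr => i _; rewrite big_map mulrCA mulr_sumr.
by congr (_ * _); apply: eq_bigr => k _; rewrite exprMn.
Qed.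

Lemma qmod_gen i : qmod (g i).
Proof.
exists (fun j => if j == i then [:: 1] else [::]).
rewrite (bigD1 i)//= eqxx big_seq1 expr1n mulr1 big1 ?addr0// => j /negPf ->.
by rewrite big_nil mulr0.
Qed.

Lemma qmod1 : qmod 1.
Proof. by rewrite -g0E; exact: qmod_gen. Qed.

Lemma qmod_sq h : qmod (h ^+ 2).
Proof. by rewrite -[_ ^+ 2]mulr1; apply: qmod_sqM; exact: qmod1. Qed.

Lemma qmod0 : qmod 0.
Proof. by exists (fun=> [::]); rewrite big1// => i _; rewrite big_nil mulr0. Qed.

Lemma qmod_sum (I : Type) (r : seq I) (Q : pred I) (F : I -> P) :
  (forall i, Q i -> qmod (F i)) -> qmod (\sum_(i <- r | Q i) F i).
Proof. by move=> QF; elim/big_ind: _ => //; [exact: qmod0|exact: qmodD]. Qed.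

Lemma qmod_scale c p : 0 <= c -> qmod p -> qmod (mpolyC n c * p).
Proof.
by move=> c0 pp; rewrite -(sqr_sqrtr c0) rmorphXn/=; exact: qmod_sqM.
Qed.

Lemma qmod_ge0 x p : feasible g x -> qmod p -> 0 <= peval p x.
Proof.
move=> fx [s ->]; rewrite !pevalE sumr_ge0// => i _; rewrite !pevalE mulr_ge0//.
  case: (unliftP ord0 i) => [j ->|->]; first exact: fx.
  by rewrite g0E peval1.
by rewrite sumr_ge0// => h _; rewrite pevalXn sqr_ge0.
Qed.

End QuadraticModule.

(** * Bernstein expansion and positivity on a box *)

Section Bernstein.
Variable R : realType.

(** Coefficient at index [k] of the monomial of degree [j] in the Bernstein basis of degree [N]; it
    approximates [(k / N) ^ j]. *)
Definition bern_ratio (N j k : nat) : R := 'C(k, j)%:R / 'C(N, j)%:R.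

(** Binomial expansion of [u ^+ j * (u + (1 - u)) ^+ (N - j)]. The commutative algebra [A] allows
    [u] to be a polynomial. *)
Lemma bern_sum (A : comAlgType R) (N j : nat) (u : A) : (j <= N)%N ->
  u ^+ j = \sum_(k < N.+1) bern_ratio N j k *: (u ^+ k * (1 - u) ^+ (N - k) *+ 'C(N, k)).
Proof.
move=> jN.
have cN : 'C(N, j)%:R != 0 :> R by rewrite pnatr_eq0 -lt0n bin_gt0.
have E k : (k < N.+1)%N -> bern_ratio N j k *: (u ^+ k * (1 - u) ^+ (N - k) *+ 'C(N, k)) =
   if (j <= k)%N then u ^+ k * (1 - u) ^+ (N - k) *+ 'C(N - j, k - j) else 0.
  rewrite ltnS => kN; case: leqP => jk; last first.
    by rewrite /bern_ratio bin_small// mul0r scale0r.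
  rewrite -scaler_nat -[RHS]scaler_nat scalerA; congr (_ *: _).
  rewrite /bern_ratio mulrAC -natrM mulnC.
  have -> : ('C(N, k) * 'C(k, j) = 'C(N - j, k - j) * 'C(N, j))%N.
    apply/eqP; rewrite -(eqn_pmul2r (fact_gt0 j)) -(eqn_pmul2r (fact_gt0 (k - j))).
    rewrite -(eqn_pmul2r (fact_gt0 (N - k))).
    have e1 := bin_fact kN; have e2 := bin_fact jk; have e3 := bin_fact jN.
    have kj : (k - j <= N - j)%N by rewrite leq_sub2r.
    have e4 := bin_fact kj.
    have -> : ('C(N, k) * 'C(k, j) * j`! * (k - j)`! * (N - k)`! =
       'C(N, k) * ('C(k, j) * (j`! * (k - j)`!) * (N - k)`!))%N by ring.
    rewrite e2 e1.
    have <- : (N - j - (k - j) = N - k)%N by rewrite subnBA// subnK.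
    have -> : ('C(N - j, k - j) * 'C(N, j) * j`! * (k - j)`! * (N - j - (k - j))`! =
       'C(N, j) * (j`! * ('C(N - j, k - j) * ((k - j)`! * (N - j - (k - j))`!))))%N by ring.
    by rewrite e4 e3.
  by rewrite natrM mulfK.
rewrite (eq_bigr (fun k : 'I_N.+1 => if (j <= k)%N then
  u ^+ k * (1 - u) ^+ (N - k) *+ 'C(N - j, k - j) else 0)); last first.
  by move=> k _; rewrite E.
rewrite -(big_mkord xpredT (fun k => if (j <= k)%N then
  u ^+ k * (1 - u) ^+ (N - k) *+ 'C(N - j, k - j) else 0)).
rewrite (big_cat_nat (n := j))//=; last by rewrite ltnW.
rewrite big1_seq ?add0r; last first.
  by move=> k; rewrite mem_index_iota /= => kj; rewrite leqNgt kj.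
rewrite -{2}[j]add0n big_addn big_mkord subSn//.
rewrite (eq_bigr (fun k : 'I_(N - j).+1 => u ^+ j * ((1 - u) ^+ (N - j - k) * u ^+ k *+ 'C(N -
  j, k)))).
  by rewrite -mulr_sumr -exprDn subrK expr1n mulr1.
move=> k _; rewrite leq_addl addnK mulrnAr exprD -subnDA [(j + k)%N]addnC.
by congr (_ *+ _); ring.
Qed.

Lemma bern_ratioS N j k : (j < N)%N ->
  bern_ratio N j.+1 k = bern_ratio N j k * ((k - j)%N%:R / (N - j)%N%:R).
Proof.
move=> jN; rewrite /bern_ratio.
have j1 : j.+1%:R != 0 :> R by rewrite pnatr_eq0.
have Nj : (N - j)%N%:R != 0 :> R by rewrite pnatr_eq0 -lt0n subn_gt0.
have c1 : 'C(N, j)%:R != 0 :> R by rewrite pnatr_eq0 -lt0n bin_gt0 ltnW.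
have ek : 'C(k, j.+1)%:R = (k - j)%N%:R * 'C(k, j)%:R / j.+1%:R :> R.
  by rewrite -natrM -mul_bin_left natrM mulrC mulKf.
have eN : 'C(N, j.+1)%:R = (N - j)%N%:R * 'C(N, j)%:R / j.+1%:R :> R.
  by rewrite -natrM -mul_bin_left natrM mulrC mulKf.
have F (a c d e f : R) : d != 0 -> e != 0 -> f != 0 ->
    (a * c / f) / (d * e / f) = c / e * (a / d).
  by move=> d0 e0 f0; field; rewrite d0 e0 f0.
by rewrite ek eN F.
Qed.

Lemma bern_ratio_itv N j k : (j <= N)%N -> (k <= N)%N -> 0 <= bern_ratio N j k <= 1.
Proof.
move=> jN kN; rewrite /bern_ratio divr_ge0//= ler_pdivrMr ?ltr0n ?bin_gt0//.
by rewrite mul1r ler_nat leq_bin2l.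
Qed.

(** The ratio is the product over i < j of the factors [(k - i) / (N - i)], with truncated
    subtraction, all in [0, 1] and within [D / (N - D)] of [k / N]. *)
Lemma bern_ratio_approx D N j k : (j <= D)%N -> (D < N)%N -> (k <= N)%N ->
  `|bern_ratio N j k - (k%:R / N%:R) ^+ j| <= j%:R * (D%:R / (N - D)%N%:R).
Proof.
move=> jD DN kN; elim: j jD => [|j IH] jD.
  by rewrite /bern_ratio !bin0 divr1 expr0 subrr normr0 mul0r.
have jN : (j < N)%N by apply: leq_trans jD (ltnW DN).
have {IH} IH := IH (ltnW jD).
have N0 : 0 < N%:R :> R by rewrite ltr0n (leq_ltn_trans _ DN).
have Nj : 0 < (N - j)%N%:R :> R by rewrite ltr0n subn_gt0.
have ND : 0 < (N - D)%N%:R :> R by rewrite ltr0n subn_gt0.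
have [b0 b1] := andP (bern_ratio_itv (ltnW jN) kN).
set b := bern_ratio N j k in IH b0 b1.
set x : R := k%:R / N%:R.
have x0 : 0 <= x by rewrite divr_ge0.
have x1 : x <= 1 by rewrite ler_pdivrMr// mul1r ler_nat.
set y : R := (k - j)%N%:R / (N - j)%N%:R.
have y0 : 0 <= y by rewrite divr_ge0.
have y1 : y <= 1 by rewrite ler_pdivrMr// mul1r ler_nat leq_sub2r.
have xy : `|y - x| <= D%:R / (N - D)%N%:R.
  apply: (@le_trans _ _ (j%:R / (N - j)%N%:R)); last first.
    rewrite ler_pdivrMr// mulrAC ler_pdivlMr// -!natrM ler_nat leq_mul//.
      exact: ltnW.
    by rewrite leq_sub2l// ltnW.
  have [kj|jk] := leqP k j.
    have -> : y = 0 by rewrite /y (eqP (_ : (k - j)%N == 0)%N)// mul0r.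
    rewrite sub0r normrN ger0_norm// ler_pdivrMr// mulrAC ler_pdivlMr//.
    by rewrite -!natrM ler_nat leq_mul// leq_subr.
  have jkE : (k - j)%N%:R = k%:R - j%:R :> R by rewrite natrB// ltnW.
  have jNE : (N - j)%N%:R = N%:R - j%:R :> R by rewrite natrB// ltnW.
  have yx : y - x = - (j%:R * (N%:R - k%:R) / (N%:R * (N - j)%N%:R)).
    have n1 : N%:R != 0 :> R by rewrite gt_eqF.
    have n2 : N%:R - j%:R != 0 :> R by rewrite -jNE gt_eqF.
    by rewrite /y /x jkE jNE; field; rewrite n1 n2.
  rewrite yx normrN ger0_norm; last first.
    by rewrite !(mulr_ge0, divr_ge0)// ?invr_ge0 ?mulr_ge0// subr_ge0 ler_nat.
  rewrite invfM mulrA; apply: ler_wpM2r; first by rewrite invr_ge0 ltW.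
  rewrite ler_pdivrMr//; apply: ler_wpM2l => //.
  by rewrite gerBl.
rewrite bern_ratioS// -/y -/b exprSr.
have -> : b * y - x ^+ j * x = (b - x ^+ j) * y + x ^+ j * (y - x) by ring.
apply: le_trans (ler_normD _ _) _;
  rewrite (normrM (b - _)) (normrM (x ^+ j)) -(natr1 j) mulrDl mul1r.
apply: lerD.
  by apply: le_trans IH; rewrite ler_piMr// ger0_norm.
apply: le_trans xy; rewrite ler_piMl// ger0_norm ?exprn_ge0// exprn_ile1//.
Qed.

Lemma prod_diff_le (I : Type) (r : seq I) (x y : I -> R) :
  (forall i, 0 <= x i <= 1) -> (forall i, 0 <= y i <= 1) ->
  `|\prod_(i <- r) x i - \prod_(i <- r) y i| <= \sum_(i <- r) `|x i - y i|.
Proof.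
move=> x01 y01; elim: r => [|i r IH]; first by rewrite !big_nil subrr normr0.
rewrite !big_cons; set X := \prod_(_ <- _) x _ in IH *; set Y := \prod_(_ <- _) y _ in IH *.
have -> : x i * X - y i * Y = (x i - y i) * X + y i * (X - Y) by ring.
apply: le_trans (ler_normD _ _) _; rewrite !normrM; apply: lerD.
  have /andP[X0 X1] : 0 <= X <= 1.
    rewrite /X; elim/big_ind: _ => [|a b /andP[a0 a1] /andP[b0 b1]|j _]; last exact: x01.
      by rewrite ler01 lexx.
    by rewrite mulr_ge0//= mulr_ile1.
  by rewrite ler_piMr// ger0_norm.
apply: le_trans IH; rewrite ler_piMl//; have /andP[y0 y1] := y01 i.
by rewrite ger0_norm.
Qed.

Variable n : nat.
Local Notation P := (mpoly n R).

Lemma comp_mpolyE_prod k (q : P) (t : n.-tuple (mpoly k R)) :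
  comp_mpoly t q = \sum_(a <- msupp q) mcoeff a q *: \prod_i tnth t i ^+ a i.
Proof.
by rewrite /comp_mpoly /mmap; apply: eq_bigr => a _; rewrite mul_mpolyC.
Qed.

(* Affine change of variables to the unit cube, where the Bernstein expansion
   of degree [N] in each variable has nonnegative coefficients for large [N]. *)
Lemma box_positive (T : P -> Prop) (rho : R) (p : P) : 0 < rho ->
  (forall q1 q2, T q1 -> T q2 -> T (q1 + q2)) ->
  (forall q1 q2, T q1 -> T q2 -> T (q1 * q2)) ->
  (forall c, 0 <= c -> T (mpolyC n c)) ->
  (forall i, T (mpolyC n rho + var R i)) -> (forall i, T (mpolyC n rho - var R i)) ->
  (forall x : 'rV[R]_n, (forall i, - rho <= x 0 i <= rho) -> 0 < peval p x) ->
  T p.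
Proof.
move=> rho0 TD TM TC Tp Tm ppos.
have Tscale c q : 0 <= c -> T q -> T (c *: q).
  by move=> c0 Tq; rewrite -mul_mpolyC; apply: TM => //; exact: TC.
have T0 : T 0 by rewrite -(mpolyC0 n R); exact: TC.
have T1 : T 1 by exact: TC.
pose u i : P := (2 * rho)^-1 *: (mpolyC n rho + var R i).
have rho2 : 0 < 2 * rho by rewrite mulr_gt0.
have uE i : 1 - u i = (2 * rho)^-1 *: (mpolyC n rho - var R i).
  have E : 1 = (2 * rho)^-1 *: ((2 * rho) *: 1) :> P.
    by rewrite scalerA mulVf ?scale1r// gt_eqF.
  rewrite {1}E -scalerBr; congr (_ *: _).
  rewrite -mul_mpolyC mulr1 mulrDl mul1r mpolyCD; ring.
have Tu i : T (u i) by apply: Tscale => //; rewrite invr_ge0 ltW.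
have T1u i : T (1 - u i) by rewrite uE; apply: Tscale => //; rewrite invr_ge0 ltW.
pose tin := [tuple (2 * rho) *: var R i - mpolyC n rho | i < n].
pose q := comp_mpoly tin p.
have pE : p = \sum_(a <- msupp q) mcoeff a q *: \prod_i u i ^+ a i.
  have -> : \sum_(a <- msupp q) mcoeff a q *: \prod_i u i ^+ a i =
            comp_mpoly [tuple u i | i < n] q.
    rewrite comp_mpolyE_prod; apply: eq_bigr => a _; congr (_ *: _).
    by apply: eq_bigr => i _; rewrite tnth_mktuple.
  rewrite /q [comp_mpoly tin p]comp_mpolyE_prod raddf_sum/= {1}[p]mpolyE.
  apply: eq_bigr => a _; rewrite comp_mpolyZ rmorph_prod/=; congr (_ *: _).
  rewrite mpolyXE_id; apply: eq_bigr => i _; rewrite rmorphXn/=; congr (_ ^+ _).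
  rewrite tnth_mktuple rmorphB/= comp_mpolyZ comp_mpolyC.
  have -> : comp_mpoly [tuple u i | i < n] (var R i) = u i.
    by rewrite comp_mpolyXU -tnth_nth tnth_mktuple.
  by rewrite /u scalerA mulfV ?gt_eqF// scale1r addrC addKr.
have qpos (z : 'rV[R]_n) : (forall i, 0 <= z 0 i <= 1) -> 0 < peval q z.
  move=> z01; rewrite /q /peval comp_mpoly_meval.
  have := ppos (\row_i (2 * rho * z 0 i - rho)) _; rewrite /peval.
  under meval_eq => i do rewrite mxE.
  move=> h; under meval_eq => i.
    rewrite tnth_mktuple -[meval _ _]/(peval _ z) !pevalE; over.
  apply: h => i; rewrite mxE; have /andP[z0 z1] := z01 i.
  apply/andP; split; nra.
pose cube := [set z : 'rV[R]_n | forall i, 0 <= z 0 i <= 1].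
have ccube : compact cube.
  apply: (@compact_in_box _ _ 1); last first.
    by move=> z z01 i; have /andP[z0 z1] := z01 i; apply/andP; split=> //; lra.
  rewrite [X in closed X](_ : _ = \bigcap_(i in [set: 'I_n])
    ([set z : 'rV[R]_n | 0 <= z 0 i] `&` [set z : 'rV[R]_n | z 0 i <= 1])); last first.
    apply/seteqP; split=> z /= h i; first by move=> _; have /andP[] := h i.
    by have [/= -> ->] := h i I.
  apply: closed_bigI => i _; apply: closedI.
    by apply: closed_preim_ge; exact: continuous_coord.
  by apply: closed_preim_le; exact: continuous_coord.
have [z0 z0c zmin] : exists2 c, cube c & forall t, cube t -> peval q c <= peval q t.
  apply: compact_min => //; last exact: continuous_peval.
  by exists 0 => i; rewrite mxE lexx ler01.
set d := peval q z0 in zmin; have d0 : 0 < d by exact: qpos.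
pose D := mmeasure mdeg q.
(* A Bernstein coefficient of [q] differs from the value of [q] at the grid point [kk / N] by at
   most [L / (N - D)]. That value is at least [d], and [N] is chosen to make the error at most
   [d]. *)
pose L := \sum_(a <- msupp q) `|mcoeff a q| * (n%:R * (D%:R * D%:R)).
have L0 : 0 <= L by apply: sumr_ge0 => a _; rewrite !mulr_ge0.
pose k0 := Num.truncn (L / d).
pose N := (D + k0.+1)%N.
have DN : (D < N)%N by rewrite /N addnS ltnS leq_addr.
have aD a i : a \in msupp q -> (a i <= D)%N.
  move=> /msize_mdeg_lt; rewrite -/D => /ltnW; apply: leq_trans.
  by rewrite mdegE (bigD1 i)//= leq_addr.
pose B (kk : {ffun 'I_n -> 'I_N.+1}) : P :=
  \prod_i (u i ^+ kk i * (1 - u i) ^+ (N - kk i) *+ 'C(N, kk i)).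
pose coef (kk : {ffun 'I_n -> 'I_N.+1}) : R :=
  \sum_(a <- msupp q) mcoeff a q * \prod_i bern_ratio N (a i) (kk i).
have pB : p = \sum_kk coef kk *: B kk.
  rewrite pE.
  under [RHS]eq_bigr do rewrite scaler_suml.
  rewrite exchange_big/=; rewrite !big_seq; apply: eq_bigr => a aq.
  transitivity (mcoeff a q *: \prod_i \sum_(k < N.+1) bern_ratio N (a i) k *:
     (u i ^+ k * (1 - u i) ^+ (N - k) *+ 'C(N, k))).
    congr (_ *: _); apply: eq_bigr => i _; apply: bern_sum.
    by apply: leq_trans (ltnW DN); exact: aD.
  rewrite bigA_distr_bigA/= scaler_sumr; apply: eq_bigr => kk _.
  rewrite -scalerA; congr (_ *: _).
  rewrite /B -[RHS]mul_mpolyC rmorph_prod -big_split/=; apply: eq_bigr => i _.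
  by rewrite mul_mpolyC.
have TB kk : T (B kk).
  rewrite /B; elim/big_ind: _ => // i _.
  have Tn r k : T r -> T (r ^+ k).
    by move=> Tr; elim: k => [|k IH]; [rewrite expr0|rewrite exprS; exact: TM].
  rewrite -scaler_nat; apply: Tscale => //.
  by apply: TM; exact: Tn.
have coef0 kk : 0 <= coef kk.
  pose z : 'rV[R]_n := \row_i ((kk i)%:R / N%:R).
  have N0 : 0 < N%:R :> R by rewrite ltr0n /N addnS.
  have zc : cube z.
    move=> i; rewrite mxE divr_ge0//= ler_pdivrMr// mul1r ler_nat.
    by rewrite -ltnS.
  have dq : d <= peval q z := zmin _ zc.
  suff : `|peval q z - coef kk| <= d.
    by rewrite ler_norml => /andP[_ +]; lra.
  rewrite /peval mevalE /coef -sumrB.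
  apply: le_trans (ler_norm_sum _ _ _) _.
  apply: (@le_trans _ _ (L / (N - D)%N%:R)); last first.
    rewrite ler_pdivrMr ?ltr0n ?subn_gt0// mulrC -ler_pdivrMr//.
    by rewrite /N addKn ltW// Num.Theory.truncnS_gt.
  rewrite /L mulr_suml !big_seq; apply: ler_sum => a aq.
  rewrite -mulrBr normrM -!mulrA; apply: ler_wpM2l => //.
  apply: le_trans (prod_diff_le _ _ _) _.
  - by move=> i; have /andP[h0 h1] := zc i; rewrite exprn_ge0//= exprn_ile1.
  - move=> i; apply: bern_ratio_itv; last by rewrite -ltnS.
    by apply: leq_trans (ltnW DN); exact: aD.
  apply: (@le_trans _ _ (\sum_(i < n) D%:R * (D%:R / (N - D)%N%:R))); last first.
    by rewrite sumr_const card_ord -[leLHS]mulr_natl.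
  apply: ler_sum => i _; rewrite distrC mxE.
  apply: le_trans (bern_ratio_approx (aD a i aq) DN _) _; first by rewrite -ltnS.
  by apply: ler_wpM2r; [rewrite divr_ge0|rewrite ler_nat aD].
rewrite pB; elim/big_ind: _ => // kk _; exact: Tscale.
Qed.

End Bernstein.

Section Bounds.
Variable R : realType.

Lemma compact_pos_lb (T : topologicalType) (f : T -> R) (A : set T) :
  compact A -> continuous f -> (forall x, A x -> 0 < f x) ->
  exists2 d, 0 < d & forall x, A x -> d <= f x.
Proof.
move=> cA cf Af; have [A0|/set0P/negP] := pselect (A !=set0); last first.
  by rewrite negbK => /eqP ->; exists 1.
by have [c Ac cmin] := compact_min A0 cA cf; exists (f c) => //; exact: Af.
Qed.

Lemma compact_ub (T : topologicalType) (f : T -> R) (A : set T) :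
  compact A -> continuous f -> exists2 b, 0 < b & forall x, A x -> f x <= b.
Proof.
move=> cA cf; have [A0|/set0P/negP] := pselect (A !=set0); last first.
  by rewrite negbK => /eqP ->; exists 1.
have [|c Ac cmin] := compact_min A0 cA (f := fun x => - f x).
  by move=> x; apply: cvgN; exact: cf.
exists (`|f c| + 1); first by rewrite ltr_wpDl.
move=> x Ax; have := cmin x Ax; rewrite lerN2 => /le_trans; apply.
by apply: le_trans (ler_norm _) _; rewrite lerDl.
Qed.

(** 1 - (1 - y)^(K+1) is [y] times a sum of K + 1 powers of [1 - y], the least of which is the
    K-th. *)
Lemma mul_pow_sub_le (y : R) K : 0 <= y <= 1 -> y * (1 - y) ^+ K * K.+1%:R <= 1.
Proof.
move=> /andP[y0 y1]; suff : y * (1 - y) ^+ K * K.+1%:R <= 1 - (1 - y) ^+ K.+1.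
  by move/le_trans; apply; rewrite lerBlDr lerDl exprn_ge0// subr_ge0.
elim: K => [|K IH]; first by rewrite expr0 expr1; lra.
have z0 : 0 <= (1 - y) ^+ K by rewrite exprn_ge0// subr_ge0.
rewrite [in leRHS]exprS -(natr1 K.+1) mulrDr mulr1.
rewrite exprS in IH *; set z := (1 - y) ^+ K in IH z0 *.
set k := K.+1%:R in IH *; have k0 : 0 <= k by rewrite ler0n.
have : y * z * k * (1 - y) <= y * z * k.
  by rewrite ler_piMr ?mulr_ge0//; lra.
nra.
Qed.

Lemma pow_bernoulli (y : R) K : 0 <= y -> 1 + K%:R * y <= (1 + y) ^+ K.
Proof.
move=> y0; elim: K => [|K IH]; first by rewrite mul0r addr0 expr0.
rewrite exprS -natr1; have K0 : 0 <= K%:R :> R by rewrite ler0n.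
have : (1 + y) * (1 + K%:R * y) <= (1 + y) * (1 + y) ^+ K.
  by apply: ler_wpM2l => //; rewrite addr_ge0.
move/(le_trans _); apply; nra.
Qed.

End Bounds.

Section Putinar.
Variables (R : realType) (n m : nat) (g : 'I_m.+1 -> mpoly n R).
Local Notation P := (mpoly n R).
Implicit Types (p q h : P) (x : 'rV[R]_n).

Definition sos p : Prop := exists s : seq P, p = \sum_(h <- s) h ^+ 2.

Lemma sosD p q : sos p -> sos q -> sos (p + q).
Proof. by move=> [s ->] [t ->]; exists (s ++ t); rewrite big_cat. Qed.

Lemma sosM p q : sos p -> sos q -> sos (p * q).
Proof.
move=> [s ->] [t ->]; exists [seq a * b | a <- s, b <- t].
rewrite big_allpairs_dep/= big_distrlr/=; apply: eq_bigr => a _.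
by apply: eq_bigr => b _; rewrite exprMn.
Qed.

Lemma sos_sq h : sos (h ^+ 2).
Proof. by exists [:: h]; rewrite big_seq1. Qed.

Lemma sos0 : sos 0.
Proof. by exists [::]; rewrite big_nil. Qed.

Lemma sosC (c : R) : 0 <= c -> sos (mpolyC n c).
Proof. by move=> c0; rewrite -(sqr_sqrtr c0) rmorphXn/=; exact: sos_sq. Qed.

Lemma sos_sum (I : Type) (r : seq I) (Q : pred I) (F : I -> P) :
  (forall i, Q i -> sos (F i)) -> sos (\sum_(i <- r | Q i) F i).
Proof. by move=> QF; elim/big_ind: _ => //; [exact: sos0|exact: sosD]. Qed.

Lemma qmod_sosM q p : sos q -> qmod g p -> qmod g (q * p).
Proof.
move=> [s ->] gp; rewrite mulr_suml; apply: qmod_sum => h _; exact: qmod_sqM.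
Qed.

Variables (i1 : 'I_m) (c rad : R).
Hypotheses (g0E : g ord0 = 1) (c_gt0 : 0 < c) (rad_gt0 : 0 < rad).
Hypothesis g1E : g (lift ord0 i1) = c *: (mpolyC n rad - \sum_j var R j ^+ 2).

Let rho := Num.sqrt rad.
Let w : P := mpolyC n rad - \sum_j var R j ^+ 2.
Let box := [set x : 'rV[R]_n | forall i, - rho <= x 0 i <= rho].

Lemma feasible_box x : feasible g x -> box x.
Proof.
move=> /(_ i1); rewrite g1E !pevalE pmulr_rge0// subr_ge0 => le i.
rewrite -ler_norml -sqrtr_sqr ler_sqrt; last exact: ltW.
apply: le_trans le; rewrite (bigD1 i)//= !pevalE lerDl sumr_ge0// => j _.
by rewrite !pevalE sqr_ge0.
Qed.

Lemma closed_feasible : closed (feasible g).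
Proof.
rewrite [X in closed X](_ : _ = \bigcap_(i in [set: 'I_m])
   [set x | 0 <= peval (g (lift ord0 i)) x]); last first.
  by apply/seteqP; split=> x /= h i; [move=> _; exact: h|exact: (h i I)].
apply: closed_bigI => i _; apply: closed_preim_ge; exact: continuous_peval.
Qed.

Lemma compact_feasible : compact (feasible g).
Proof. exact: (compact_in_box closed_feasible feasible_box). Qed.

(** With the single generator [w], the set [T] of sums of an sos and an sos multiple of [w] is
    closed under products, as [w ^+ 2] is a square; this fails in general for several generators. So
    [box_positive] applies to [T], which lies in the module of [g]. *)
Lemma qmod_box_positive q : (forall x, box x -> 0 < peval q x) -> qmod g q.
Proof.
move=> qpos.
have rho0 : 0 < rho by rewrite sqrtr_gt0.
have rho2 : rho ^+ 2 = rad by rewrite sqr_sqrtr// ltW.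
pose T t := exists a b : P, [/\ sos a, sos b & t = a + b * w].
suff [a [b [sa sb ->]]] : T q.
  apply: qmodD; first by rewrite -[a]mulr1; apply: qmod_sosM => //; exact: qmod1.
  apply: qmod_sosM => //.
  have -> : w = mpolyC n c^-1 * g (lift ord0 i1).
    by rewrite g1E mul_mpolyC scalerA mulVf ?scale1r// gt_eqF.
  by apply: qmod_scale; [rewrite invr_ge0 ltW|exact: qmod_gen].
(* With [e] a sign, 2 rho (rho + e x_i) is the sum of (rho + e x_i)^2, of the x_j^2 for j != i, and
   of w. *)
have Tlin i (e : R) : e ^+ 2 = 1 -> T (mpolyC n rho + mpolyC n e * var R i).
  move=> e1; exists (mpolyC n (2 * rho)^-1 * ((mpolyC n rho + mpolyC n e * var R i) ^+ 2 +
      \sum_(j < n | j != i) var R j ^+ 2)), (mpolyC n (2 * rho)^-1).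
  have i0 : 0 <= (2 * rho)^-1 by rewrite invr_ge0 mulr_ge0// ltW.
  split.
  - apply: sosM; first exact: sosC.
    by apply: sosD; [exact: sos_sq|apply: sos_sum => j _; exact: sos_sq].
  - exact: sosC.
  - have -> : w = mpolyC n rho ^+ 2 - (var R i ^+ 2 + \sum_(j < n | j != i) var R j ^+ 2).
      by rewrite -rmorphXn/= rho2 /w (bigD1 i).
    rewrite -mulrDr.
    set S := \sum_(_ < _ | _) _; set X := var R i; set r := mpolyC n rho.
    set E := mpolyC n e; have E1 : E ^+ 2 = 1 by rewrite -rmorphXn/= e1.
    have -> : (r + E * X) ^+ 2 + S + (r ^+ 2 - (X ^+ 2 + S)) = 2 * r * (r + E * X).
      have -> : (r + E * X) ^+ 2 = r ^+ 2 + 2 * (r * E * X) + E ^+ 2 * X ^+ 2 by ring.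
      by rewrite E1; ring.
    have -> : 2 * r = mpolyC n (2 * rho) by rewrite rmorphM/= rmorphMn.
    by rewrite mulrA -rmorphM/= mulVf ?mul1r// gt_eqF// mulr_gt0.
apply: (@box_positive _ _ T rho) => //.
- move=> q1 q2 [a [b [sa sb ->]]] [a' [b' [sa' sb' ->]]].
  exists (a + a'), (b + b'); split; [exact: sosD|exact: sosD|ring].
- move=> q1 q2 [a [b [sa sb ->]]] [a' [b' [sa' sb' ->]]].
  exists (a * a' + b * b' * w ^+ 2), (a * b' + a' * b); split.
  + by apply: sosD; [exact: sosM|apply: sosM; [exact: sosM|exact: sos_sq]].
  + by apply: sosD; exact: sosM.
  + ring.
- move=> e e0; exists (mpolyC n e), 0; split; [exact: sosC|exact: sos0|].
  by rewrite mul0r addr0.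
- by move=> i; have := Tlin i 1; rewrite expr1n mul1r; apply.
- by move=> i; have := Tlin i (- 1); rewrite sqrrN expr1n rmorphN rmorph1 mulN1r; apply.
Qed.

(* Subtracting [G (1 - G) ^ (2k)], with [G] the rescaled constraints, makes the
   polynomial positive on the whole box once [k] is large: where [G >= 0] the
   term is at most [1 / (2k + 1)], where [G < 0] it tends to minus infinity. *)
Theorem putinar p : (forall x, feasible g x -> 0 < peval p x) -> qmod g p.
Proof.
move=> ppos.
have cbox : compact box by exact: compact_box.
have cg i : continuous (fun x => peval (g (lift ord0 i)) x) by exact: continuous_peval.
have cabs i : continuous (fun x => `|peval (g (lift ord0 i)) x|).
  by apply: continuous_norm_real; exact: cg.
have [d d0 dp] := compact_pos_lb compact_feasible (@continuous_peval _ _ p) ppos.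
have [G G0 gG] : exists2 G, 0 < G & forall i x, box x -> `|peval (g (lift ord0 i)) x| <= G.
  have [G G0 gG] := compact_ub cbox (continuous_sum_real (r := index_enum 'I_m)
     (P := xpredT) (F := fun i x => `|peval (g (lift ord0 i)) x|) (fun i _ => cabs i)).
  exists G => // i x bx; apply: le_trans (gG x bx).
  by rewrite (bigD1 i)//= lerDl sumr_ge0.
(* The total violation: nonnegative, and zero exactly on the feasible set. On [K2], which is compact
   and misses that set, it is at least some [t > 0]. *)
pose v x := \sum_(i < m) (`|peval (g (lift ord0 i)) x| + (- 1) * peval (g (lift ord0 i)) x).
have cv : continuous v.
  apply: continuous_sum_real => i _; apply: continuous_add_real; first exact: cabs.
  by apply: continuous_mul_real; [exact: continuous_const_real|exact: cg].
have v0 x i : 0 <= `|peval (g (lift ord0 i)) x| + (- 1) * peval (g (lift ord0 i)) x.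
  by rewrite mulN1r subr_ge0 ler_norm.
pose K2 := [set x | box x /\ peval p x <= d / 2].
have cK2 : compact K2.
  apply: (subclosed_compact _ cbox); last by move=> x [].
  apply: (@closedI _ box); first exact: (compact_closed (@norm_hausdorff _ _)).
  by apply: closed_preim_le; exact: continuous_peval.
have [t t0 tv] : exists2 t, 0 < t & forall x, K2 x -> t <= v x.
  apply: compact_pos_lb => // x [bx px]; rewrite lt_neqAle sumr_ge0 ?andbT//.
  apply/eqP => /esym/eqP; rewrite psumr_eq0// => /allP v0x.
  suff fx : feasible g x by have := dp x fx; move: px d0; lra.
  move=> i; have := v0x i (mem_index_enum i); rewrite /= mulN1r subr_eq0 => /eqP <-.
  exact: normr_ge0.
have [B B0 pB] := compact_ub cbox (@continuous_peval _ _ (- p)).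
have m0 : 0 < m%:R :> R by rewrite ltr0n (leq_trans _ (ltn_ord i1)).
pose t1 := t / (2 * m%:R * G).
have t10 : 0 < t1 by rewrite divr_gt0// !mulr_gt0.
(* The first summand makes [m / (2k + 1)] at most [d / 2]; the second makes the gain [k * t1 ^+ 2]
   at a violated constraint exceed [B + m], which bounds [- p] plus the other terms. *)
pose kR := 2 * m%:R / d + (B + m%:R) / t1 ^+ 2.
have a1 : 0 < 2 * m%:R / d by rewrite divr_gt0// mulr_gt0.
have a2 : 0 < (B + m%:R) / t1 ^+ 2 by apply: divr_gt0; [exact: addr_gt0|exact: exprn_gt0].
pose k := (Num.truncn kR).+1.
have kRk : kR < k%:R by exact: Num.Theory.truncnS_gt.
pose Gi i : P := mpolyC n G^-1 * g (lift ord0 i).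
pose q := p - \sum_(i < m) Gi i * ((1 - Gi i) ^+ k) ^+ 2.
have -> : p = q + \sum_(i < m) mpolyC n G^-1 * (((1 - Gi i) ^+ k) ^+ 2 * g (lift ord0 i)).
  rewrite /q -addrA -[LHS]addr0; congr (_ + _); apply/esym/eqP.
  rewrite addrC subr_eq0; apply/eqP; apply: eq_bigr => i _; rewrite /Gi; ring.
apply: qmodD; last first.
  apply: qmod_sum => i _; apply: qmod_scale; first by rewrite invr_ge0 ltW.
  by apply: qmod_sqM; exact: qmod_gen.
apply: qmod_box_positive => x bx.
rewrite /q pevalB peval_sum subr_gt0.
pose y i := G^-1 * peval (g (lift ord0 i)) x.
have yE i : peval (Gi i) x = y i by rewrite /Gi !pevalE.
under eq_bigr => i _ do rewrite pevalM !pevalXn pevalB peval1 yE -exprM.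
have y1 i : `|y i| <= 1.
  by rewrite /y normrM gtr0_norm ?invr_gt0// ler_pdivrMl// mulr1 gG.
have yk i : y i * (1 - y i) ^+ (k * 2) <= (k * 2).+1%:R^-1.
  have [yi|yi] := leP (y i) 0.
    apply: (@le_trans _ _ 0); last by rewrite invr_ge0.
    rewrite mulr_le0_ge0// exprn_ge0// subr_ge0 (le_trans yi)//.
  rewrite -[_^-1]mul1r ler_pdivlMr//; apply: mul_pow_sub_le.
  by rewrite ltW//= (le_trans (ler_norm _)).
have k21 : 0 < (k * 2).+1%:R :> R by [].
have k2k : k%:R * 2 <= (k * 2).+1%:R :> R by rewrite -natrM ler_nat leqW.
have kR1 : 2 * m%:R / d < k%:R.
  by apply: le_lt_trans kRk; rewrite lerDl ltW.
have kR2 : (B + m%:R) / t1 ^+ 2 < k%:R.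
  by apply: le_lt_trans kRk; rewrite lerDr ltW.
have [pd|pd] := ltP (d / 2) (peval p x).
  apply: le_lt_trans pd; apply: (@le_trans _ _ (\sum_(i < m) (k * 2).+1%:R^-1)).
    by apply: ler_sum => i _; exact: yk.
  rewrite sumr_const card_ord -[leLHS]mulr_natl ler_pdivrMr//.
  rewrite ltr_pdivrMr// in kR1; nra.
have [i ti] : exists i, t / m%:R <= `|peval (g (lift ord0 i)) x| + (- 1) * peval (g (lift ord0
  i)) x.
  apply: contrapT => /forallNP nt; have := tv x (conj bx pd); apply/negP; rewrite -ltNge.
  have -> : t = \sum_(i < m) t / m%:R.
    by rewrite sumr_const card_ord -[RHS]mulr_natl mulrC divfK// gt_eqF.
  apply: ltr_sum; first by apply/hasP; exists i1 => //; exact: mem_index_enum.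
  by move=> i _; rewrite ltNge; apply/negP/nt.
have yi : y i <= - t1.
  have gi : peval (g (lift ord0 i)) x <= - (t / m%:R / 2).
    have tm : 0 < t / m%:R by rewrite divr_gt0.
    have [h|h] := leP 0 (peval (g (lift ord0 i)) x).
      by move: ti; rewrite ger0_norm//; lra.
    by move: ti; rewrite ltr0_norm//; lra.
  rewrite /y ler_pdivrMl//; apply: le_trans gi _; rewrite mulrN lerN2.
  by rewrite le_eqVlt; apply/orP; left; apply/eqP; rewrite /t1; field; rewrite !gt_eqF.
rewrite (bigD1 i)//=.
have s1 : \sum_(j < m | j != i) y j * (1 - y j) ^+ (k * 2) <= m%:R.
  apply: (@le_trans _ _ (\sum_(j < m) 1)); last by rewrite sumr_const card_ord.
  rewrite [leRHS](bigD1 i)//= -[leLHS]add0r lerD// ler_sum// => j _.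
  by apply: le_trans (yk j) _; rewrite invf_le1// ler1n.
have s2 : y i * (1 - y i) ^+ (k * 2) <= - (t1 * (k%:R * t1)).
  rewrite -lerN2 opprK -mulNr.
  have b : 1 + (k * 2)%:R * t1 <= (1 - y i) ^+ (k * 2).
    apply: le_trans (pow_bernoulli _ (ltW t10)) _.
    rewrite lerXn2r ?nnegrE//; last by rewrite lerD2l lerNr.
    - by rewrite addr_ge0// ltW.
    - by rewrite subr_ge0 (le_trans yi)// (@le_trans _ _ 0)// oppr_le0 ltW.
  apply: ler_pM => //; [exact: ltW|by rewrite mulr_ge0// ltW|by rewrite lerNr|].
  apply: le_trans b; rewrite natrM; nra.
have := pB x bx; rewrite pevalN => pB'.
rewrite ltr_pdivrMr ?exprn_gt0// in kR2.
apply: le_lt_trans (lerD s2 s1) _.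
by rewrite expr2 in kR2; nra.
Qed.

End Putinar.

(** * Representation of the nonnegative polynomial f - f* *)

Section ZerosInInterior.
Variables (R : realType) (n m : nat) (g : 'I_m.+1 -> mpoly n R).
Local Notation P := (mpoly n R).
Variables (i1 : 'I_m) (c rad : R).
Hypotheses (g0E : g ord0 = 1) (c_gt0 : 0 < c) (rad_gt0 : 0 < rad).
Hypothesis g1E : g (lift ord0 i1) = c *: (mpolyC n rad - \sum_j var R j ^+ 2).
Variable F : P.
Hypothesis F_ge0 : forall x, feasible g x -> 0 <= peval F x.

Let cS : compact (feasible g) := compact_feasible c_gt0 rad_gt0 g1E.

(* With [Q = \sum_i a_i ^ 2] and [t = (1 - Q / B) ^ N] one has [1 - t^2 = Q w],
   so that [F = t^2 s + \sum_i a_i ^ 2 (t^2 e_i + w F)]; for large [N] the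
   polynomials [t^2 e_i + w F] are positive on the feasible set. *)
Lemma qmod_of_positive_at_zeros (I : finType) (a e : I -> P) (s : P) :
  qmod g s -> F = s + \sum_i a i ^+ 2 * e i ->
  (forall x i, feasible g x -> peval F x = 0 -> 0 < peval (e i) x) ->
  qmod g F.
Proof.
move=> gs FE epos.
pose Q := \sum_i a i ^+ 2.
have Q0 x : 0 <= peval Q x.
  by rewrite /Q !pevalE sumr_ge0// => i _; rewrite pevalXn sqr_ge0.
have [b b0 bQ] := compact_ub cS (@continuous_peval _ _ Q).
pose B := b + 1; have B0 : 0 < B by rewrite addr_gt0.
pose u : P := 1 - mpolyC n B^-1 * Q.
have u01 x : feasible g x -> 0 < peval u x <= 1.
  move=> fx; have Qx := bQ x fx; rewrite /u pevalB peval1 pevalM pevalC.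
  apply/andP; split; last by rewrite gerBl mulr_ge0// invr_ge0 ltW.
  by rewrite subr_gt0 ltr_pdivrMl// mulr1 (le_lt_trans Qx)// ltrDl.
(* Where [e i <= 0], [F] has no zero and so a positive lower bound by compactness; [N] is large
   enough for w F, which is at least (2 N / B) t^2 F, to beat t^2 e_i. *)
have [N HN] : exists N, forall i x, feasible g x -> peval (e i) x <= 0 ->
    - peval (e i) x < N%:R * (2 / B) * peval F x.
  have HN i : exists N, forall x, feasible g x -> peval (e i) x <= 0 ->
      - peval (e i) x < N%:R * (2 / B) * peval F x.
    pose K := feasible g `&` [set x | peval (e i) x <= 0].
    have cK : compact K.
      apply: (subclosed_compact _ cS); last by move=> x [].
      apply: closedI; first exact: closed_feasible.
      by apply: closed_preim_le; exact: continuous_peval.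
    have [d d0 dF] : exists2 d, 0 < d & forall x, K x -> d <= peval F x.
      apply: compact_pos_lb => //; first exact: continuous_peval.
      move=> x [fx ex]; rewrite lt_neqAle F_ge0// andbT; apply/eqP => /esym Fx.
      by have := epos x i fx Fx; rewrite ltNge ex.
    have [E E0 eE] := compact_ub cS (@continuous_peval _ _ (- e i)).
    exists (Num.truncn (E * B / (2 * d))).+1 => x fx ex.
    have h := eE x fx; rewrite pevalN in h; apply: (le_lt_trans h).
    have := Num.Theory.truncnS_gt (E * B / (2 * d)).
    set N := (Num.truncn _).+1%:R; rewrite ltr_pdivrMr ?mulr_gt0// => hN.
    have d' := dF x (conj fx ex).
    apply: (@lt_le_trans _ _ (N * (2 / B) * d)); last first.
      by apply: ler_wpM2l => //; rewrite mulr_ge0// divr_ge0// ltW.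
    by rewrite mulrA mulrAC ltr_pdivlMr// -!mulrA.
  have [f Hf] := choice HN; exists (\sum_i f i)%N => i x fx ex.
  apply: lt_le_trans (Hf i x fx ex) _; rewrite -!mulrA; apply: ler_wpM2r.
    by rewrite !mulr_ge0 ?F_ge0 ?invr_ge0 ?(ltW B0).
  by rewrite ler_nat (bigD1 i)//= leq_addr.
pose t := u ^+ N; pose w : P := mpolyC n B^-1 * \sum_(j < N * 2) u ^+ j.
have tw : 1 - t ^+ 2 = Q * w.
  rewrite /t -exprM -[LHS]opprB subrX1 -mulNr opprB /w.
  have -> : 1 - u = mpolyC n B^-1 * Q by rewrite /u; ring.
  by rewrite mulrA [Q * _]mulrC.
have FE' : F = t ^+ 2 * s + \sum_i a i ^+ 2 * (t ^+ 2 * e i + w * F).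
  have E1 : \sum_i a i ^+ 2 * (t ^+ 2 * e i + w * F) =
      t ^+ 2 * \sum_i a i ^+ 2 * e i + Q * w * F.
    rewrite /Q !mulr_suml mulr_sumr -big_split/=; apply: eq_bigr => i _; ring.
  rewrite E1 addrA -mulrDr -FE -tw; ring.
rewrite FE'; apply: qmodD; first exact: qmod_sqM.
apply: qmod_sum => i _; apply: qmod_sqM.
apply: (putinar g0E c_gt0 rad_gt0 g1E) => x fx.
have /andP[u0 u1] := u01 x fx; set ux := peval u x in u0 u1.
have F0 := F_ge0 fx.
have wx : peval w x = B^-1 * \sum_(j < N * 2) ux ^+ j.
  rewrite /w pevalM pevalC peval_sum; congr (_ * _).
  by apply: eq_bigr => j _; rewrite pevalXn.
rewrite pevalD pevalM (pevalM w) wx /t !pevalXn -/ux -exprM;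
  have t0 : 0 < ux ^+ (N * 2) by rewrite exprn_gt0.
have sum_ge : (N * 2)%:R * ux ^+ (N * 2) <= \sum_(j < N * 2) ux ^+ j.
  rewrite -[X in X%:R]card_ord mulr_natl -sumr_const; apply: ler_sum => j _.
  by apply: ler_wiXn2l; [exact: ltW| |exact: ltnW].
set S := \sum_(_ < _) _ in sum_ge *.
have [ei|ei] := ltP 0 (peval (e i) x).
  rewrite ltr_pwDl ?mulr_gt0// !mulr_ge0 ?invr_ge0 ?(ltW B0)//.
  by apply: le_trans sum_ge; rewrite mulr_ge0// ltW.
have := HN i x fx ei; set ex := peval (e i) x; set Fx := peval F x in F0 *.
set tt := ux ^+ (N * 2) in t0 sum_ge *.
have h : B^-1 * ((N * 2)%:R * tt) * Fx <= B^-1 * S * Fx.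
  by apply: ler_wpM2r => //; apply: ler_wpM2l => //; rewrite invr_ge0 ltW.
move=> h2; apply: lt_le_trans (_ : 0 < tt * ex + B^-1 * ((N * 2)%:R * tt) * Fx) _.
  have -> : tt * ex + B^-1 * ((N * 2)%:R * tt) * Fx =
            tt * (N%:R * (2 / B) * Fx - - ex) by rewrite natrM; ring.
  by rewrite mulr_gt0// subr_gt0.
by rewrite lerD2l.
Qed.

(** A cross term is absorbed by the square (d_i/2) (a_i + k_ij a_j / d_i)^2. The price is d_i/2 on
    a_i^2, kept small by the choice of [d], and k_ij^2 / (2 d_i) on a_j^2, which vanishes at the
    zeros of [F]. *)
Lemma qmod_of_vanishing_cross_terms (I : finType) (a e : I -> P) (k : I -> I -> P) (s : P) :
  qmod g s -> F = s + \sum_i a i ^+ 2 * e i + \sum_i \sum_j a i * a j * k i j ->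
  (forall x i, feasible g x -> peval F x = 0 -> 0 < peval (e i) x) ->
  (forall x i j, feasible g x -> peval F x = 0 -> peval (k i j) x = 0) ->
  qmod g F.
Proof.
move=> gs FE epos k0.
(* Each [i] pays [d i / 2] once for every [j], hence the cardinal. *)
have /choice[d Hd] : forall i, exists d : R, 0 < d /\
    forall x, feasible g x -> peval F x = 0 -> #|I|%:R * (d / 2) < peval (e i) x.
  move=> i.
  pose Z := feasible g `&` [set x | peval F x = 0].
  have cZ : compact Z.
    apply: (subclosed_compact _ cS); last by move=> x [].
    apply: closedI; first exact: closed_feasible.
    by apply: closed_preim_eq; exact: continuous_peval.
  have [d d0 de] : exists2 d, 0 < d & forall x, Z x -> d <= peval (e i) x.
    apply: compact_pos_lb => //; first exact: continuous_peval.
    by move=> x [fx Fx]; exact: epos.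
  have I1 : 0 < #|I|%:R + 1 :> R by rewrite ltr_wpDl.
  exists (d / (#|I|%:R + 1)); split; first by rewrite divr_gt0.
  move=> x fx Fx; apply: lt_le_trans (de x (conj fx Fx)).
  rewrite mulrA ltr_pdivrMr// mulrA ltr_pdivrMr//.
  have I0 : 0 <= #|I|%:R :> R by rewrite ler0n.
  nra.
have d0 i : 0 < d i by case: (Hd i).
pose e' i := e i - mpolyC n (#|I|%:R * (d i / 2)) -
  \sum_j mpolyC n (2 * d j)^-1 * k j i ^+ 2.
pose s' := \sum_i \sum_j mpolyC n (d i / 2) * (a i + mpolyC n (d i)^-1 * (k i j * a j)) ^+ 2.
have sqE i j : mpolyC n (d i / 2) * (a i + mpolyC n (d i)^-1 * (k i j * a j)) ^+ 2 =
   mpolyC n (d i / 2) * a i ^+ 2 + a i * a j * k i j +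
   mpolyC n (2 * d i)^-1 * k i j ^+ 2 * a j ^+ 2.
  set A := mpolyC n (d i / 2); set E := mpolyC n (d i)^-1.
  have d1 : d i != 0 by rewrite gt_eqF.
  have AE : A * E * 2 = 1.
    transitivity (mpolyC n (d i / 2 * (d i)^-1 * 2)).
      by rewrite 2!rmorphM/= rmorph_nat.
    by rewrite (_ : d i / 2 * (d i)^-1 * 2 = 1) ?rmorph1//; field.
  have AE2 : A * E ^+ 2 = mpolyC n (2 * d i)^-1.
    by rewrite -rmorphXn -rmorphM/=; congr mpolyC; field.
  transitivity (A * a i ^+ 2 + (A * E * 2) * (a i * (k i j * a j)) +
     A * E ^+ 2 * (k i j * a j) ^+ 2); first by ring.
  by rewrite AE AE2; ring.
have FE' : F = (s + s') + \sum_i a i ^+ 2 * e' i.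
  rewrite FE -!addrA; congr (_ + _).
  have -> : s' = \sum_i mpolyC n (#|I|%:R * (d i / 2)) * a i ^+ 2 +
      (\sum_i \sum_j a i * a j * k i j +
       \sum_j \sum_i mpolyC n (2 * d i)^-1 * k i j ^+ 2 * a j ^+ 2).
    rewrite [X in _ + (_ + X)]exchange_big -!big_split/=; apply: eq_bigr => i _.
    rewrite (eq_bigr _ (fun j _ => sqE i j)) !big_split/= sumr_const -addrA.
    congr (_ + _).
    by rewrite mulr_natl rmorphMn/= mulrnAl.
  have -> : \sum_i a i ^+ 2 * e' i = \sum_i a i ^+ 2 * e i -
      \sum_i mpolyC n (#|I|%:R * (d i / 2)) * a i ^+ 2 -
      \sum_j \sum_i mpolyC n (2 * d i)^-1 * k i j ^+ 2 * a j ^+ 2.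
    rewrite -!sumrB; apply: eq_bigr => i _; rewrite /e' -mulr_suml; ring.
  ring.
apply: qmod_of_positive_at_zeros FE' _.
  apply: qmodD => //; apply: qmod_sum => i _; apply: qmod_sum => j _.
  by apply: qmod_scale; [rewrite divr_ge0// ltW|exact: qmod_sq].
move=> x i fx Fx; rewrite /e' !pevalE big1; last first.
  by move=> j _; rewrite !pevalE k0// expr0n mulr0.
by rewrite oppr0 addr0 subr_gt0; exact: (Hd i).2.
Qed.

End ZerosInInterior.

(** * Taylor expansion at a point with polynomial coefficients *)

Section LocalExpansion.
Variables (R : realType) (n : nat) (x0 : 'rV[R]_n).
Local Notation P := (mpoly n R).
Implicit Types (p q : P) (x : 'rV[R]_n).

Definition shift (i : 'I_n) : P := var R i - mpolyC n (x0 0 i).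

Lemma peval_shift i x : peval (shift i) x = x 0 i - x0 0 i.
Proof. by rewrite /shift !pevalE. Qed.

(** Hadamard's form of the first-order expansion: the remainder is carried by the coefficients, so
    nothing is truncated. *)
Definition expands1 p : Prop := exists p1 : 'I_n -> P,
  p = mpolyC n (peval p x0) + \sum_a shift a * p1 a /\
  forall a, peval (p1 a) x0 = peval (mderiv a p) x0.

Lemma expands1C c : expands1 (mpolyC n c).
Proof.
exists (fun=> 0); split=> [|a]; last by rewrite mderivC !pevalE.
by rewrite big1 ?addr0 ?pevalC// => a _; rewrite mulr0.
Qed.

Lemma expands1D p q : expands1 p -> expands1 q -> expands1 (p + q).
Proof.
move=> [p1 [pE p1E]] [q1 [qE q1E]]; exists (fun a => p1 a + q1 a); split=> [|a].
  under eq_bigr do rewrite mulrDr.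
  by rewrite {1}pE {1}qE big_split/= pevalD rmorphD/= addrACA.
by rewrite mderivD !pevalD p1E q1E.
Qed.

Lemma expands1M p q : expands1 p -> expands1 q -> expands1 (p * q).
Proof.
move=> [p1 [pE p1E]] [q1 [qE q1E]].
exists (fun a => mpolyC n (peval p x0) * q1 a + p1 a * q); split=> [|a].
  under eq_bigr do rewrite mulrDr mulrCA [X in _ + X]mulrA.
  rewrite big_split/= -mulr_sumr -mulr_suml pevalM rmorphM/= addrA -mulrDr -qE.
  by rewrite -mulrDl -pE.
by rewrite mderivM !pevalD !pevalM pevalC p1E q1E addrC.
Qed.

Lemma expands1_var i : expands1 (var R i).
Proof.
exists (fun a => (a == i)%:R); split=> [|a].
  rewrite (bigD1 i)//= eqxx mulr1 big1 ?addr0; last first.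
    by move=> a /negPf ->; rewrite mulr0.
  by rewrite peval_var /shift addrC subrK.
rewrite /var mderivX mnm1E eq_sym; case: eqVneq => [->|_]; last first.
  by rewrite scale0r !pevalE.
have -> : mnm_sub (mnm1 a) (mnm1 a) = mnm0.
  by apply/mnmP => j; rewrite mnmBE mnm0E subnn.
by rewrite scale1r mpolyX0.
Qed.

Lemma expands1_all p : expands1 p.
Proof.
rewrite [p]mpolyE; elim/big_ind: _ => [||a _].
- by rewrite -(mpolyC0 n R); exact: expands1C.
- exact: expands1D.
- rewrite -mul_mpolyC; apply: expands1M; first exact: expands1C.
  rewrite mpolyXE_id; elim/big_ind: _ => [||i _].
  + exact: expands1C.
  + exact: expands1M.
  + elim: (a i) => [|k IH]; first exact: expands1C.
    by rewrite exprS; apply: expands1M; [exact: expands1_var|exact: IH].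
Qed.

(** The coefficients are expanded once more. They need not be symmetric, so only their
    symmetrization at [x0] is tied to the Hessian; differentiating the expansion identifies it. *)
Lemma expand2 p : exists p2 : 'I_n -> 'I_n -> P,
  p = mpolyC n (peval p x0) + \sum_a mpolyC n (gradient p x0 0 a) * shift a +
      \sum_a \sum_b shift a * shift b * p2 a b /\
  forall a b, peval (p2 a b) x0 + peval (p2 b a) x0 = hessian p x0 a b.
Proof.
have [p1 [pE p1E]] := expands1_all p.
have /choice[p2 p2E] := fun a => expands1_all (p1 a).
exists p2; split=> [|c d].
  rewrite {1}pE -addrA; congr (_ + _); rewrite -big_split/=; apply: eq_bigr => a _.
  rewrite mxE -p1E {1}(p2E a).1 mulrDr mulrC mulr_sumr; congr (_ + _).
  by apply: eq_bigr => b _; rewrite mulrA.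
rewrite mxE pE.
have dshift a b : mderiv a (shift b) = (a == b)%:R.
  rewrite /shift mderivB mderivC subr0 /var mderivX mnm1E.
  case: eqVneq => [->|_]; last by rewrite scale0r.
  rewrite scale1r (_ : mnm_sub _ _ = mnm0) ?mpolyX0//.
  by apply/mnmP => j; rewrite mnmBE mnm0E subnn.
have dsum e (h : 'I_n -> P) : mderiv e (\sum_a shift a * h a) =
    h e + \sum_a shift a * mderiv e (h a).
  rewrite raddf_sum/= (eq_bigr (fun a => (e == a)%:R * h a + shift a * mderiv e (h a))).
    rewrite big_split/=; congr (_ + _); rewrite (bigD1 e)//= eqxx mul1r big1 ?addr0//.
    by move=> a; rewrite eq_sym => /negPf ->; rewrite mul0r.
  by move=> a _; rewrite mderivM dshift.
rewrite mderivD mderivC add0r dsum mderivD dsum !pevalD.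
have -> : peval (\sum_a shift a * mderiv c (mderiv d (p1 a))) x0 = 0.
  by rewrite peval_sum big1// => a _; rewrite pevalM peval_shift subrr mul0r.
rewrite addr0.
by rewrite !(p2E _).2 addrC.
Qed.

End LocalExpansion.

(** * Positive semidefinite block matrices and smallest eigenvalues *)

Section PsdBlocks.
Variable R : realType.

Lemma form_mxE n (B : 'M[R]_n) (u : 'rV[R]_n) :
  (u *m B *m u^T) 0 0 = \sum_a \sum_b u 0 a * u 0 b * B a b.
Proof.
rewrite mxE exchange_big/=; apply: eq_bigr => b _.
by rewrite !mxE mulr_suml; apply: eq_bigr => a _; rewrite mulrAC.
Qed.

Lemma psd_congruence N a (M : 'M[R]_N) (V : 'M[R]_(a, N)) : psd M -> psd (V *m M *m V^T).
Proof.
move=> [MT M0]; split; first by rewrite !trmx_mul trmxK MT mulmxA.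
by move=> u; have := M0 (u *m V); rewrite trmx_mul !mulmxA.
Qed.

Lemma psd_mxsub N a (f : 'I_a -> 'I_N) (M : 'M[R]_N) : psd M -> psd (mxsub f f M).
Proof.
move=> pM; have := psd_congruence (rowsub f 1%:M) pM; congr psd.
rewrite mul_rowsub_mx mul1mx trmx_mxsub trmx1 mulmx_colsub mulmx1.
by apply/matrixP => i j; rewrite !mxE.
Qed.

Lemma psd_block_scalar N a (A : 'M[R]_N) (b : R) :
  psd A -> 0 <= b -> psd (block_mx A 0 0 (b%:M : 'M[R]_a)).
Proof.
move=> [AT A0] b0; split; first by rewrite tr_block_mx AT !trmx0 tr_scalar_mx.
move=> u; rewrite -(hsubmxK u) mul_row_block tr_row_mx mul_row_col !mulmx0 addr0 add0r.
rewrite mxE addr_ge0// mul_mx_scalar -scalemxAl mxE mulr_ge0//; exact: dotr_ge0.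
Qed.

Section Diagonal.
Variables (p : nat) (p_ : 'I_p -> nat).

Lemma mxdiag_form (B : forall i, 'M[R]_(p_ i)) (u : 'rV[R]_(\sum_i p_ i)) :
  (u *m \mxdiag_i B i *m u^T) 0 0 =
  \sum_i (submxrow u i *m B i *m (submxrow u i)^T) 0 0.
Proof.
rewrite -{1 2}(submxrowK u) mul_mxrow_mxdiag tr_mxrow mul_mxrow_mxcol summxE.
by [].
Qed.

Lemma dotr_submxrow (u : 'rV[R]_(\sum_i p_ i)) :
  dotr u u = \sum_i dotr (submxrow u i) (submxrow u i).
Proof. by rewrite {1}/dotr -{1 2}(submxrowK u) tr_mxrow mul_mxrow_mxcol summxE. Qed.

Lemma psd_mxdiag (B : forall i, 'M[R]_(p_ i)) : (forall i, psd (B i)) -> psd (\mxdiag_i B i).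
Proof.
move=> pB; split; first by rewrite tr_mxdiag; apply/eq_mxdiagP => i; case: (pB i).
by move=> u; rewrite mxdiag_form sumr_ge0// => i _; case: (pB i).
Qed.

Lemma psd_mxdiag_block (B : forall i, 'M[R]_(p_ i)) i : psd (\mxdiag_i B i) -> psd (B i).
Proof. by move=> pB; rewrite -(submxblock_diag B i); exact: psd_mxsub. Qed.

Lemma tr_mxdiag_mul (B : forall i, 'M[R]_(p_ i)) (M : 'M[R]_(\sum_i p_ i)) :
  \tr (\mxdiag_i B i *m M) = \sum_i \tr (B i *m submxblock M i i).
Proof. by rewrite -{1}(submxblockK M) mul_mxdiag_mxblock mxtrace_mxblock. Qed.

Lemma tr_mxdiag_mxdiag (B G : forall i, 'M[R]_(p_ i)) :
  \tr (\mxdiag_i B i *m \mxdiag_i G i) = \sum_i \tr (B i *m G i).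
Proof. by rewrite tr_mxdiag_mul; apply: eq_bigr => i _; rewrite submxblock_diag. Qed.

End Diagonal.

Lemma psd_of_bounded_form N (B : 'M[R]_N) : B^T = B ->
  (forall u : 'rV[R]_N, `|(u *m B *m u^T) 0 0| <= dotr u u) ->
  psd (1%:M - B) /\ psd (1%:M + B).
Proof.
move=> BT Bu; have h u := Bu u; split; split.
- by rewrite linearB/= trmx1 BT.
- move=> u; have := h u; rewrite ler_norml => /andP[_ b].
  by rewrite mulmxBr mulmxBl mulmx1 mxE [X in _ + X]mxE subr_ge0.
- by rewrite linearD/= trmx1 BT.
- move=> u; have := h u; rewrite ler_norml => /andP[b _].
  by rewrite mulmxDr mulmxDl mulmx1 mxE -lerBlDr sub0r lerNl.
Qed.

Lemma lambda_min_le N (D G : 'M[R]_N) : D^T = D -> psd G ->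
  lambda_min D * \tr G <= \tr (D *m G).
Proof.
move=> DT pG; rewrite -subr_ge0 -mxtraceZ -raddfB -mul_scalar_mx -mulmxBl.
apply: psd_tr_mul_ge0 => //.
have [U [d [UU UU' DE]]] := symmetric_diagonalizable DT.
(* [lambda_min] is an [inf], which lies below the elements of a set only if the set has a lower
   bound; the entries of [d] provide one. *)
have lb : has_lbound [set a | eigenvalue D a].
  exists (- \sum_l `|d 0 l|) => a /eigenvalueP[v vD v0].
  have dv : 0 < dotr v v.
    by rewrite lt_neqAle dotr_ge0 andbT; apply: contraNneq v0 => /esym/dotr_eq0 ->.
  have E : a * dotr v v = \sum_l (v *m U^T) 0 l ^+ 2 * d 0 l.
    by rewrite -mx_conj_diag_row /conj_diag -DE vD -scalemxAl mxE.
  have E2 : dotr v v = \sum_l (v *m U^T) 0 l ^+ 2.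
    have := mx_conj_diag_row U (const_mx 1) v.
    rewrite /conj_diag diag_const_mx mulmx1 UU' mulmx1 => h.
    by rewrite /dotr h; apply: eq_bigr => l _; rewrite [const_mx _ _ _]mxE mulr1.
  rewrite -(ler_pM2r dv) E E2 mulNr mulr_sumr -sumrN; apply: ler_sum => l _.
  rewrite -mulNr [leRHS]mulrC; apply: ler_wpM2r; first exact: sqr_ge0.
  rewrite lerNl (bigD1 l)//= ler_wpDr ?sumr_ge0// -normrN ler_norm//.
have ev l : lambda_min D <= d 0 l.
  apply: (ge_inf lb); rewrite /=; apply/eigenvalueP; exists (row l U).
    rewrite DE -row_mul !mulmxA UU mul1mx; apply/rowP => i.
    by rewrite mxE mul_diag_mx !mxE.
  apply/eqP => r0; have := congr1 (fun M : 'M[R]_N => M l l) UU; rewrite mxE.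
  rewrite big1; first by rewrite mxE eqxx => /eqP; rewrite eq_sym oner_eq0.
  by move=> i _; have /rowP/(_ i) := r0; rewrite !mxE => ->; rewrite mul0r.
have -> : D - (lambda_min D)%:M = conj_diag U (\row_l (d 0 l - lambda_min D)).
  rewrite /conj_diag (_ : diag_mx _ = diag_mx d - (lambda_min D)%:M).
    by rewrite mulmxBr mulmxBl -DE mul_mx_scalar -scalemxAl UU' scalemx1.
  by apply/matrixP => i j; rewrite !mxE; case: (i == j); rewrite ?mulr1n ?mulr0n ?subrr.
by apply: conj_diag_psd => l; rewrite mxE subr_ge0.
Qed.

End PsdBlocks.

(** * Local certificates at an optimal solution *)

Section LocalRepresentation.
Variables (R : realType) (n m : nat).
Local Notation P := (mpoly n R).

Lemma psd_form_sos (B : 'M[R]_n) (y : 'I_n -> P) : psd B ->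
  sos (\sum_a \sum_b y a * y b * mpolyC n (B a b)).
Proof.
move=> /psd_diagP[U [d [_ _ -> d0]]].
have -> : \sum_a \sum_b y a * y b * mpolyC n (conj_diag U d a b) =
    \sum_l mpolyC n (d 0 l) * (\sum_a mpolyC n (U l a) * y a) ^+ 2.
  under eq_bigr => a _ do under eq_bigr => b _ do rewrite conj_diagE rmorph_sum mulr_sumr/=.
  under [RHS]eq_bigr => l _ do rewrite expr2 big_distrlr mulr_sumr/=.
  rewrite [RHS]exchange_big/=; apply: eq_bigr => a _.
  under [RHS]eq_bigr => l _ do rewrite mulr_sumr/=.
  rewrite [RHS]exchange_big/=; apply: eq_bigr => b _.
  by apply: eq_bigr => l _; rewrite !rmorphM/=; ring.
by apply: sos_sum => l _; apply: sosM; [exact: sosC|exact: sos_sq].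
Qed.

Lemma compact_sphere : compact [set u : 'rV[R]_n | dotr u u = 1].
Proof.
have := @compact_sphere_ortho R n 0 0; congr compact; apply/seteqP; split => u /=.
  by case.
by move=> u1; split => //; apply/matrixP => i [].
Qed.

(** Finsler's lemma. On the part of the unit sphere where the form of [H] is nonpositive, the sum of
    squares has a positive lower bound by compactness, so a large multiple of it compensates. *)
Lemma finsler (H : 'M[R]_n) (I : finType) (A : pred I) (v : I -> 'rV[R]_n) :
  (forall u : 'rV[R]_n, u != 0 -> (forall i, A i -> dotr (v i) u = 0) ->
     0 < (u *m H *m u^T) 0 0) ->
  exists b eps : R, [/\ 0 < b, 0 < eps & forall u : 'rV[R]_n,
    eps * dotr u u <= (u *m H *m u^T) 0 0 + b * \sum_(i | A i) dotr (v i) u ^+ 2].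
Proof.
move=> Hpos; pose S := [set u : 'rV[R]_n | dotr u u = 1].
have cS : compact S := compact_sphere.
pose f1 (u : 'rV[R]_n) := (u *m H *m u^T) 0 0.
pose f2 (u : 'rV[R]_n) := \sum_(i | A i) dotr (v i) u ^+ 2.
have cf1 : continuous f1.
  by have := @continuous_dotr R n H 1%:M; under eq_fun do rewrite mulmx1.
have cf2 : continuous f2.
  apply: continuous_sum_real => i _; under eq_fun do rewrite expr2 dotrE.
  apply: continuous_mul_real; apply: continuous_sum_real => j _;
    apply: continuous_mul_real; try exact: continuous_const_real;
    exact: continuous_coord.
have f20 u : 0 <= f2 u by apply: sumr_ge0 => i _; exact: sqr_ge0.
have S0 u : S u -> u != 0.
  move=> u1; apply/eqP => u0; have : dotr u u = 1 := u1.
  by rewrite u0 /dotr mul0mx mxE => /eqP; rewrite eq_sym oner_eq0.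
have [d d0 df2] : exists2 d, 0 < d & forall u, (S `&` [set u | f1 u <= 0]) u -> d <= f2 u.
  apply: compact_pos_lb => //.
    apply: (subclosed_compact _ cS); last by move=> u [].
    apply: closedI; first exact: (compact_closed (@norm_hausdorff _ _)).
    exact: closed_preim_le.
  move=> u [Su f1u]; rewrite lt_neqAle f20 andbT; apply/eqP => /esym/eqP.
  rewrite psumr_eq0; last by move=> i _; exact: sqr_ge0.
  move=> /allP z; suff : 0 < f1 u by rewrite ltNge f1u.
  apply: (Hpos u (S0 u Su)) => i Ai; have := z i (mem_index_enum i).
  by rewrite Ai /= sqrf_eq0 => /eqP.
have [E E0 f1E] : exists2 E, 0 < E & forall u, S u -> - f1 u <= E.
  apply: compact_ub => //; under eq_fun do rewrite -mulN1r.
  by apply: continuous_mul_real => //; exact: continuous_const_real.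
pose b := 2 * E / d; have b0 : 0 < b by rewrite divr_gt0// mulr_gt0.
have pos u : S u -> 0 < f1 u + b * f2 u.
  move=> Su; have [f1u|f1u] := ltP 0 (f1 u).
    by rewrite ltr_pwDl// mulr_ge0// ltW.
  have h1 := df2 u (conj Su f1u); have h2 := f1E u Su.
  have : b * d <= b * f2 u by rewrite ler_pM2l.
  have -> : b * d = 2 * E by rewrite /b divfK// gt_eqF.
  lra.
have [eps e0 he] : exists2 e, 0 < e & forall u, S u -> e <= f1 u + b * f2 u.
  apply: compact_pos_lb => //; apply: continuous_add_real => //.
  by apply: continuous_mul_real => //; exact: continuous_const_real.
exists b, eps; split => // u; have [->|u0] := eqVneq u 0.
  rewrite !mul0mx mxE dotrE big1 ?mulr0 ?add0r; last by move=> i _; rewrite mxE mul0r.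
  by rewrite mulr_ge0 ?(ltW b0)// sumr_ge0// => i _; exact: sqr_ge0.
have du : 0 < dotr u u.
  by rewrite lt_neqAle dotr_ge0 andbT; apply: contraNneq u0 => /esym/dotr_eq0 ->.
pose t := (Num.sqrt (dotr u u))^-1.
have t2 : t ^+ 2 = (dotr u u)^-1 by rewrite exprVn sqr_sqrtr// ltW.
have := he (t *: u) _; rewrite /S /= dotrZl dotrZr mulrA -expr2 t2 mulVf ?gt_eqF//.
move=> /(_ erefl); rewrite /f1 /f2.
have -> : (t *: u *m H *m (t *: u)^T) 0 0 = t ^+ 2 * (u *m H *m u^T) 0 0.
  by rewrite linearZ/= -!scalemxAl -scalemxAr scalerA mxE expr2.
have -> : \sum_(i | A i) dotr (v i) (t *: u) ^+ 2 = t ^+ 2 * \sum_(i | A i) dotr (v i) u ^+ 2.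
  by rewrite mulr_sumr; apply: eq_bigr => i _; rewrite dotrZr exprMn.
rewrite t2 mulrCA -mulrDr -ler_pdivrMl ?invr_gt0// invrK mulrC.
by [].
Qed.

Variables (f : P) (g : 'I_m.+1 -> P) (x0 : 'rV[R]_n).
Hypothesis g0E : g ord0 = 1.
Let con (i : 'I_m) := g (lift ord0 i).
Local Notation y := (shift x0).

Lemma active_orthogonal (u : 'rV[R]_n) :
  (forall i, peval (con i) x0 == 0 -> dotr (gradient (con i) x0) u = 0) ->
  forall w, w \in <<active_gradients g x0>>%VS -> (w *m u^T) 0 0 = 0.
Proof.
move=> Hu w; set X := active_gradients _ _; rewrite -[X]/(val (in_tuple X)).
move=> /coord_span ->; rewrite mulmx_suml summxE big1// => j _.
rewrite -scalemxAl mxE; apply/eqP; rewrite mulf_eq0; apply/orP; right; apply/eqP.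
have /mapP[i] : X`_j \in X by apply: mem_nth.
by rewrite mem_filter => /andP[gi _] ->; exact: Hu.
Qed.

(* Near an optimum, [F = f - f(x0)] is the Lagrangian plus [\sum_i eta_i g_i]
   over the active constraints.  Replacing the multiplier [eta_i] by the square
   of [sqrt eta_i - b l_i / (2 sqrt eta_i)], where [l_i] is the linear part of
   [g_i], adds [b l_i^2] to the second order part of the remainder, which is
   positive definite for large [b]. *)
Theorem local_representation : second_order_sufficient f g x0 ->
  exists (s : P) (eps : R) (K : 'I_n -> 'I_n -> P),
  [/\ qmod g s, 0 < eps,
      f - mpolyC n (peval f x0) = s + mpolyC n eps * \sum_a y a ^+ 2 +
        \sum_a \sum_b y a * y b * K a b &
      forall a b, peval (K a b) x0 = 0].
Proof.
move=> [eta [[eta0 gradL compl] strict _ hess]].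
pose L := lagrangian f g eta.
pose A i := peval (con i) x0 == 0.
have [L2 [LE L2E]] := expand2 x0 L.
have Lx0 : peval L x0 = peval f x0.
  rewrite /L /lagrangian pevalB peval_sum big1 ?subr0// => i _.
  by rewrite pevalZ compl.
rewrite Lx0 gradL in LE.
have {}LE : L = mpolyC n (peval f x0) + \sum_a \sum_b y a * y b * L2 a b.
  rewrite LE [X in _ + X + _]big1 ?addr0// => a _.
  by rewrite mxE mpolyC0 mul0r.
have /choice[G GE] : forall i, exists p1 : 'I_n -> P,
    con i = mpolyC n (peval (con i) x0) + \sum_a y a * p1 a /\
    forall a, peval (p1 a) x0 = peval (mderiv a (con i)) x0.
  by move=> i; exact: expands1_all.
pose D i a := peval (mderiv a (con i)) x0.
pose l i : P := \sum_a mpolyC n (D i a) * y a.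
have Gact i : A i -> con i = \sum_a y a * G i a.
  by move=> /eqP Ai; rewrite {1}(GE i).1 Ai mpolyC0 add0r.
(* Strict complementarity is what allows the division by sqrt (eta_i). *)
have eta_gt0 i : A i -> 0 < eta i.
  by move=> /eqP Ai; have := strict i; rewrite -/(con i) Ai addr0.
have eta_eq0 i : ~~ A i -> eta i = 0.
  by move=> Ai; have /eqP := compl i;
    rewrite mulf_eq0 (negPf (Ai : peval (g (lift ord0 i)) x0 != 0)) orbF => /eqP.
(* The factor 1/2: by [expand2] the quadratic part of the Lagrangian is half its Hessian. *)
have [|b [eps [b0 e0 Hb]]] := @finsler (2^-1 *: hessian L x0) 'I_m A (fun i => gradient (con i)
  x0).
  move=> u u0 Hu; rewrite -scalemxAr -scalemxAl mxE mulr_gt0// ?invr_gt0//.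
  by apply: hess => //; exact: active_orthogonal.
pose tt i : P := mpolyC n (Num.sqrt (eta i)) - mpolyC n (b / (2 * Num.sqrt (eta i))) * l i.
have ttE i : A i -> tt i ^+ 2 = mpolyC n (eta i) - mpolyC n b * l i +
    mpolyC n (b ^+ 2 / (4 * eta i)) * l i ^+ 2.
  move=> Ai; have ei := eta_gt0 i Ai.
  have s0 : Num.sqrt (eta i) != 0 by rewrite sqrtr_eq0 -ltNge.
  have s2 : Num.sqrt (eta i) ^+ 2 = eta i by rewrite sqr_sqrtr// ltW.
  rewrite /tt; set q := Num.sqrt (eta i) in s0 s2 *.
  transitivity (mpolyC n q ^+ 2 - (mpolyC n q * mpolyC n (b / (2 * q)) * 2) * l i +
    mpolyC n (b / (2 * q)) ^+ 2 * l i ^+ 2); first by ring.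
  have -> : mpolyC n q ^+ 2 = mpolyC n (eta i) by rewrite -rmorphXn/= s2.
  have -> : mpolyC n q * mpolyC n (b / (2 * q)) * 2 = mpolyC n b.
    transitivity (mpolyC n (q * (b / (2 * q)) * 2)).
      by rewrite 2![in RHS]rmorphM/= rmorph_nat.
    by congr mpolyC; field.
  by rewrite -rmorphXn/= -s2; congr (_ + mpolyC n _ * _); field.
pose M a c : P := L2 a c + \sum_(i | A i) (mpolyC n b * (mpolyC n (D i a) * G i c) -
  mpolyC n (b ^+ 2 / (4 * eta i)) * (l i * (mpolyC n (D i a) * G i c))).
have lcon i : A i -> l i * con i = \sum_a \sum_c y a * y c * (mpolyC n (D i a) * G i c).
  move=> Ai; rewrite (Gact i Ai) big_distrlr/=; apply: eq_bigr => a _.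
  by apply: eq_bigr => c _; ring.
have FE : f - mpolyC n (peval f x0) = \sum_(i | A i) tt i ^+ 2 * con i +
    \sum_a \sum_c y a * y c * M a c.
  set c0 := mpolyC n (peval f x0) in LE *.
  have -> : f = L + \sum_(i | A i) mpolyC n (eta i) * con i.
    rewrite /L /lagrangian -addrA -[LHS]addr0; congr (_ + _); apply/esym/eqP.
    rewrite addrC subr_eq0; apply/eqP; rewrite big_mkcond/=; apply: eq_bigr => i _.
    case: ifPn => [_|/eta_eq0 ->]; first by rewrite mul_mpolyC.
    by rewrite scale0r.
  rewrite LE addrAC [c0 + _]addrC addrK.
  have -> : \sum_a \sum_c y a * y c * M a c = \sum_a \sum_c y a * y c * L2 a c +
     \sum_(i | A i) (mpolyC n b * (l i * con i) -
       mpolyC n (b ^+ 2 / (4 * eta i)) * (l i * (l i * con i))).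
    have -> : \sum_(i | A i) (mpolyC n b * (l i * con i) -
       mpolyC n (b ^+ 2 / (4 * eta i)) * (l i * (l i * con i))) =
      \sum_(i | A i) \sum_a \sum_c y a * y c * (mpolyC n b * (mpolyC n (D i a) * G i c) -
        mpolyC n (b ^+ 2 / (4 * eta i)) * (l i * (mpolyC n (D i a) * G i c))).
      apply: eq_bigr => i Ai; rewrite (lcon i Ai) !mulr_sumr -sumrB.
      apply: eq_bigr => a _; rewrite !mulr_sumr -sumrB; apply: eq_bigr => c _.
      ring.
    rewrite [X in _ = _ + X]exchange_big/= -big_split/=; apply: eq_bigr => a _.
    rewrite [X in _ = _ + X]exchange_big/= -big_split/=; apply: eq_bigr => c _.
    by rewrite /M mulrDr mulr_sumr.
  rewrite addrCA -big_split/=; congr (_ + _); apply: eq_bigr => i Ai.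
  rewrite (ttE i Ai); ring.
pose Mc a c := peval (M a c) x0.
(* The coefficients [Mc] need not be symmetric; their quadratic form only depends on [H]. *)
pose H : 'M[R]_n := \matrix_(a, c) (2^-1 * (Mc a c + Mc c a)).
have lx0 i : peval (l i) x0 = 0.
  by rewrite /l peval_sum big1// => a _; rewrite pevalM peval_shift subrr mulr0.
have McE a c : Mc a c = peval (L2 a c) x0 + b * \sum_(i | A i) D i a * D i c.
  rewrite /Mc /M pevalD peval_sum mulr_sumr; congr (_ + _); apply: eq_bigr => i _.
  rewrite pevalB !pevalM !pevalC lx0 (GE i).2 -/(D i c).
  by rewrite mul0r mulr0 subr0.
have HE (u : 'rV[R]_n) : (u *m H *m u^T) 0 0 = (u *m (2^-1 *: hessian L x0) *m u^T) 0 0 +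
    b * \sum_(i | A i) dotr (gradient (con i) x0) u ^+ 2.
  rewrite !form_mxE.
  have -> : \sum_(i | A i) dotr (gradient (con i) x0) u ^+ 2 =
      \sum_a \sum_c u 0 a * u 0 c * \sum_(i | A i) D i a * D i c.
    under [RHS]eq_bigr => a _ do under eq_bigr => c _ do rewrite mulr_sumr.
    under [RHS]eq_bigr => a _ do rewrite exchange_big/=.
    rewrite [RHS]exchange_big/=; apply: eq_bigr => i _.
    rewrite dotrE expr2 big_distrlr/=; apply: eq_bigr => a _; apply: eq_bigr => c _.
    by rewrite !mxE -!/(D i _); ring.
  rewrite mulr_sumr -big_split/=; apply: eq_bigr => a _.
  rewrite mulr_sumr -big_split/=; apply: eq_bigr => c _.
  rewrite mxE [in RHS]mxE !McE -L2E.
  have -> : \sum_(i | A i) D i c * D i a = \sum_(i | A i) D i a * D i c.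
    by apply: eq_bigr => i _; rewrite mulrC.
  set X := \sum_(i | _) _; set Y := peval _ _; set Z := peval _ _.
  by field.
have pB : psd (H - eps%:M).
  split.
    rewrite linearB/= tr_scalar_mx; congr (_ - _); apply/matrixP => a c.
    by rewrite !mxE addrC.
  move=> u; rewrite mulmxBr mulmxBl mxE [in X in _ + X]mxE subr_ge0 HE.
  apply: le_trans (Hb u); rewrite mul_mx_scalar -scalemxAl mxE.
  by [].
(* The part of the second-order coefficients that vanishes at [x0]; the constant part splits into
   the sos form of [H - eps%:M] and [eps] times the squared distance. *)
pose K a c := M a c - mpolyC n (Mc a c).
exists (\sum_(i | A i) tt i ^+ 2 * con i + \sum_a \sum_c y a * y c * mpolyC n ((H - eps%:M) a
  c)), eps, K.
split => //; last by move=> a c; rewrite /K pevalB pevalC subrr.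
- apply: qmodD; first by apply: qmod_sum => i _; apply: qmod_sqM; exact: qmod_gen.
  rewrite -[X in qmod _ X]mulr1; apply: qmod_sosM; first exact: psd_form_sos.
  exact: qmod1.
- rewrite FE -!addrA; congr (_ + _).
  have -> : mpolyC n eps * \sum_a y a ^+ 2 =
      \sum_a \sum_c y a * y c * mpolyC n (eps%:M a c).
    rewrite mulr_sumr; apply: eq_bigr => a _; rewrite (bigD1 a)//= mxE eqxx mulr1n.
    rewrite big1 ?addr0; first by rewrite mulrC expr2.
    by move=> c ca; rewrite mxE eq_sym (negPf ca) mulr0n mpolyC0 mulr0.
  have E1 : \sum_a \sum_c y a * y c * mpolyC n (Mc a c) =
      \sum_a \sum_c y a * y c * mpolyC n (H a c).
    have E2 : \sum_a \sum_c y a * y c * mpolyC n (H a c) =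
        \sum_a \sum_c y a * y c * mpolyC n (2^-1 * Mc a c) +
        \sum_a \sum_c y a * y c * mpolyC n (2^-1 * Mc c a).
      rewrite -big_split/=; apply: eq_bigr => a _; rewrite -big_split/=.
      by apply: eq_bigr => c _; rewrite -mulrDr -rmorphD/= -mulrDr mxE.
    rewrite E2 [X in _ = _ + X]exchange_big/= -big_split/=; apply: eq_bigr => a _.
    rewrite -big_split/=; apply: eq_bigr => c _.
    by rewrite [y c * y a]mulrC -mulrDr -rmorphD/=; congr (_ * mpolyC n _); field.
  have -> : \sum_a \sum_c y a * y c * M a c = \sum_a \sum_c y a * y c * mpolyC n (Mc a c) +
      \sum_a \sum_c y a * y c * K a c.
    rewrite -big_split/=; apply: eq_bigr => a _; rewrite -big_split/=.
    by apply: eq_bigr => c _; rewrite -mulrDr /K addrC subrK.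
  rewrite E1 addrA; congr (_ + _).
  rewrite -big_split/=; apply: eq_bigr => a _; rewrite -big_split/=.
  apply: eq_bigr => c _; rewrite -mulrDr -rmorphD/=; congr (_ * mpolyC n _).
  by have /matrixP/(_ a c) := subrK eps%:M H; rewrite [LHS]mxE => ->.
Qed.

End LocalRepresentation.

(** * Linear forms that separate finitely many points *)

Section SeparatingForm.
Variables (R : realType) (n : nat).

Lemma exists_notin (s : seq R) : exists t, t \notin s.
Proof.
exists (1 + \sum_(x <- s) `|x|); apply/negP => ts.
have : `|1 + \sum_(x <- s) `|x| | <= \sum_(x <- s) `|x|.
  rewrite [leRHS](perm_big _ (perm_to_rem ts))/= big_cons lerDl.
  by rewrite sumr_ge0.
rewrite ger0_norm ?addr_ge0 ?sumr_ge0//; lra.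
Qed.

(** Along the line [th + t *: v], every [w] not orthogonal to [v] excludes one [t]; the others are
    handled by [th] itself. *)
Lemma separating_form (vs : seq 'rV[R]_n) : (forall v, v \in vs -> v != 0) ->
  exists th : 'rV[R]_n, forall v, v \in vs -> dotr th v != 0.
Proof.
elim: vs => [_|v vs IH v0]; first by exists 0.
have [th Hth] : exists th : 'rV[R]_n, forall w, w \in vs -> dotr th w != 0.
  by apply: IH => w wvs; apply: v0; rewrite in_cons wvs orbT.
have [t Ht] := exists_notin [seq - dotr th w / dotr v w | w <- v :: vs].
have vv : dotr v v != 0.
  by apply: contraNneq (v0 v (mem_head _ _)) => /dotr_eq0 ->.
exists (th + t *: v) => w wvs; rewrite dotrDl dotrZl; apply/eqP => E.
have [vw|vw] := eqVneq (dotr v w) 0.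
  move: wvs E; rewrite in_cons vw mulr0 addr0 => /predU1P[wE|wvs].
    by move: vw; rewrite wE => /eqP; rewrite (negPf vv).
  by move/eqP; rewrite (negPf (Hth w wvs)).
move/negP: Ht; apply; apply/mapP; exists w => //.
by rewrite -[LHS](mulfK vw); congr (_ / _); apply/eqP; rewrite -addr_eq0 addrC E.
Qed.

Lemma separating_points (k : nat) (x : 'I_k -> 'rV[R]_n) : injective x ->
  exists th : 'rV[R]_n, injective (fun j => dotr th (x j)).
Proof.
move=> xI; have [|th Hth] := @separating_form
    [seq x ij.1 - x ij.2 | ij <- enum {: 'I_k * 'I_k} & ij.1 != ij.2].
  move=> v /mapP[[i j]]; rewrite mem_filter /= => /andP[ij _] ->.
  by rewrite subr_eq0 (inj_eq xI).
exists th => i j /= E; apply/eqP/negPn/negP => ij.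
have : x i - x j \in [seq x ij.1 - x ij.2 | ij <- enum {: 'I_k * 'I_k} & ij.1 != ij.2].
  by apply/mapP; exists (i, j) => //; rewrite mem_filter ij mem_enum.
by move=> /Hth; rewrite dotrDr -scaleN1r dotrZr mulN1r E subrr eqxx.
Qed.

End SeparatingForm.

(** * Interpolation at the nodes to third order *)

Section CubicIdempotents.
Variables (R : realType) (k : nat) (l : 'I_k -> R).
Hypothesis l_inj : injective l.

Definition node_poly : {poly R} := \prod_j ('X - (l j)%:P).

Let p j : {poly R} := ('X - (l j)%:P) ^+ 3.

Lemma node_coprime (s : seq 'I_k) j : j \notin s -> coprimep (p j) (\prod_(i <- s) p i).
Proof.
elim: s => [|i s IH]; first by rewrite big_nil coprimep1.
rewrite in_cons negb_or big_cons coprimepMr => /andP[ji js]; rewrite IH// andbT.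
by rewrite /p coprimep_expl// coprimep_expr// coprimep_XsubC2// subr_eq0 (inj_eq l_inj) eq_sym.
Qed.

Lemma node_crt (D : {poly R}) : (forall j, p j %| D) -> exists W, D = node_poly ^+ 3 * W.
Proof.
move=> pD; suff /dvdpP[W ->] : node_poly ^+ 3 %| D by exists W; rewrite mulrC.
rewrite /node_poly -prodrXl -/p.
elim: (index_enum _) (index_enum_uniq 'I_k) => [_|j s IH /= /andP[js us]].
  by rewrite big_nil dvd1p.
by rewrite big_cons Gauss_dvdp ?pD ?IH//; exact: node_coprime.
Qed.

(** By the Chinese remainder theorem, [nu j] is 1 modulo the cube of X - l_j and 0 modulo the other
    cubes. Third order is chosen because the square of [node_poly] is later taken out and the factor
    left over must still vanish at the nodes. *)
Lemma cubic_idempotents : exists (nu kap : 'I_k -> {poly R}) (W : {poly R}),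
  [/\ forall j i, (nu j).[l i] = (i == j)%:R,
      forall j, nu j ^+ 2 * (nu j ^+ 2 - 1) = node_poly ^+ 3 * kap j &
      1 - \sum_j nu j ^+ 4 = node_poly ^+ 3 * W].
Proof.
have H j : exists v : {poly R}, p j %| 1 - v /\ forall i, i != j -> p i %| v.
  pose r := \prod_(i | i != j) p i.
  have : coprimep (p j) r.
    rewrite /r -big_filter; apply: node_coprime.
    by rewrite mem_filter eqxx.
  move=> /Bezout_eq1_coprimepP[u uE]; exists (u.2 * r); split.
    by rewrite -uE addrK dvdp_mull// dvdpp.
  by move=> i ij; rewrite dvdp_mull// /r (bigD1 i)//= dvdp_mulr// dvdpp.
have [nu Hnu] := choice H.
have d1 j : p j %| 1 - nu j := (Hnu j).1.
have d2 i j : i != j -> p i %| nu j by exact: (Hnu j).2.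
have ev (q : {poly R}) j : p j %| q -> q.[l j] = 0.
  by move=> /dvdpP[w ->]; rewrite hornerM horner_exp hornerXsubC subrr expr0n mulr0.
have kapE j : exists kap, nu j ^+ 2 * (nu j ^+ 2 - 1) = node_poly ^+ 3 * kap.
  apply: node_crt => i; have [->|ij] := eqVneq i j.
    rewrite dvdp_mull// (_ : _ - 1 = (1 - nu j) * (- (nu j + 1))); last by ring.
    by rewrite dvdp_mulr.
  by rewrite dvdp_mulr// expr2 dvdp_mulr// d2.
have [kap Hkap] := choice kapE.
have [W HW] : exists W, 1 - \sum_j nu j ^+ 4 = node_poly ^+ 3 * W.
  apply: node_crt => i; rewrite (bigD1 i)//= opprD addrA dvdp_sub//.
    rewrite (_ : 1 - _ = (1 - nu i) * ((1 + nu i) * (1 + nu i ^+ 2))); last by ring.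
    by rewrite dvdp_mulr.
  elim/big_ind: _ => [|a b|j ji]; [exact: dvdp0|exact: dvdp_add|].
  by rewrite exprS dvdp_mulr// d2// eq_sym.
exists nu, kap, W; split=> // j i; case: eqVneq => [->|ij]; last by apply: ev; exact: d2.
by have := ev _ _ (d1 j); rewrite hornerD hornerN hornerC => /eqP; rewrite subr_eq0 => /eqP <-.
Qed.

End CubicIdempotents.

(** * Gluing the local certificates at the finitely many zeros *)

Section GlobalRepresentation.
Variables (R : realType) (n m : nat) (f : mpoly n R) (g : 'I_m.+1 -> mpoly n R).
Local Notation P := (mpoly n R).
Variables (i1 : 'I_m) (c rad : R).
Hypotheses (g0E : g ord0 = 1) (c_gt0 : 0 < c) (rad_gt0 : 0 < rad).
Hypothesis g1E : g (lift ord0 i1) = c *: (mpolyC n rad - \sum_j var R j ^+ 2).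
Variable fstar : R.
Hypothesis f_min : forall x, feasible g x -> fstar <= peval f x.
Hypothesis sosc : forall x, feasible g x -> peval f x = fstar -> second_order_sufficient f g x.

Let F : P := f - mpolyC n fstar.
Let zero x := feasible g x /\ peval F x = 0.

Let FE x : peval F x = peval f x - fstar.
Proof. by rewrite /F pevalB pevalC. Qed.

Let F_ge0 x : feasible g x -> 0 <= peval F x.
Proof. by move=> fx; rewrite FE subr_ge0 f_min. Qed.

Let cS : compact (feasible g) := compact_feasible c_gt0 rad_gt0 g1E.

Let local_rep x : zero x -> exists (s : P) (eps : R) (K : 'I_n -> 'I_n -> P),
  [/\ qmod g s, 0 < eps,
      F = s + mpolyC n eps * \sum_a shift x a ^+ 2 +
        \sum_a \sum_b shift x a * shift x b * K a b &
      forall a b, peval (K a b) x = 0].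
Proof.
move=> [fx]; rewrite FE => /eqP; rewrite subr_eq0 => /eqP fxE.
have [s [eps [K [gs e0 E K0]]]] := local_representation g0E (sosc fx fxE).
by exists s, eps, K; split=> //; rewrite -E fxE.
Qed.

(** The local certificate gives F(z) >= (eps - k(z)) |z - x|^2 on the feasible set, and [k] is
    continuous with k(x) = 0. *)
Lemma zero_isolated x : zero x ->
  exists U : set 'rV[R]_n, [/\ open U, U x & forall z, U z -> zero z -> z = x].
Proof.
move=> /local_rep[s [eps [K [gs e0 E K0]]]].
pose k z := \sum_a \sum_b `|peval (K a b) z|.
have ck : continuous k.
  apply: continuous_sum_real => a _; apply: continuous_sum_real => b _.
  by apply: continuous_norm_real; exact: continuous_peval.
exists [set z | k z < eps]; split.
- by apply: (open_comp _ (@open_lt _ eps)) => z _; exact: ck.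
- by rewrite /= /k big1// => a _; rewrite big1// => b _; rewrite K0 normr0.
move=> z /= kz [fz]; rewrite E !pevalD pevalM pevalC !peval_sum.
have s0 := qmod_ge0 g0E fz gs.
under [in X in _ + X + _ = _]eq_bigr do rewrite pevalXn peval_shift.
set q := \sum_(_ < _) _.
have q0 : 0 <= q by apply: sumr_ge0 => a _; exact: sqr_ge0.
pose y a := z 0 a - x 0 a.
have yq a : y a ^+ 2 <= q.
  by rewrite /q (bigD1 a)//= lerDl sumr_ge0// => b _; exact: sqr_ge0.
have : `|\sum_a peval (\sum_b shift x a * shift x b * K a b) z| <= q * k z.
  apply: le_trans (ler_norm_sum _ _ _) _; rewrite mulr_sumr; apply: ler_sum => a _.
  rewrite peval_sum; apply: le_trans (ler_norm_sum _ _ _) _.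
  rewrite mulr_sumr; apply: ler_sum => b _; rewrite !pevalM !peval_shift normrM.
  apply: ler_wpM2r => //; rewrite -/(y a) -/(y b).
  have := yq a; have := yq b => ya yb; rewrite ler_norml; apply/andP; split.
    by have := sqr_ge0 (y a + y b); rewrite sqrrD; lra.
  by have := sqr_ge0 (y a - y b); rewrite sqrrB; lra.
rewrite ler_norml => /andP[h _] h0.
have qk : q * (eps - k z) <= 0 by rewrite mulrBr mulrC; lra.
have {}qk : q <= 0 by rewrite pmulr_lle0 ?subr_gt0// in qk.
apply/rowP => a; apply/eqP; rewrite -subr_eq0 -sqrf_eq0 eq_le sqr_ge0 andbT.
exact: le_trans (yq a) qk.
Qed.

(** The zero set is compact, and [zero_isolated] makes it discrete. *)
Lemma zeros_finite : exists (k : nat) (x : 'I_k -> 'rV[R]_n),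
  [/\ injective x, forall j, zero (x j) & forall z, zero z -> exists j, z = x j].
Proof.
have cZ : compact [set x | zero x].
  apply: (subclosed_compact _ cS); last by move=> x [].
  apply: (@closedI _ (feasible g)); first exact: closed_feasible.
  by apply: closed_preim_eq; exact: continuous_peval.
have /choice[U HU] : forall x, exists U : set 'rV[R]_n,
    open U /\ (zero x -> U x /\ forall z, U z -> zero z -> z = x).
  move=> x; have [zx|nz] := pselect (zero x); last by exists setT; split => //; exact: openT.
  by have [U [oU Ux h]] := zero_isolated zx; exists U; split.
move: cZ; rewrite compact_cover => /(_ _ [set x | zero x] U).
case; [by move=> x _; case: (HU x)|by move=> x zx; exists x => //; case: ((HU x).2 zx)|].
move=> D' D'Z Zc; pose s : seq 'rV[R]_n := undup (finmap.enum_fset D').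
exists (size s), (fun j => nth 0 s j); split.
- by move=> i j /eqP; rewrite nth_uniq ?undup_uniq// => /eqP /val_inj.
- move=> j; have := mem_nth 0 (ltn_ord j); rewrite mem_undup => /D'Z.
  by rewrite inE.
- move=> z zz; have [x /= xD Uz] := Zc z zz.
  have zx : zero x by have := D'Z x xD; rewrite inE.
  have -> : z = x by case: ((HU x).2 zx) => _; apply.
  have xs : x \in s by rewrite mem_undup.
  by exists (Ordinal (etrans (index_mem x s) xs)); rewrite /= nth_index.
Qed.

Lemma small_scale (I : finType) (A E : I -> R) : (forall i, 0 <= A i) ->
  (forall i, 0 < E i) -> exists2 eta, 0 < eta & forall i, eta * A i < E i.
Proof.
move=> A0 E0; pose S := \sum_i A i / E i.
have S0 : 0 <= S by apply: sumr_ge0 => i _; rewrite divr_ge0// ltW.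
have S1 : 0 < 1 + S by rewrite ltr_pwDl.
exists (1 + S)^-1; first by rewrite invr_gt0.
move=> i; rewrite ltr_pdivrMl// -ltr_pdivrMr//.
rewrite /S (bigD1 i)//= addrCA ltrDl ltr_pwDl// sumr_ge0// => j _.
by rewrite divr_ge0// ltW.
Qed.

Lemma peval_horner_alg (q : {poly R}) (t : P) x :
  peval (horner_alg t q) x = q.[peval t x].
Proof.
elim/poly_ind: q => [|q a IH]; first by rewrite rmorph0 horner0 peval0.
rewrite rmorphD rmorphM/= horner_algX horner_algC pevalD pevalM IH.
by rewrite !hornerE pevalZ peval1 mulr1.
Qed.

(* With [nu_j] equal to 1 at [x_j] and 0 at the other zeros, up to third order
   along the separating form [t], and [pi] the node polynomial in [t],
   [F = \sum_j nu_j^4 F + pi^3 W F] is rewritten with the squares of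
   [nu_j (x_a - x_ja)] and of [pi]; adding [eta pi^2] makes the coefficient of
   [pi^2] positive at the zeros, at a small cost in the other ones. *)
Theorem qmod_sub_minimum : qmod g F.
Proof.
have [k [x [xI xZ Zx]]] := zeros_finite.
have [th thI] := separating_points xI.
pose l j := dotr th (x j).
have [nu [kap [W [nuE kapE WE]]]] := cubic_idempotents thI.
rewrite -/l in nuE kapE WE.
have /choice[s] : forall j, exists s : P, exists (eps : R) (K : 'I_n -> 'I_n -> P),
  [/\ qmod g s, 0 < eps,
      F = s + mpolyC n eps * \sum_a shift (x j) a ^+ 2 +
        \sum_a \sum_b shift (x j) a * shift (x j) b * K a b &
      forall a b, peval (K a b) (x j) = 0] by move=> j; exact: local_rep.
move=> /choice[eps] /choice[K HK].
pose t : P := \sum_a mpolyC n (th 0 a) * var R a.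
have tx z : peval t z = dotr th z.
  rewrite /t peval_sum dotrE; apply: eq_bigr => a _.
  by rewrite pevalM pevalC peval_var.
pose h (q : {poly R}) : P := horner_alg t q.
have hM q1 q2 : h (q1 * q2) = h q1 * h q2 by exact: rmorphM.
have hX q d : h (q ^+ d) = h q ^+ d by exact: rmorphXn.
have hB q1 q2 : h (q1 - q2) = h q1 - h q2 by exact: rmorphB.
have h1 : h 1 = 1 by exact: rmorph1.
pose N j := h (nu j); pose pi := h (node_poly l).
(* The cofactor of the node at [x j]: [pi] is [pj j] times the form [t] centred at [x j], a linear
   combination of the [y j a]. *)
pose pj j := h (\prod_(i | i != j) ('X - (l i)%:P)).
pose y j a : P := shift (x j) a.
have piE j : pi = (\sum_a mpolyC n (th 0 a) * y j a) * pj j.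
  rewrite /pi /pj /h /node_poly (bigD1 j)//= rmorphM/=; congr (_ * _).
  rewrite rmorphB/= horner_algX horner_algC /t /l dotrE.
  rewrite -mul_mpolyC mulr1 rmorph_sum/= -sumrB; apply: eq_bigr => a _.
  by rewrite /y /shift mulrBr rmorphM.
have Nx j i : peval (N j) (x i) = (i == j)%:R.
  by rewrite /N /h peval_horner_alg tx nuE.
have pix i : peval pi (x i) = 0.
  by rewrite (piE i) pevalM peval_sum big1 ?mul0r// => a _;
    rewrite pevalM peval_shift subrr mulr0.
have kapP j : N j ^+ 2 * (N j ^+ 2 - 1) = pi ^+ 3 * h (kap j).
  by rewrite /N /pi -!hX -h1 -hB -!hM kapE.
have WP : 1 - \sum_j N j ^+ 4 = pi ^+ 3 * h W.
  rewrite /pi -hX -hM -WE hB h1; congr (_ - _).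
  by rewrite [RHS]rmorph_sum; apply: eq_bigr => j _; rewrite -[RHS]/(h _) hX.
have [eta eta0 Heta] : exists2 eta, 0 < eta & forall ja : 'I_k * 'I_n,
    eta * (n%:R * th 0 ja.2 ^+ 2 * peval (pj ja.1) (x ja.1) ^+ 2) < eps ja.1.
  apply: small_scale => ja; last by case: (HK ja.1).
  by apply: mulr_ge0; [apply: mulr_ge0 => //; exact: sqr_ge0|exact: sqr_ge0].
pose y2 j := \sum_a y j a ^+ 2.
pose lin j := \sum_a mpolyC n (th 0 a) * y j a.
(* Lagrange's identity: the sum over a, b of (v_a - v_b)^2 is 2 (n sum v_a^2 - (sum v_a)^2). It
   trades the square of [lin j], a factor of [pi ^+ 2], for the squares of the coordinates
   [y j a]. *)
pose lag j := \sum_a \sum_b (mpolyC n (th 0 a) * y j a - mpolyC n (th 0 b) * y j b) ^+ 2.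
have lagE j : mpolyC n 2^-1 * lag j =
    n%:R * \sum_a mpolyC n (th 0 a) ^+ 2 * y j a ^+ 2 - lin j ^+ 2.
  pose v a := mpolyC n (th 0 a) * y j a.
  have -> : lag j = 2 * (n%:R * \sum_a v a ^+ 2 - lin j ^+ 2).
    have -> : lag j = \sum_(a < n) \sum_(b < n) v a ^+ 2 +
        \sum_(a < n) \sum_(b < n) v b ^+ 2 - 2 * (lin j ^+ 2).
      rewrite expr2 big_distrlr/= mulr_sumr -big_split/= -sumrB; apply: eq_bigr => a _.
      rewrite mulr_sumr -big_split/= -sumrB; apply: eq_bigr => b _; rewrite /v; ring.
    have -> : \sum_(a < n) \sum_(b < n) v a ^+ 2 = n%:R * \sum_a v a ^+ 2.
      by rewrite mulr_sumr; apply: eq_bigr => a _; rewrite sumr_const card_ord mulr_natl.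
    by rewrite sumr_const card_ord -[_ *+ n]mulr_natl; ring.
  rewrite mulrA -[2]/(2%:R) -(rmorph_nat (@mpolyC n R)) -rmorphM/= mulVf ?pnatr_eq0// rmorph1
    mul1r.
  by congr (_ * _ - _); apply: eq_bigr => a _; rewrite /v exprMn.
(* The squares at hand are those of [N j * y j a], indexed by pairs, and that of [pi], indexed by
   [unit]. *)
pose I := ('I_k * 'I_n + unit)%type.
pose b (i : I) : P := match i with inl ja => N ja.1 * y ja.1 ja.2 | inr _ => pi end.
pose e (i : I) : P := match i with
  | inl ja => mpolyC n (eps ja.1) -
      mpolyC n eta * (n%:R * mpolyC n (th 0 ja.2) ^+ 2 * (N ja.1 ^+ 2 * pj ja.1 ^+ 2))
  | inr _ => mpolyC n eta end.
(* All leftovers carry [pi ^+ 3]: from replacing [N j ^+ 4] by [N j ^+ 2], and from the defect of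
   the partition of unity, applied to [F] and to [pi ^+ 2]. With [pi ^+ 2] taken out, each keeps a
   factor [pi]. *)
pose k0 := \sum_j mpolyC n (eps j) * (pi * h (kap j) * y2 j) + pi * h W * F -
  mpolyC n eta * (pi ^+ 3 * h W).
pose kk (i i' : I) : P := match i, i' with
  | inl ja, inl jb => if ja.1 == jb.1 then N ja.1 ^+ 2 * K ja.1 ja.2 jb.2 else 0
  | inr _, inr _ => k0
  | _, _ => 0 end.
pose S := \sum_j N j ^+ 4 * s j +
  \sum_j mpolyC n eta * (mpolyC n 2^-1 * ((N j ^+ 2 * pj j) ^+ 2 * lag j)).
apply: (qmod_of_vanishing_cross_terms g0E c_gt0 rad_gt0 g1E F_ge0 (a := b) (e := e) (k := kk)
  (s := S)).
- apply: qmodD; apply: qmod_sum => j _.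
    rewrite (_ : N j ^+ 4 = (N j ^+ 2) ^+ 2); last by rewrite -exprM.
    by apply: qmod_sqM; case: (HK j).
  apply: qmod_scale; first exact: ltW.
  apply: qmod_scale; first by rewrite invr_ge0.
  apply: qmod_sqM; apply: qmod_sum => a _; apply: qmod_sum => a' _.
  exact: qmod_sq.
- have E1 : \sum_i b i ^+ 2 * e i = \sum_j mpolyC n (eps j) * (N j ^+ 2 * y2 j) -
      \sum_j mpolyC n eta * (N j ^+ 4 * pj j ^+ 2 *
        (n%:R * \sum_a mpolyC n (th 0 a) ^+ 2 * y j a ^+ 2)) + mpolyC n eta * pi ^+ 2.
    rewrite big_sumType/= big_const/= card_unit /= addr0 [pi ^+ 2 * _]mulrC; congr (_ + _).
    rewrite -sumrB -(pair_big xpredT xpredT (fun j a => (N j * y j a) ^+ 2 *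
      (mpolyC n (eps j) - mpolyC n eta * (n%:R * mpolyC n (th 0 a) ^+ 2 * (N j ^+ 2 * pj j ^+
        2)))))/=.
    apply: eq_bigr => j _; rewrite /y2 !mulr_sumr -sumrB; apply: eq_bigr => a _; ring.
  have E2 : \sum_i \sum_i' b i * b i' * kk i i' =
      \sum_j N j ^+ 4 * (\sum_a \sum_b y j a * y j b * K j a b) + pi ^+ 2 * k0.
    rewrite big_sumType/= [X in _ + X]big_const/= card_unit /= addr0; congr (_ + _); last first.
      rewrite big_sumType/= [X in _ + X]big_const/= card_unit /= addr0 big1 ?add0r ?expr2//.
      by move=> ja _; rewrite mulr0.
    under eq_bigr => ja _ do rewrite big_sumType/= [X in _ + X]big_const/= card_unit /= addr0
      mulr0 addr0.
    rewrite -(pair_big xpredT xpredT (fun j a => \sum_(jb : 'I_k * 'I_n) N j * y j a * (N jb.1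
      * y jb.1 jb.2) *
       (if j == jb.1 then N j ^+ 2 * K j a jb.2 else 0)))/=.
    apply: eq_bigr => j _; rewrite mulr_sumr; apply: eq_bigr => a _.
    rewrite -(pair_big xpredT xpredT (fun j' b => N j * y j a * (N j' * y j' b) *
       (if j == j' then N j ^+ 2 * K j a b else 0)))/=.
    rewrite (bigD1 j)//= eqxx [X in _ + X]big1 ?addr0; last first.
      by move=> j' jj'; rewrite big1// => b' _; rewrite eq_sym (negPf jj') mulr0.
    rewrite mulr_sumr; apply: eq_bigr => b' _; ring.
  have E3 : F = \sum_j N j ^+ 4 * F + pi ^+ 3 * h W * F.
    by rewrite -WP -mulr_suml -mulrDl addrC subrK mul1r.
  have E4 : \sum_j N j ^+ 4 * F = \sum_j N j ^+ 4 * s j +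
      \sum_j mpolyC n (eps j) * (N j ^+ 2 * y2 j) +
      \sum_j mpolyC n (eps j) * (pi ^+ 3 * h (kap j) * y2 j) +
      \sum_j N j ^+ 4 * (\sum_a \sum_b y j a * y j b * K j a b).
    rewrite -!big_split/=; apply: eq_bigr => j _.
    have [_ _ {1}-> _] := HK j; rewrite -/(y2 j) -kapP; ring.
  have E5 : pi ^+ 2 = \sum_j N j ^+ 4 * pj j ^+ 2 * lin j ^+ 2 + pi ^+ 3 * h W * pi ^+ 2.
    have -> : \sum_j N j ^+ 4 * pj j ^+ 2 * lin j ^+ 2 = (\sum_j N j ^+ 4) * pi ^+ 2.
      by rewrite mulr_suml; apply: eq_bigr => j _; rewrite (piE j) -/(lin j); ring.
    by rewrite -WP -mulrDl addrC subrK mul1r.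
  have E6 : \sum_j mpolyC n eta * (mpolyC n 2^-1 * ((N j ^+ 2 * pj j) ^+ 2 * lag j)) =
      \sum_j mpolyC n eta * (N j ^+ 4 * pj j ^+ 2 *
        (n%:R * \sum_a mpolyC n (th 0 a) ^+ 2 * y j a ^+ 2)) -
      mpolyC n eta * \sum_j N j ^+ 4 * pj j ^+ 2 * lin j ^+ 2.
    rewrite mulr_sumr -sumrB; apply: eq_bigr => j _.
    rewrite [mpolyC n 2^-1 * _]mulrCA lagE; ring.
  have E7 : \sum_j mpolyC n (eps j) * (pi ^+ 3 * h (kap j) * y2 j) =
      pi ^+ 2 * \sum_j mpolyC n (eps j) * (pi * h (kap j) * y2 j).
    rewrite mulr_sumr; apply: eq_bigr => j _; ring.
  rewrite E1 E2 /S E6 {1}E3 E4 E7 /k0.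
  set A1 := \sum_j N j ^+ 4 * s j; set A2 := \sum_j mpolyC n (eps j) * (N j ^+ 2 * y2 j).
  set A3 := \sum_j _ * (pi * _ * _); set A4 := \sum_j N j ^+ 4 * (\sum_a _).
  set A5 := \sum_j mpolyC n eta * _; set A6 := \sum_j N j ^+ 4 * pj j ^+ 2 * _ in E5 *.
  have -> : A6 = pi ^+ 2 - pi ^+ 3 * h W * pi ^+ 2 by rewrite {1}E5 addrK.
  ring.
- move=> z [[j a]|[]] fz Fz; last by rewrite /= pevalC.
  have [i ->] := Zx z (conj fz Fz).
  rewrite /= pevalB pevalC (pevalM (mpolyC n eta)) pevalC (pevalM (n%:R * _)).
  rewrite (pevalM n%:R) (pevalM (N j ^+ 2)) !pevalXn Nx pevalC.
  have -> : peval (n%:R : P) (x i) = n%:R by exact: rmorph_nat.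
  case: eqVneq => [->|_]; last by rewrite expr0n mul0r !mulr0 subr0; case: (HK j).
  by rewrite expr1n mul1r subr_gt0; exact: (Heta (j, a)).
- move=> z [[j a]|[]] [[j' a']|[]] fz Fz; rewrite ?peval0//=.
    have [i ->] := Zx z (conj fz Fz); case: eqVneq => [jj'|]; last by rewrite peval0.
    rewrite pevalM pevalXn Nx; case: eqVneq => [->|_]; last by rewrite expr0n mul0r.
    by have [_ _ _ ->] := HK j; rewrite mulr0.
  have [i ->] := Zx z (conj fz Fz).
  rewrite /k0 pevalB pevalD peval_sum (pevalM (pi * _) F) (pevalM pi) pix !mul0r addr0.
  rewrite (pevalM _ (_ * h W)) (pevalM _ (h W)) pevalXn pix expr0n mul0r mulr0 subr0.
  by rewrite big1// => j _; rewrite pevalM (pevalM _ (y2 j)) (pevalM pi) pix !mul0r mulr0.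
Qed.

End GlobalRepresentation.

(** * The semidefinite relaxation and its moments *)

Section Gram.
Variables (R : realType) (n : nat).
Local Notation P := (mpoly n R).
Implicit Types (p q h : P) (x : 'rV[R]_n).

Lemma gramE t (G : 'M[R]_(nmon n t)) :
  gram G = \sum_a \sum_b G a b *: mpolyX R (mnm_add (mon a) (mon b)).
Proof.
rewrite /gram mxE exchange_big/=; apply: eq_bigr => b _.
rewrite !mxE mulr_suml; apply: eq_bigr => a _.
by rewrite !mxE mpolyXD -mul_mpolyC mulrCA mulrA.
Qed.

Lemma gram_sum t (I : Type) (r : seq I) (G : I -> 'M[R]_(nmon n t)) :
  gram (\sum_(i <- r) G i) = \sum_(i <- r) gram (G i).
Proof.
rewrite gramE; under [RHS]eq_bigr do rewrite gramE.
rewrite [RHS]exchange_big/=; apply: eq_bigr => a _.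
rewrite [RHS]exchange_big/=; apply: eq_bigr => b _.
by rewrite summxE scaler_suml.
Qed.

Definition coef_vec t h : 'rV[R]_(nmon n t) := \row_a mcoeff (mon a) h.

Lemma sum_mon (V : nmodType) t (F : multinom n -> V) :
  \sum_(a < nmon n t) F (mon a) = \sum_(c : bmultinom n t.+1) F (bmnm c).
Proof. by rewrite (big_enum_val (A := predT) (fun c => F (bmnm c))). Qed.

Lemma gram_square t h : (mmeasure mdeg h <= t.+1)%N ->
  gram ((coef_vec t h)^T *m coef_vec t h) = h ^+ 2.
Proof.
move=> ht; have hE : h = \sum_(a < nmon n t) mcoeff (mon a) h *: mpolyX R (mon a).
  by rewrite (@sum_mon _ t (fun c => mcoeff c h *: mpolyX R c)); exact: mpolywE.
rewrite {3}hE expr2 big_distrlr gramE; apply: eq_bigr => a _; apply: eq_bigr => b _.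
rewrite mxE big_ord1 !mxE mpolyXD -!mul_mpolyC rmorphM/=; ring.
Qed.

Lemma gram_eval_ge0 t (G : 'M[R]_(nmon n t)) x : psd G -> 0 <= peval (gram G) x.
Proof.
move=> [_ /(_ (\row_a peval (mpolyX R (mon a)) x))].
rewrite form_mxE gramE peval_sum; congr (0 <= _).
apply: eq_bigr => a _; rewrite peval_sum; apply: eq_bigr => b _.
by rewrite !mxE pevalZ mpolyXD pevalM mulrC.
Qed.

Lemma mcoeff_gram t (G : 'M[R]_(nmon n t)) e : mcoeff e (gram G) = \tr (hankel R t e *m G).
Proof.
rewrite gramE mxtrace_mulC raddf_sum; apply: eq_bigr => a _.
rewrite raddf_sum mxE; apply: eq_bigr => b _.
by rewrite /= mcoeffZ mcoeffX mxE addmC.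
Qed.

(** The product formula in the shape used by [Bg]: the sum ranges over bounded [z] below [c], where
    [mnm_sub] is a true difference. *)
Lemma mcoeff_mul_bounded D p q c : (mmeasure mdeg p <= D)%N ->
  mcoeff c (p * q) = \sum_(z : bmultinom n D | mpoly.lem z c) mcoeff z p * mcoeff (mnm_sub c z) q.
Proof.
move=> pD; rewrite {1}(mpolywE pD) mulr_suml raddf_sum/= [RHS]big_mkcond/=.
apply: eq_bigr => z _; rewrite -scalerAl mcoeffZ mulrC.
case: ifPn => zc.
  by rewrite mulrC -{1}(submK zc) addmC [mpolyX R z * q]mulrC mcoeffMX.
apply/eqP; rewrite mulf_eq0; apply/orP; left; apply/eqP.
rewrite [q]mpolyE mulr_sumr raddf_sum big1// => k _.
rewrite -scalerAr -mpolyXD /= mcoeffZ mcoeffX; case: eqVneq => [E|_]; last by rewrite mulr0.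
by move: zc; rewrite -E lem_addr.
Qed.

(** [mmeasure mdeg] is one more than the degree, and 0 at the zero polynomial. *)
Lemma mmeasure_le_half_deg p : (mmeasure mdeg p <= (2 * half_deg p).+1)%N.
Proof.
rewrite /half_deg /pdeg; case: (mmeasure mdeg p) => //= d; rewrite ltnS mul2n.
by rewrite -{1}(odd_double_half d) uphalf_half doubleD leq_add2r; case: (odd d).
Qed.

Lemma peval_bounded D p x : (mmeasure mdeg p <= D)%N ->
  peval p x = \sum_(c : bmultinom n D) mcoeff c p * \prod_i x 0 i ^+ c i.
Proof.
move=> /mpolywE {1}->; rewrite peval_sum; apply: eq_bigr => c _.
by rewrite pevalZ /peval mevalX.
Qed.

Lemma mmeasure_le D p : (forall c, (D <= mdeg c)%N -> mcoeff c p = 0) ->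
  (mmeasure mdeg p <= D)%N.
Proof.
move=> h; rewrite mmeasureE; apply/bigmax_leqP_seq => c cp _; rewrite ltnNge.
by apply/negP => /h/eqP; rewrite mcoeff_eq0 cp.
Qed.

Lemma mon_deg t (a : 'I_(nmon n t)) : (mdeg (mon a) <= t)%N.
Proof. by rewrite -ltnS; exact: bmdeg. Qed.

Lemma mon_inj t : injective (@mon n t).
Proof. by move=> a b ab; apply: enum_val_inj; apply: val_inj. Qed.

Lemma hankel_eq0 t e : (t.*2 < mdeg e)%N -> @hankel R n t e = 0.
Proof.
move=> te; apply/matrixP => a b; rewrite !mxE; case: eqVneq => // E.
by move: te; rewrite -E mdegD ltnNge -addnn leq_add// mon_deg.
Qed.

Lemma hankel_sym t e : (@hankel R n t e)^T = hankel R t e.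
Proof. by apply/matrixP => a b; rewrite !mxE addmC. Qed.

(** A row or column of [hankel] has at most one entry 1, since [mon] is injective; so 2 |u_a u_b| <=
    u_a^2 + u_b^2 suffices. *)
Lemma hankel_form_le t e (u : 'rV[R]_(nmon n t)) :
  `|(u *m hankel R t e *m u^T) 0 0| <= dotr u u.
Proof.
rewrite mxE dotrE; under eq_bigr do rewrite mxE mulr_suml.
have row_le (a : 'I_(nmon n t)) :
    \sum_(b < nmon n t) (mnm_add (mon a) (mon b) == e)%:R * (u 0 a ^+ 2) <= u 0 a ^+ 2.
  rewrite -mulr_suml; apply: ler_piMl; first exact: sqr_ge0.
  have [[b0 bE]|nb] := pselect (exists b : 'I_(nmon n t), mnm_add (mon a) (mon b) = e).
    rewrite (bigD1 b0) //= bE eqxx big1 ?addr0// => b bb0.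
    case: eqVneq => //; rewrite -bE => /eqP; rewrite eqm_add2l => /eqP/mon_inj E.
    by rewrite E eqxx in bb0.
  rewrite big1 ?ler01// => b _; case: eqVneq => // E.
  by case: nb; exists b.
apply: le_trans (ler_norm_sum _ _ _) _.
apply: (@le_trans _ _ (\sum_b \sum_a (mnm_add (mon a) (mon b) == e)%:R *
    (u 0 a ^+ 2 / 2 + u 0 b ^+ 2 / 2))).
  apply: ler_sum => b _; apply: le_trans (ler_norm_sum _ _ _) _.
  apply: ler_sum => a _; rewrite !mxE; case: eqVneq => _; last first.
    by rewrite mulr0 mul0r normr0 mul0r.
  rewrite mulr1 mul1r ler_norml; have h1 := sqr_ge0 (u 0 a + u 0 b).
  have h2 := sqr_ge0 (u 0 a - u 0 b); rewrite sqrrD in h1; rewrite sqrrB in h2.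
  by apply/andP; split; lra.
under eq_bigr do under eq_bigr do rewrite mulrDr.
under eq_bigr do rewrite big_split/=.
rewrite big_split/= exchange_big/=.
under [X in _ + X <= _]eq_bigr do under eq_bigr do rewrite addmC.
rewrite -big_split/=; apply: ler_sum => a _; rewrite -big_split/=.
under eq_bigr do rewrite -mulrDr -splitr.
by rewrite -expr2; exact: row_le.
Qed.

Lemma l1norm_bounded D p : \sum_(z : bmultinom n D) `|mcoeff z p| <= l1norm p.
Proof.
rewrite /l1norm (bigID (fun z : bmultinom n D => bmnm z \in msupp p))/=.
rewrite [X in _ + X]big1 ?addr0; last first.
  by move=> z; rewrite -mcoeff_eq0 => /eqP ->; rewrite normr0.
rewrite -(big_map (fun z : bmultinom n D => bmnm z) (fun c => c \in msupp p) (fun c => `|mcoeff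
  c p|)).
rewrite -[leLHS]big_filter; set s := seq.filter _ _.
have us : uniq s.
  by apply: filter_uniq; rewrite map_inj_uniq ?index_enum_uniq//; exact: val_inj.
have ss : {subset s <= msupp p} by move=> c; rewrite mem_filter => /andP[].
rewrite [leRHS](perm_big (s ++ [seq c <- msupp p | c \notin s])); last first.
  apply: uniq_perm; rewrite ?msupp_uniq//.
    rewrite cat_uniq us filter_uniq ?msupp_uniq// andbT/=.
    by apply/hasPn => c; rewrite mem_filter => /andP[].
  by move=> c; rewrite mem_cat mem_filter; case: (boolP (c \in s)) => //= /ss ->.
by rewrite big_cat lerDl sumr_ge0.
Qed.

End Gram.

(** * Sums of monomials at a point of small l1 norm *)

Section MonomialSum.
Variable R : realType.

Lemma prod_sub_ge (I : Type) (r : seq I) (y : I -> R) : (forall i, 0 <= y i <= 1) ->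
  1 - \sum_(i <- r) y i <= \prod_(i <- r) (1 - y i) <= 1.
Proof.
move=> y01; elim: r => [|i r /andP[IH1 IH2]]; first by rewrite !big_nil subr0 lexx.
rewrite !big_cons; have /andP[y0 y1] := y01 i.
set S := \sum_(_ <- _) _ in IH1 *; set Q := \prod_(_ <- _) _ in IH1 IH2 *.
have S0 : 0 <= S by apply: sumr_ge0 => j _; case/andP: (y01 j).
apply/andP; split; nra.
Qed.

(** All monomials together are dominated by the product of the geometric series in |x_i|, and the
    product of the 1 - |x_i| is at least 1 - sum |x_i| >= 1 - r. Removing the constant monomial
    leaves 1/(1 - r) - 1. *)
Lemma sum_monomials_le n D (x : 'rV[R]_n) (r : R) : 0 < r -> r < 1 ->
  \sum_i `|x 0 i| <= r ->
  \sum_(c : bmultinom n D.+1 | bmnm c != mnm0) `|\prod_i x 0 i ^+ bmnm c i| <= r / (1 - r).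
Proof.
move=> r0 r1 xr.
have yr i : `|x 0 i| <= r.
  by apply: le_trans xr; rewrite (bigD1 i)//= lerDl sumr_ge0.
have r1' : 0 < 1 - r by rewrite subr_gt0.
have tot : \sum_(c : bmultinom n D.+1) `|\prod_i x 0 i ^+ bmnm c i| <= (1 - r)^-1.
  apply: (@le_trans _ _ (\prod_i \sum_(t < D.+1) `|x 0 i| ^+ t)).
    rewrite bigA_distr_bigA/=.
    (* Exponents of total degree at most [D] embed into the box of exponents at most [D] in each
       variable, over which the product of the series expands. *)
    pose phi (c : bmultinom n D.+1) : {ffun 'I_n -> 'I_D.+1} := [ffun i => inord (bmnm c i)].
    have phiE c i : phi c i = bmnm c i :> nat.
      rewrite ffunE inordK//; apply: leq_ltn_trans (bmdeg c).
      by rewrite mdegE (bigD1 i)//= leq_addr.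
    have phi_inj : injective phi.
      move=> c c' E; apply: val_inj; apply/mnmP => i /=.
      by rewrite -!phiE E.
    rewrite (eq_bigr (fun c => \prod_i `|x 0 i| ^+ phi c i)); last first.
      move=> c _; rewrite normr_prod; apply: eq_bigr => i _.
      by rewrite normrX phiE.
    pose G (k : {ffun 'I_n -> 'I_D.+1}) := \prod_i `|x 0 i| ^+ k i.
    rewrite -[leLHS](big_map phi xpredT G) [leLHS]big_uniq/=; last first.
      by rewrite map_inj_uniq// index_enum_uniq.
    rewrite [leRHS](bigID (mem (map phi (index_enum (bmultinom n D.+1)))))/=.
    by rewrite lerDl sumr_ge0// => k _; apply: prodr_ge0 => i _; exact: exprn_ge0.
  rewrite -[leRHS]mul1r ler_pdivlMr//.
  have y01 i : 0 <= `|x 0 i| <= 1 by rewrite normr_ge0 (le_trans (yr i))// ltW.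
  have gs i : (\sum_(t < D.+1) `|x 0 i| ^+ t) * (1 - `|x 0 i|) <= 1.
    by rewrite mulrC -opprB mulNr -subrX1 opprB lerBlDr lerDl exprn_ge0.
  apply: (@le_trans _ _ (\prod_i ((\sum_(t < D.+1) `|x 0 i| ^+ t) * (1 - `|x 0 i|)))).
    rewrite big_split/=; apply: ler_wpM2l.
      by apply: prodr_ge0 => i _; apply: sumr_ge0 => t _; exact: exprn_ge0.
    have /andP[h _] := prod_sub_ge (index_enum 'I_n) y01.
    by apply: le_trans h; rewrite lerD2l lerN2.
  apply: prodr_ile1 => i _; rewrite gs andbT; have /andP[_ y1] := y01 i.
  by rewrite mulr_ge0// ?subr_ge0// sumr_ge0// => t _; exact: exprn_ge0.
have -> : r / (1 - r) = (1 - r)^-1 - 1 by field; rewrite gt_eqF.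
rewrite lerBrDl; apply: le_trans tot; rewrite [leRHS](bigD1 (bm0 : bmultinom n D.+1))//=.
rewrite [X in X + _ <= _](_ : 1 = `|\prod_i x 0 i ^+ bmnm (bm0 : bmultinom n D.+1) i|);
  last first.
  by rewrite big1 ?normr1// => i _; rewrite mnm0E expr0.
by rewrite lerD2l.
Qed.

End MonomialSum.

(** * The constraint matrices as coefficients of polynomials *)

Section CONLemmas.
Variables (R : realType) (n m : nat) (g : 'I_m.+1 -> mpoly n R) (k : nat).
Implicit Types (f p : mpoly n R) (x : 'rV[R]_n) (c : multinom n).

Definition Bblock c i : 'M[R]_(blk g k i) :=
  \sum_(z : bmultinom n (2 * half_deg (g i)).+1 | mpoly.lem z c)
    mcoeff z (g i) *: hankel R (k - half_deg (g i)) (mnm_sub c z).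

Definition sos_combination (G : forall i, 'M[R]_(blk g k i)) : mpoly n R :=
  \sum_(i < m.+1) g i * gram (G i).

Lemma mcoeff_sos_combination (G : forall i, 'M[R]_(blk g k i)) c :
  mcoeff c (sos_combination G) = \sum_i \tr (Bblock c i *m G i).
Proof.
rewrite raddf_sum; apply: eq_bigr => i _.
rewrite /= (mcoeff_mul_bounded _ _ (mmeasure_le_half_deg (g i))) /Bblock mulmx_suml raddf_sum.
by apply: eq_bigr => z _; rewrite /= mcoeff_gram -scalemxAl mxtraceZ.
Qed.

(** Off-diagonal blocks and the slack entry are invisible to the constraints: every [P] acts like a
    Gram certificate built from its diagonal blocks. *)
Lemma tr_con_mx c (P : 'M[R]_(\sum_i blk g k i + 1)) :
  \tr (con_mx g k c *m P) = mcoeff c (sos_combination (fun i => submxblock (ulsubmx P) i i)).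
Proof.
rewrite mcoeff_sos_combination -tr_mxdiag_mul /con_mx -{1}(submxK P) mulmx_block.
by rewrite !mul0mx !addr0 mxtrace_block mxtrace0 addr0.
Qed.

Lemma tr_con_mx_block c (G : forall i, 'M[R]_(blk g k i)) b :
  \tr (con_mx g k c *m block_mx (\mxdiag_i G i) 0 0 b) = mcoeff c (sos_combination G).
Proof.
rewrite mcoeff_sos_combination /con_mx mulmx_block !mul0mx !addr0 mxtrace_block.
by rewrite mxtrace0 addr0 /Bg tr_mxdiag_mxdiag.
Qed.

Lemma con_mx_sym c : (con_mx g k c)^T = con_mx g k c.
Proof.
rewrite /con_mx tr_block_mx !trmx0 /Bg tr_mxdiag; congr block_mx; apply/eq_mxdiagP => i.
by rewrite linear_sum; apply: eq_bigr => z _; rewrite /= linearZ/= hankel_sym.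
Qed.

(** A block combines matrices [hankel], of norm at most 1, with weights of total absolute value at
    most [l1norm (g i)]. Hamiltonian updates need this to keep M = (1 - A)/2 between 0 and 1. *)
Lemma con_mx_contraction c : (forall i, l1norm (g i) <= 1) ->
  psd (1%:M - con_mx g k c) /\ psd (1%:M + con_mx g k c).
Proof.
move=> g1; apply: psd_of_bounded_form; first exact: con_mx_sym.
move=> u; rewrite -(hsubmxK u) /con_mx mul_row_block tr_row_mx mul_row_col !mulmx0.
rewrite !addr0 mul0mx addr0 mxdiag_form.
apply: le_trans (ler_norm_sum _ _ _) _.
have -> : dotr (row_mx (lsubmx u) (rsubmx u)) (row_mx (lsubmx u) (rsubmx u)) =
    dotr (lsubmx u) (lsubmx u) + dotr (rsubmx u) (rsubmx u).
  by rewrite /dotr tr_row_mx mul_row_col mxE.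
apply: ler_wpDr; first exact: dotr_ge0.
rewrite dotr_submxrow; apply: ler_sum => i _; set v := submxrow _ i.
rewrite mulmx_sumr mulmx_suml summxE; apply: le_trans (ler_norm_sum _ _ _) _.
apply: (@le_trans _ _ (\sum_(z : bmultinom n (2 * half_deg (g i)).+1)
    `|mcoeff z (g i)| * dotr v v)).
  rewrite big_mkcond/=; apply: ler_sum => z _; case: ifP => _; last first.
    by rewrite mulr_ge0// dotr_ge0.
  rewrite -scalemxAr -scalemxAl mxE normrM; apply: ler_wpM2l => //.
  exact: hankel_form_le.
rewrite -mulr_suml; apply: ler_piMl; first exact: dotr_ge0.
exact: le_trans (l1norm_bounded _ _) (g1 i).
Qed.

Lemma sos_combination_deg (G : forall i, 'M[R]_(blk g k i)) :
  (forall i, (half_deg (g i) <= k)%N) -> (mmeasure mdeg (sos_combination G) <= (2 * k).+1)%N.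
Proof.
move=> gk; apply: mmeasure_le => c kc; rewrite mcoeff_sos_combination big1// => i _.
rewrite /Bblock big1 ?mul0mx ?mxtrace0// => z zc; rewrite hankel_eq0 ?scaler0//.
have := congr1 mdeg (submK zc); rewrite mdegD => E.
have zd : (mdeg z <= 2 * half_deg (g i))%N by rewrite -ltnS; exact: bmdeg.
rewrite -mul2n mulnBr ltn_subLR ?leq_mul2l ?gk//.
by apply: leq_trans kc _; rewrite -E addnC leq_add2r.
Qed.

Lemma sum_con_index (V : nmodType) (F : multinom n -> V) :
  \sum_(c : bmultinom n (2 * k).+1 | bmnm c != mnm0) F (bmnm c) =
  \sum_(c : con_index n k) F (bmnm (val c)).
Proof.
rewrite (reindex_omap (val : con_index n k -> bmultinom n (2 * k).+1) insub)/=.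
  by apply: eq_bigl => c; rewrite valK eqxx andbT; exact: (valP c).
by move=> c c0; rewrite insubT.
Qed.

Lemma peval_con p x : (mmeasure mdeg p <= (2 * k).+1)%N ->
  peval p x = mcoeff mnm0 p +
    \sum_(c : con_index n k) mcoeff (val c) p * \prod_i x 0 i ^+ bmnm (val c) i.
Proof.
move=> pk; rewrite (peval_bounded x pk) (bigD1 (bm0 : bmultinom n (2 * k).+1))//=.
rewrite big1 ?mulr1; last by move=> i _; rewrite mnm0E.
congr (_ + _); exact: (sum_con_index (fun c => mcoeff c p * \prod_i x 0 i ^+ c i)).
Qed.

Hypothesis g0E : g ord0 = 1.

Lemma feasible_ge0 x i : feasible g x -> 0 <= peval (g i) x.
Proof.
move=> fx; case: (unliftP ord0 i) => [j ->|->]; first exact: fx.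
by rewrite g0E peval1.
Qed.

Lemma sos_combination_ge0 x (G : forall i, 'M[R]_(blk g k i)) :
  feasible g x -> (forall i, psd (G i)) -> 0 <= peval (sos_combination G) x.
Proof.
move=> fx pG; rewrite /sos_combination peval_sum sumr_ge0// => i _.
by rewrite pevalM; apply: mulr_ge0; [exact: feasible_ge0 | exact: (gram_eval_ge0 x (pG i))].
Qed.

Lemma l1norm_le1 : (forall i : 'I_m, l1norm (g (lift ord0 i)) <= 1) ->
  forall i, l1norm (g i) <= 1.
Proof.
move=> gl i; case: (unliftP ord0 i) => [j ->|->]; first exact: gl.
by rewrite g0E /l1norm msupp1 big_seq1 mcoeff1 eqxx normr1.
Qed.

(** This provides [C_min] of the binary search, with [delta = eps * (r / (1 - r))]. Constant terms
    are not compared with each other: that of [q] is the objective at [P]. *)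
Lemma con_constant_le f x (eps r : R) (P : 'M[R]_(\sum_i blk g k i + 1)) :
  0 <= eps -> 0 < r -> r < 1 -> \sum_j `|x 0 j| <= r -> feasible g x ->
  (half_deg f <= k)%N -> (forall i, (half_deg (g i) <= k)%N) -> psd P ->
  (forall c : con_index n k,
    `|mcoeff (val c) f - \tr (con_mx g k (val c) *m P)| <= eps) ->
  mcoeff mnm0 f - peval f x <= \tr (con_mx g k mnm0 *m P) + eps * (r / (1 - r)).
Proof.
move=> e0 r0 r1 xr fx fk gk pP ap.
rewrite tr_con_mx; set q := sos_combination _.
have q0 : 0 <= peval q x.
  apply: sos_combination_ge0 => // i; apply: psd_mxsub.
  rewrite (_ : ulsubmx P = mxsub (lshift 1) (lshift 1) P); first exact: psd_mxsub.
  by apply/matrixP => a b; rewrite !mxE.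
have qk : (mmeasure mdeg q <= (2 * k).+1)%N by exact: sos_combination_deg.
have fd : (mmeasure mdeg f <= (2 * k).+1)%N.
  by apply: leq_trans (mmeasure_le_half_deg f) _; rewrite ltnS leq_mul2l fk orbT.
rewrite (peval_con x fd) opprD addNKr lerNl.
apply: le_trans (_ : - (mcoeff mnm0 q + eps * (r / (1 - r))) + peval q x <= _).
  by rewrite lerDl.
rewrite (peval_con x qk) opprD.
set Sq := \sum_c _; set Sf := \sum_c _.
suff : Sq - Sf <= eps * (r / (1 - r)) by lra.
rewrite /Sq /Sf -sumrB.
apply: (@le_trans _ _ (\sum_(c : con_index n k) eps * `|\prod_i x 0 i ^+ bmnm (val c) i|)).
  apply: ler_sum => c _; rewrite -mulrBl; apply: le_trans (ler_norm _) _.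
  rewrite normrM; apply: ler_wpM2r => //; have := ap c.
  by rewrite distrC tr_con_mx.
rewrite -mulr_sumr; apply: ler_wpM2l => //.
rewrite -(sum_con_index (fun c => `|\prod_i x 0 i ^+ c i|)); exact: sum_monomials_le.
Qed.

End CONLemmas.

Section Certificates.
Variables (R : realType) (n m : nat) (g : 'I_m.+1 -> mpoly n R).

(** [K] bounds the degrees of the finitely many squares, so one certificate serves all larger
    orders, its Gram matrices being sums of rank-one matrices of coefficients. *)
Lemma qmod_sos_combination p : qmod g p -> exists K, forall k, (K <= k)%N ->
  exists G : forall i, 'M[R]_(blk g k i), (forall i, psd (G i)) /\ p = sos_combination G.
Proof.
move=> [s ->].
exists (\max_(i < m.+1) \max_(h <- s i) (mmeasure mdeg h + half_deg (g i)))%N => k Kk.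
exists (fun i => \sum_(h <- s i) (coef_vec (k - half_deg (g i)) h)^T *m coef_vec _ h); split.
  move=> i; elim/big_ind : _ => [||h _]; [exact: psd0|move=> A B; exact: psdD|].
  rewrite -[X in _ *m X]trmxK -[X in X *m _]mulmx1; apply: psd_congruence.
  by split=> [|u]; rewrite ?trmx1// mulmx1; exact: dotr_ge0.
apply: eq_bigr => i _; congr (_ * _); rewrite gram_sum [LHS]big_seq [RHS]big_seq.
apply: eq_bigr => h hs; rewrite gram_square//.
have hk : (mmeasure mdeg h + half_deg (g i) <= k)%N.
  apply: leq_trans Kk; apply: leq_trans (leq_bigmax i).
  exact: leq_bigmax_seq.
by apply: leqW; rewrite leq_subRL ?(leq_trans (leq_addl _ _) hk)// addnC.
Qed.

End Certificates.

Section Moments.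
Variables (R : realType) (n : nat).
Variable mu : {measure set (borelRn R n) -> \bar R}.
Hypothesis mu_moments : finite_moments mu.
Implicit Types p q : mpoly n R.

Lemma integrable_peval p : mu.-integrable setT (fun x => (peval p x)%:E).
Proof.
elim/mpolyind : p => [|a e p _ _ ip].
  by under eq_fun do rewrite peval0; exact: integrable0.
under eq_fun do rewrite pevalD pevalZ EFinD EFinM.
by apply: integrableD => //; apply: integrableZl => //; exact: mu_moments.
Qed.

Lemma integral_pevalD p q :
  (\int[mu]_x peval (p + q) x = \int[mu]_x peval p x + \int[mu]_x peval q x)%R.
Proof.
under eq_Rintegral do rewrite pevalD.
by rewrite RintegralD//; exact: integrable_peval.
Qed.

Lemma integral_pevalZ a p :
  (\int[mu]_x peval (a *: p) x = a * \int[mu]_x peval p x)%R.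
Proof.
under eq_Rintegral do rewrite pevalZ.
by rewrite RintegralZl//; exact: integrable_peval.
Qed.

Lemma integral_peval_sum (I : Type) (s : seq I) (F : I -> mpoly n R) :
  (\int[mu]_x peval (\sum_(i <- s) F i) x = \sum_(i <- s) \int[mu]_x peval (F i) x)%R.
Proof.
apply: (big_morph (fun p => \int[mu]_x peval p x)%R integral_pevalD).
by rewrite -(scale0r 0) integral_pevalZ mul0r.
Qed.

Lemma moment0_ge0 : 0 <= moment mu mnm0.
Proof. by apply: Rintegral_ge0 => x _; rewrite mpolyX0 peval1. Qed.

Lemma integral_localizing t p (G : 'M[R]_(nmon n t)) :
  (\int[mu]_x peval (p * gram G) x)%R = \tr (localizing t p (moment mu) *m G).
Proof.
rewrite gramE mxtrace_mulC mulr_sumr integral_peval_sum; apply: eq_bigr => a _.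
rewrite mulr_sumr integral_peval_sum mxE; apply: eq_bigr => b _.
rewrite -scalerAr integral_pevalZ mxE; congr (_ * _).
rewrite {1}[p]mpolyE mulr_suml integral_peval_sum; apply: eq_bigr => c _.
rewrite -scalerAl -mpolyXD integral_pevalZ; congr (_ * moment mu _).
by rewrite addmC [mnm_add (mon b) _]addmC.
Qed.

Lemma localizing_sym t p : (localizing t p (moment mu))^T = localizing t p (moment mu).
Proof.
apply/matrixP => a b; rewrite !mxE; apply: eq_bigr => c _.
by rewrite [mnm_add (mon b) _]addmC.
Qed.

Lemma integral_sos_combination m (g : 'I_m.+1 -> mpoly n R) k
    (G : forall i, 'M[R]_(blk g k i)) :
  (\int[mu]_x peval (sos_combination G) x)%R =
  \tr (moment_matrix g k (moment mu) *m \mxdiag_i G i).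
Proof.
rewrite tr_mxdiag_mxdiag integral_peval_sum; apply: eq_bigr => i _.
exact: integral_localizing.
Qed.

Lemma tr_certificate_le1 f m (g : 'I_m.+1 -> mpoly n R) k (l0 l : R)
    (G : forall i, 'M[R]_(blk g k i)) :
  l <= l0 -> f - mpolyC n l0 = sos_combination G -> (forall i, psd (G i)) ->
  0 < lambda_min (moment_matrix g k (moment mu)) ->
  (\int[mu]_x (peval f x - l))%R / lambda_min (moment_matrix g k (moment mu)) <= 1 ->
  \tr (\mxdiag_i G i) <= 1.
Proof.
move=> ll fE pG lmin0; rewrite ler_pdivrMr// mul1r => le_lmin.
rewrite -(ler_pM2l lmin0) mulr1; apply: le_trans le_lmin.
apply: le_trans (lambda_min_le _ (psd_mxdiag pG)) _.
  by rewrite tr_mxdiag; apply/eq_mxdiagP => i; exact: localizing_sym.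
rewrite -integral_sos_combination -fE.
(* Passing from [l0] down to [l] adds [l0 - l] times the mass of [mu], which is nonnegative. *)
have -> : (\int[mu]_x (peval f x - l))%R =
    (\int[mu]_x peval (f - mpolyC n l0) x)%R + (l0 - l) * moment mu mnm0.
  rewrite /moment -integral_pevalZ -integral_pevalD; apply: eq_Rintegral => x _.
  by rewrite mpolyX0 pevalD pevalB pevalC pevalZ peval1; ring.
by rewrite lerDl mulr_ge0 ?subr_ge0// moment0_ge0.
Qed.

End Moments.

Theorem corollary1 (R : realType) (n m : nat) (eps : R)
    (f : mpoly n R) (g : 'I_m.+1 -> mpoly n R)
    (c rad r : R) (xstar : 'rV[R]_n)
    (eps_gt0 : 0 < eps) (m_gt0 : (0 < m)%N)
    (g0E : g ord0 = 1)
    (c_gt0 : 0 < c) (rad_gt0 : 0 < rad)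
    (g1E : g (inord 1) =
           c *: (mpolyC n rad - \sum_(j < n) mpolyX R (mnm1 j) ^+ 2))
    (g_l1 : forall i : 'I_m, l1norm (g (lift ord0 i)) <= 1)
    (r_gt0 : 0 < r) (r_lt1 : r < 1)
    (xstar_opt : optimal_solution f g xstar)
    (xstar_l1 : \sum_(j < n) `|xstar 0 j| <= r)
    (sosc : forall x : 'rV[R]_n,
        optimal_solution f g x -> second_order_sufficient f g x) :
  exists K : nat, forall k : nat, (K <= k)%N -> relaxation_order f g k ->
    sos_value f g k = (opt_value f g)%:E /\
    forall (llow : R) (mu : {measure set (borelRn R n) -> \bar R})
           (a : 'rV[R]_n) (v : R),
      (llow%:E <= sos_value f g k)%E ->
      finite_moments mu ->
      mu (~` feasible g) = 0%E ->
      0 < lambda_min (moment_matrix g k (moment mu)) ->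
      (\int[mu]_x (peval f x - llow))%R
        / lambda_min (moment_matrix g k (moment mu)) <= 1 ->
      feasible g a ->
      con_lmin f a < con_lmax f llow ->
      con_output f g k eps llow a v ->
      0 <= v - opt_value f g <= eps * (2 + r / (1 - r)).
Proof.
have [xstar_feas xstar_min] := xstar_opt.
have -> : opt_value f g = peval f xstar.
  apply/eqP; rewrite eq_le; apply/andP; split.
    apply: ge_inf; last by exists xstar.
    by exists (peval f xstar) => _ [y fy <-]; exact: xstar_min.
  apply: lb_le_inf; first by exists (peval f xstar); exists xstar.
  by move=> _ [y fy <-]; exact: xstar_min.
have g1E' : g (lift ord0 (Ordinal m_gt0)) = c *: (mpolyC n rad - \sum_j var R j ^+ 2).
  by rewrite -g1E; congr g; apply: val_inj; rewrite /= inordK.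
have [|K sosK] := @qmod_sos_combination _ _ _ g (f - mpolyC n (peval f xstar)).
  apply: (qmod_sub_minimum g0E c_gt0 rad_gt0 g1E' xstar_min) => x fx fxE.
  by apply: sosc; split=> // y /xstar_min; rewrite fxE.
exists K => k /sosK[G [pG fE]]; rewrite /relaxation_order geq_max => /andP[fk /bigmax_leqP gk].
have {}gk i : (half_deg (g i) <= k)%N by exact: gk.
(* Any certificate for [l], evaluated at [xstar], bounds [l] by the value of [f] there; [G] attains
   this value. *)
have sosE : sos_value f g k = (peval f xstar)%:E.
  apply/eqP; rewrite eq_le; apply/andP; split.
    apply: ge_ereal_sup => _ [l [G' [pG' fE']] <-]; rewrite lee_fin -subr_ge0.
    suff : 0 <= peval (f - mpolyC n l) xstar by rewrite pevalB pevalC.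
    rewrite fE'; apply: (sos_combination_ge0 g0E xstar_feas) => i.
    exact: psd_mxdiag_block pG'.
  apply: ereal_sup_ubound; exists (peval f xstar) => //; exists G.
  by split=> //; exact: psd_mxdiag.
split=> // llow mu a v; rewrite sosE lee_fin => low_le mu_moments _ lmin_gt0 trace_bound fa ll.
move=> [l out ->].
have trG := tr_certificate_le1 mu_moments low_le fE pG lmin_gt0 trace_bound.
(* [con_mx] is zero on the last diagonal entry, so that entry can bring the trace to one without
   changing any constraint. *)
pose X : 'M[R]_(\sum_i blk g k i + 1) := block_mx (\mxdiag_i G i) 0 0 (1 - \tr (\mxdiag_i G
  i))%:M.
have g_l1' := l1norm_le1 g0E g_l1.
have trX c' : \tr (con_mx g k c' *m X) = mcoeff c' (f - mpolyC n (peval f xstar)).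
  by rewrite tr_con_mx_block fE.
have trX0 : \tr (con_mx g k mnm0 *m X) = mcoeff mnm0 f - peval f xstar.
  by rewrite trX mcoeffB mcoeffC eqxx mulr1.
have trXc (c' : con_index n k) : \tr (con_mx g k (val c') *m X) = mcoeff (val c') f.
  rewrite trX mcoeffB mcoeffC; have /negPf := valP c'; rewrite /= eq_sym => ->.
  by rewrite mulr0 subr0.
have pX : psd X by apply: psd_block_scalar; [exact: psd_mxdiag | rewrite subr_ge0].
have tX : \tr X = 1 by rewrite mxtrace_block mxtrace_scalar mulr1n addrC subrK.
(* The first block contains the monomial 1, and the slack entry is one more. *)
have N_gt1 : (1 < \sum_i blk g k i + 1)%N.
  rewrite addn1 ltnS (bigD1 ord0)//= ltn_addr// /blk /nmon.
  by apply/card_gt0P; exists bm0.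
have contr c' := con_mx_contraction k c' g_l1'.
have C_min (P : 'M[R]_(\sum_i blk g k i + 1)) : psd P -> \tr P = 1 ->
    (forall c' : con_index n k,
      `|mcoeff (val c') f - \tr (con_mx g k (val c') *m P)| <= eps) ->
    \tr (con_mx g k mnm0 *m X) <= \tr (con_mx g k mnm0 *m P) + eps * (r / (1 - r)).
  move=> pP _ ap; rewrite trX0.
  by apply: con_constant_le => //; exact: ltW.
have := @bs_output_bounds R _ N_gt1 _ eps _ _ _ eps_gt0 (contr mnm0).1 (contr mnm0).2
  (con_mx_sym g k mnm0) (fun c' : con_index n k => (contr (val c')).1)
  (fun c' : con_index n k => (contr (val c')).2)
  (fun c' : con_index n k => con_mx_sym g k (val c')) X _ pX tX trXc C_min _ _ _ out ll.
(* The objective at [X] is [f_0 - f(xstar)], so that it lies in the initial interval because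
   [f(xstar) <= f(a)] and [llow <= f(xstar)]. Subtraction from [f_0] turns the lower end kept by the
   search into an upper bound on the optimal value. *)
rewrite trX0 lerD2l lerN2 lerD2l lerN2 => /(_ (xstar_min _ fa) low_le).
have -> : 0 <= eps * (r / (1 - r)).
  by rewrite mulr_ge0 ?ltW// divr_gt0// subr_gt0.
by move=> /(_ isT)/andP[h1 h2]; apply/andP; split; lra.
Qed.
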